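(* Let $1<p<\infty$ and let $f=h+\overline{g}:\mathbb{D}\to\mathbb{C}$ be a uniformly locally univalent, sense-preserving harmonic mapping whose dilatation $w$ belongs to $\mathcal{B}_p$ and satisfies $\|w\|<1$. If $F=\log J_f\in\widetilde{\mathcal{B}}_p$, then $$I(f):=\int_{\mathbb{D}}|S_f(z)|^p(1-|z|^2)^{2p-2}\,dA(z)<\infty.$$
   Context: $\mathbb{D}$ is the unit disk and $dA$ is Lebesgue area measure. A sense-preserving locally univalent harmonic mapping $f:\mathbb{D}\to\mathbb{C}$ is written $f=h+\overline{g}$ with $h,g$ analytic in $\mathbb{D}$, $h(0)=g(0)=0$, $h'\neq 0$ in $\mathbb{D}$; its dilatation is $w=g'/h'$, an analytic function with $|w|<1$ in $\mathbb{D}$, and its Jacobian is $J_f=|h'|^2-|g'|^2>0$. Write $\|w\|=\sup_{z\in\mathbb{D}}|w(z)|$. With $\partial_z=\frac12(\partial_x-i\partial_y)$, $\partial_{\bar z}=\frac12(\partial_x+i\partial_y)$ and $F=\log J_f$, the Schwarzian derivative of $f$ is $S_f=F_{zz}-\frac12 F_z^2$; explicitly $S_f=S_h+\frac{\overline{w}}{1-|w|^2}\big(w'\frac{h''}{h'}-w''\big)-\frac32\big(\frac{w'\overline{w}}{1-|w|^2}\big)^2$, where $S_h=(h''/h')'-\frac12(h''/h')^2$ is the classical Schwarzian. The hyperbolic distance is $d_h(z,\xi)=\frac12\log\frac{1+p(z,\xi)}{1-p(z,\xi)}$ with $p(z,\xi)=\left|\frac{z-\xi}{1-\overline{\xi}z}\right|$,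 and $D(a,\rho)$ is the hyperbolic disk of center $a$ and radius $\rho$. A function on $\mathbb{D}$ is uniformly locally univalent if there is $\rho\in(0,\infty]$ such that it is univalent on every $D(a,\rho)$, $a\in\mathbb{D}$. For $1<p<\infty$: the analytic Besov space $\mathcal{B}_p$ consists of analytic $u$ on $\mathbb{D}$ with $\int_{\mathbb{D}}|u'(z)|^p(1-|z|^2)^{p-2}dA(z)<\infty$; $\widetilde{\mathcal{B}}_p$ consists of smooth $G:\mathbb{D}\to\mathbb{C}$ with $\int_{\mathbb{D}}(|G_z(z)|+|G_{\bar z}(z)|)^p(1-|z|^2)^{p-2}dA(z)<\infty$. *)

(* Defs.v *)
From Stdlib Require Import Reals.
From Coquelicot Require Import Coquelicot.

Local Open Scope R_scope.

Definition inD (z : C) : Prop := Cmod z < 1.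

Definition analytic_on_D (u : C -> C) : Prop :=
  forall z : C, inD z -> ex_derive u z.

Definition cder (u : C -> C) : C -> C := C_derive u.

Definition dx (G : C -> C) (z : C) : C :=
  (Derive (fun t => fst (G (t, snd z))) (fst z),
   Derive (fun t => snd (G (t, snd z))) (fst z)).
Definition dy (G : C -> C) (z : C) : C :=
  (Derive (fun t => fst (G (fst z, t))) (snd z),
   Derive (fun t => snd (G (fst z, t))) (snd z)).

Definition Dz (G : C -> C) (z : C) : C :=
  Cmult (RtoC (/2)) (Cminus (dx G z) (Cmult Ci (dy G z))).
Definition Dzb (G : C -> C) (z : C) : C :=
  Cmult (RtoC (/2)) (Cplus (dx G z) (Cmult Ci (dy G z))).

Definition harm (h g : C -> C) (z : C) : C := Cplus (h z) (Cconj (g z)).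

Definition dilatation (h g : C -> C) (z : C) : C := Cdiv (cder g z) (cder h z).

Definition jacobian (h g : C -> C) (z : C) : R :=
  Cmod (cder h z) ^ 2 - Cmod (cder g z) ^ 2.

Definition logJ (h g : C -> C) (z : C) : C := RtoC (ln (jacobian h g z)).

Definition schwarzian (h g : C -> C) (z : C) : C :=
  Cminus (Dz (Dz (logJ h g)) z)
         (Cmult (RtoC (/2)) (Cmult (Dz (logJ h g) z) (Dz (logJ h g) z))).

Definition pseudo_hyp (z xi : C) : R :=
  Cmod (Cdiv (Cminus z xi) (Cminus (RtoC 1) (Cmult (Cconj xi) z))).
Definition hyp_dist (z xi : C) : R :=
  / 2 * ln ((1 + pseudo_hyp z xi) / (1 - pseudo_hyp z xi)).
Definition hyp_disk (a : C) (rho : R) (z : C) : Prop :=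
  inD z /\ hyp_dist z a < rho.

Definition univalent_on (u : C -> C) (A : C -> Prop) : Prop :=
  forall z1 z2, A z1 -> A z2 -> u z1 = u z2 -> z1 = z2.

(** Uniformly locally univalent: there is rho in (0, +oo] such that u is
    univalent on every hyperbolic disk D(a, rho), a in D.  The case
    rho = +oo means D(a, +oo) = D. *)
Definition uniformly_locally_univalent (u : C -> C) : Prop :=
  (exists rho : R, 0 < rho /\ forall a, inD a -> univalent_on u (hyp_disk a rho))
  \/ univalent_on u inD.

From mathcomp Require Import all_boot all_order all_algebra.
From mathcomp Require Import all_classical all_reals all_analysis.
From mathcomp Require Import Rstruct Rstruct_topology.

Local Open Scope ring_scope.
Local Open Scope ereal_scope.

Definition area := ((@lebesgue_measure R) \x (@lebesgue_measure R))%E.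

Definition diskset : set (R * R)%type := [set z | inD z].

(** int_D phi dA < +oo, for a nonnegative real integrand phi. *)
Definition finite_area_integral (phi : C -> R) : Prop :=
  (\int[area]_(z in diskset) (phi z)%:E < +oo)%E.

Definition in_Besov (p : R) (u : C -> C) : Prop :=
  analytic_on_D u /\
  finite_area_integral (fun z => (
     powR (Cmod (cder u z)) p * powR (1 - Cmod z ^+ 2) (p - 2))%R).

Definition in_Besov_tilde (p : R) (G : C -> C) : Prop :=
  finite_area_integral (fun z => (
     powR (Cmod (Dz G z) + Cmod (Dzb G z)) p * powR (1 - Cmod z ^+ 2) (p - 2))%R).

Definition I_f_finite (p : R) (h g : C -> C) : Prop :=
  finite_area_integral (fun z => (
     powR (Cmod (schwarzian h g z)) p * powR (1 - Cmod z ^+ 2) (2 * p - 2))%R).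

(* Main.v *)
Require Import Defs.
From Stdlib Require Import Reals.
From Stdlib Require Lra Psatz Classical ClassicalEpsilon.
From Coquelicot Require Coquelicot.
From HB Require structures.
From mathcomp Require all_boot all_order all_algebra.
From mathcomp Require all_classical all_reals all_analysis.
From mathcomp Require Rstruct Rstruct_topology measurable_realfun lra ring.

(** Write [f = h + conj g], [q = h''/h'], [w = g'/h'].  The formulas
    [F_z = q - conj w w' / (1 - |w|^2)] and
    [S_f = q' + q^2 - conj w (w'' + 2 w' q) / (1 - |w|^2) - 3/2 F_z^2]
    reduce the theorem to two facts about an analytic [u] on the disk whose
    [|u|^p (1 - |z|^2)^(p-2)] is integrable, applied to [u = q] and [u = w']:
    [|u| (1 - |z|^2)] is bounded, and [|u'|^p (1 - |z|^2)^(2p-2)] is integrable.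
    Both follow from local mean value estimates of [|u|^p] and [|u'|^p] by the
    average of [|u|^p] over a square of size comparable to [1 - |z|], the second
    one after exchanging the order of integration.  These estimates come from
    Cauchy's formula on the boundary of a rectangle: if the formula holds for all
    positions of the four sides, then one of the sides carries at least a quarter of
    the bound in all of its positions, and integrating over these positions yields
    an area integral. *)

(** With |w| <= c < 1 the formulas are used only through |q| <= |F_z| + K |w'|, which turns the
    hypothesis on F into one on the analytic function q, and |S_f| <= K (|q'| + |w''| + |q|^2 +
    |w'|^2). The squares are where boundedness enters: |u|^(2p) (1 - |z|^2)^(2p-2) is the product of
    (|u| (1 - |z|^2))^p and |u|^p (1 - |z|^2)^(p-2). [analytic_on_D] gives complex differentiability
    at each point and no continuity of the derivative, so Goursat's theorem is the starting point,
    and Cauchy's formula also has to show that derivatives are analytic again. Rectangles with sides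
    parallel to the axes keep every contour integral a one-variable integral in x or in y, so that
    Tonelli's theorem for the product measure suffices to pass from contours to areas. All
    comparisons are between integrals of nonnegative functions, where the smaller function may be
    arbitrary: neither F_z nor S_f is ever shown to be measurable. *)

Module ComplexAnalysis.
Import Lra Psatz Classical ClassicalEpsilon Coquelicot.Coquelicot.
Local Open Scope R_scope.

(** * Complex derivatives and continuity in epsilon-delta form *)

Lemma norm_C (z : C_R_NormedModule) : norm z = Cmod z.
Proof. symmetry. exact (Cmod_norm z). Qed.

(** Turns the filter formulation into one estimate in [Cmod], the form in which all error bounds
    below are proved. A point to which [locally z] converges is [z] itself, so the quantifier over
    limit points disappears. *)
Lemma is_derive_C_iff (u : C -> C) (z l : C) :
  @is_derive C_AbsRing C_NormedModule u z l <->
  forall eps, 0 < eps -> exists d, 0 < d /\ forall y : C,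
    Cmod (y - z)%C < d -> Cmod (u y - u z - (y - z) * l)%C <= eps * Cmod (y - z)%C.
Proof.
split.
- intros [_ H] eps Heps.
  destruct (H z (fun P HP => HP) (mkposreal eps Heps)) as [d Hd].
  exists d. split; [apply cond_pos|]. intros y Hy. exact (Hd y Hy).
- intros H. split; [apply is_linear_scal_l|].
  intros x Hx. apply (is_filter_lim_locally_unique (K := C_AbsRing) (V := AbsRing_NormedModule C_AbsRing)) in Hx. subst x.
  intros [eps Heps]. destruct (H eps Heps) as [d [Hd Hd']].
  exists (mkposreal d Hd). intros y Hy. exact (Hd' y Hy).
Qed.

(* Coquelicot has two uniform structures on [C]: the one of [C_AbsRing], used here and
   by [is_derive], has the balls of [Cmod]; that of the normed module is the product one. *)
Definition Ccont (f : C -> C) (z : C) :=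
  @continuous (AbsRing_UniformSpace C_AbsRing) (AbsRing_UniformSpace C_AbsRing) f z.

Lemma Ccont_iff f z : Ccont f z <->
  forall eps, 0 < eps -> exists d, 0 < d /\ forall y : C,
    Cmod (y - z)%C < d -> Cmod (f y - f z)%C < eps.
Proof.
split.
- intros H eps Heps.
  destruct (H (fun v => Cmod (v - f z)%C < eps)) as [d Hd].
  { exists (mkposreal eps Heps). intros y Hy. exact Hy. }
  exists d. split; [apply cond_pos|]. intros y Hy. exact (Hd y Hy).
- intros H P [e He]. destruct (H e (cond_pos e)) as [d [Hd Hd']].
  exists (mkposreal d Hd). intros y Hy. apply He. exact (Hd' y Hy).
Qed.

Lemma Ccont_const c z : Ccont (fun _ => c) z.
Proof. exact (@continuous_const (AbsRing_UniformSpace C_AbsRing) (AbsRing_UniformSpace C_AbsRing) c z). Qed.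
Lemma Ccont_id z : Ccont (fun y => y) z.
Proof. exact (@continuous_id (AbsRing_UniformSpace C_AbsRing) z). Qed.
Lemma Ccont_mult f g z : Ccont f z -> Ccont g z -> Ccont (fun y => (f y * g y)%C) z.
Proof. intros Hf Hg. exact (continuous_mult (U := AbsRing_UniformSpace C_AbsRing) (K := C_AbsRing) f g z Hf Hg). Qed.
Lemma Ccont_plus f g z : Ccont f z -> Ccont g z -> Ccont (fun y => (f y + g y)%C) z.
Proof. intros Hf Hg. exact (continuous_plus (U := AbsRing_UniformSpace C_AbsRing) (K := C_AbsRing) (V := AbsRing_NormedModule C_AbsRing) f g z Hf Hg). Qed.
Lemma Ccont_minus f g z : Ccont f z -> Ccont g z -> Ccont (fun y => (f y - g y)%C) z.
Proof. intros Hf Hg. exact (continuous_minus (U := AbsRing_UniformSpace C_AbsRing) (K := C_AbsRing) (V := AbsRing_NormedModule C_AbsRing) f g z Hf Hg). Qed.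

Lemma is_derive_Cinv (z : C) : z <> 0 ->
  @is_derive C_AbsRing C_NormedModule Cinv z (- / (z * z))%C.
Proof.
intros Hz. apply is_derive_C_iff. intros eps Heps.
assert (Hm : 0 < Cmod z) by (apply Cmod_gt_0; auto).
set (m := Cmod z) in *.
assert (He : 0 < eps * m * m * m / 2) by (repeat apply Rmult_lt_0_compat; lra).
(* The error is |y - z|^2 / (|y| m^2). The first bound gives |y| > m / 2, so the error is at most 2
   |y - z|^2 / m^3, and the second bound absorbs the remaining factor. *)
exists (Rmin (m / 2) (eps * m * m * m / 2)). split; [apply Rmin_pos; lra|].
intros y Hy.
assert (H1 : Cmod (y - z)%C < m / 2) by (eapply Rlt_le_trans; [exact Hy|apply Rmin_l]).
assert (H2 : Cmod (y - z)%C < eps * m * m * m / 2) by (eapply Rlt_le_trans; [exact Hy|apply Rmin_r]).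
assert (Hy2 : m / 2 < Cmod y).
{ assert (T := Cmod_triangle y (- (y - z))%C). rewrite Cmod_opp in T.
  replace (y + - (y - z))%C with z in T by ring. fold m in T. lra. }
assert (Hy0 : y <> 0) by (apply Cmod_gt_0; lra).
replace (/ y - / z - (y - z) * - / (z * z))%C with ((y - z) * ((y - z) / (y * (z * z))))%C by (field; auto).
rewrite Cmod_mult, Cmod_div by (repeat apply Cmult_neq_0; auto).
rewrite Rmult_comm. apply Rmult_le_compat_r; [apply Cmod_ge_0|].
rewrite !Cmod_mult. fold m.
assert (Hp : 0 < m * m) by nra.
apply Rle_div_l; [nra|].
apply Rle_trans with (eps * (m / 2 * (m * m))); [lra|].
apply Rmult_le_compat_l; [lra|]. nra.
Qed.

Lemma is_derive_Ccont (u : C -> C) (z l : C) :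
  @is_derive C_AbsRing C_NormedModule u z l -> Ccont u z.
Proof.
intros H. apply Ccont_iff. rewrite is_derive_C_iff in H. intros eps Heps.
destruct (H 1 Rlt_0_1) as [d [Hd H1]].
assert (Hl := Cmod_ge_0 l).
exists (Rmin d (eps / (2 + Cmod l))). split.
{ apply Rmin_pos; auto. apply Rdiv_lt_0_compat; lra. }
intros y Hy.
assert (Hy1 : Cmod (y - z)%C < d) by (eapply Rlt_le_trans; [exact Hy|apply Rmin_l]).
assert (Hy2 : Cmod (y - z)%C < eps / (2 + Cmod l)) by (eapply Rlt_le_trans; [exact Hy|apply Rmin_r]).
specialize (H1 y Hy1).
replace (u y - u z)%C with ((u y - u z - (y - z) * l) + (y - z) * l)%C by ring.
eapply Rle_lt_trans; [apply Cmod_triangle|]. rewrite Cmod_mult.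
apply Rlt_div_r in Hy2; [|lra]. pose proof (Cmod_ge_0 (y - z)%C). nra.
Qed.

Lemma Ccont_inv f z : Ccont f z -> f z <> 0 -> Ccont (fun y => / f y)%C z.
Proof.
intros Hf H0.
refine (continuous_comp (U := AbsRing_UniformSpace C_AbsRing) (V := AbsRing_UniformSpace C_AbsRing)
  (W := AbsRing_UniformSpace C_AbsRing) f Cinv z Hf _).
exact (is_derive_Ccont _ _ _ (is_derive_Cinv _ H0)).
Qed.

Lemma Cmod_le_sum (x y : R) : Cmod (x, y) <= Rabs x + Rabs y.
Proof.
replace (x, y) with (RtoC x + Ci * RtoC y)%C.
2: { unfold RtoC, Ci, Cmult, Cplus; simpl; f_equal; ring. }
eapply Rle_trans; [apply Cmod_triangle|].
rewrite Cmod_mult, Cmod_Ci, !Cmod_R. lra.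
Qed.

(** Besides restricting to a line, this changes the uniform structure on the target from the balls
    of [Cmod] to that of the normed module, which is the one [RInt] refers to. *)
Lemma Ccont_hline (f : C -> C) (x y : R) : Ccont f (x, y) ->
  @continuous R_UniformSpace (NormedModule.UniformSpace R_AbsRing C_R_NormedModule) (fun t => f (t, y)) x.
Proof.
intros H. rewrite Ccont_iff in H. intros P [e He].
destruct (H e (cond_pos e)) as [d [Hd Hd']].
exists (mkposreal d Hd). intros t Ht. apply He.
apply C_NormedModule_mixin_compat1. apply (Hd' (t, y)).
eapply Rle_lt_trans; [apply Cmod_le_sum|]. simpl.
replace (y + - y) with 0 by ring. rewrite Rabs_R0, Rplus_0_r. exact Ht.
Qed.

Lemma Ccont_vline (f : C -> C) (x y : R) : Ccont f (x, y) ->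
  @continuous R_UniformSpace (NormedModule.UniformSpace R_AbsRing C_R_NormedModule) (fun t => f (x, t)) y.
Proof.
intros H. rewrite Ccont_iff in H. intros P [e He].
destruct (H e (cond_pos e)) as [d [Hd Hd']].
exists (mkposreal d Hd). intros t Ht. apply He.
apply C_NormedModule_mixin_compat1. apply (Hd' (x, t)).
eapply Rle_lt_trans; [apply Cmod_le_sum|]. simpl.
replace (x + - x) with 0 by ring. rewrite Rabs_R0, Rplus_0_l. exact Ht.
Qed.

(** * Integrals of complex-valued functions of a real variable *)

Definition Cint (f : R -> C) (a b : R) : C := @RInt C_R_CompleteNormedModule f a b.
Definition ex_Cint (f : R -> C) (a b : R) := @ex_RInt C_R_NormedModule f a b.

Lemma Cint_plus f g a b : ex_Cint f a b -> ex_Cint g a b ->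
  Cint (fun t => f t + g t)%C a b = (Cint f a b + Cint g a b)%C.
Proof. intros Hf Hg. exact (RInt_plus (V := C_R_CompleteNormedModule) f g a b Hf Hg). Qed.
Lemma Cint_minus f g a b : ex_Cint f a b -> ex_Cint g a b ->
  Cint (fun t => f t - g t)%C a b = (Cint f a b - Cint g a b)%C.
Proof. intros Hf Hg. exact (RInt_minus (V := C_R_CompleteNormedModule) f g a b Hf Hg). Qed.
Lemma ex_Cint_plus f g a b : ex_Cint f a b -> ex_Cint g a b -> ex_Cint (fun t => f t + g t)%C a b.
Proof. intros Hf Hg. exact (ex_RInt_plus (V := C_R_NormedModule) f g a b Hf Hg). Qed.
Lemma ex_Cint_minus f g a b : ex_Cint f a b -> ex_Cint g a b -> ex_Cint (fun t => f t - g t)%C a b.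
Proof. intros Hf Hg. exact (ex_RInt_minus (V := C_R_NormedModule) f g a b Hf Hg). Qed.

Lemma Cint_chasles f a b c : ex_Cint f a b -> ex_Cint f b c -> (Cint f a b + Cint f b c)%C = Cint f a c.
Proof. intros Hf Hg. exact (RInt_Chasles (V := C_R_CompleteNormedModule) f a b c Hf Hg). Qed.

(** The integral lives in a module over the reals, so linearity for a complex factor is checked on
    real and imaginary parts. *)
Lemma is_RInt_Cscal (c : C) f a b l : @is_RInt C_R_NormedModule f a b l ->
  @is_RInt C_R_NormedModule (fun t => c * f t)%C a b (c * l)%C.
Proof.
destruct c as [c1 c2], l as [l1 l2]. intros H.
assert (H1 := is_RInt_fct_extend_fst _ _ _ _ H).
assert (H2 := is_RInt_fct_extend_snd _ _ _ _ H). simpl in H1, H2.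
apply (is_RInt_fct_extend_pair (U := R_NormedModule) (V := R_NormedModule)); simpl.
- exact (is_RInt_minus _ _ _ _ _ _ (is_RInt_scal _ _ _ c1 _ H1) (is_RInt_scal _ _ _ c2 _ H2)).
- exact (is_RInt_plus _ _ _ _ _ _ (is_RInt_scal _ _ _ c1 _ H2) (is_RInt_scal _ _ _ c2 _ H1)).
Qed.

Lemma ex_Cint_scal c f a b : ex_Cint f a b -> ex_Cint (fun t => c * f t)%C a b.
Proof. intros [l H]. exists (c * l)%C. apply is_RInt_Cscal, H. Qed.

Lemma Cint_scal c f a b : ex_Cint f a b -> Cint (fun t => c * f t)%C a b = (c * Cint f a b)%C.
Proof.
intros H. apply (is_RInt_unique (V := C_R_CompleteNormedModule)), is_RInt_Cscal.
exact (RInt_correct (V := C_R_CompleteNormedModule) f a b H).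
Qed.

Lemma Cint_ext f g a b : (forall t, Rmin a b <= t <= Rmax a b -> f t = g t) -> Cint f a b = Cint g a b.
Proof. intros H. apply (RInt_ext (V := C_R_CompleteNormedModule)). intros t Ht. apply H. lra. Qed.

Lemma Cint_const c a b : Cint (fun _ => c) a b = (RtoC (b - a) * c)%C.
Proof. unfold Cint. rewrite (RInt_const (V := C_R_CompleteNormedModule)). apply scal_R_Cmult. Qed.

Lemma Cint_id a b : Cint RtoC a b = RtoC ((b * b - a * a) / 2).
Proof.
apply (is_RInt_unique (V := C_R_CompleteNormedModule)).
apply (is_RInt_fct_extend_pair (U := R_NormedModule) (V := R_NormedModule)); simpl.
- replace ((b * b - a * a) / 2) with (minus (b * b / 2) (a * a / 2)) by (unfold minus, plus, opp; simpl; lra).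
  apply (is_RInt_derive (fun x => x * x / 2)).
  + intros x _. auto_derive; auto. lra.
  + intros x _. apply continuous_id.
- pose proof (is_RInt_const (V := R_NormedModule) a b 0) as E. change (@is_RInt R_NormedModule (fun _ => 0) a b ((b - a) * 0)) in E.
  rewrite Rmult_0_r in E. exact E.
Qed.

Lemma ex_Cint_id a b : ex_Cint RtoC a b.
Proof.
apply (ex_RInt_fct_extend_pair (U := R_NormedModule) (V := R_NormedModule)); simpl.
- apply (ex_RInt_continuous (V := R_CompleteNormedModule)). intros; apply continuous_id.
- apply ex_RInt_const.
Qed.
Lemma ex_Cint_const c a b : ex_Cint (fun _ => c) a b.
Proof. apply (ex_RInt_const (V := C_R_NormedModule)). Qed.

Lemma Cint_bound f a b M : a <= b -> ex_Cint f a b ->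
  (forall t, a <= t <= b -> Cmod (f t) <= M) -> Cmod (Cint f a b) <= (b - a) * M.
Proof.
intros Hab Hf HM. rewrite <- norm_C.
apply (norm_RInt_le_const (V := C_R_NormedModule) f a b); auto.
- intros t Ht. rewrite norm_C. auto.
- exact (RInt_correct (V := C_R_CompleteNormedModule) f a b Hf).
Qed.

Lemma ex_Cint_h f a b y : a <= b -> (forall t, a <= t <= b -> Ccont f (t, y)) ->
  ex_Cint (fun t => f (t, y)) a b.
Proof.
intros Hab H. apply (ex_RInt_continuous (V := C_R_CompleteNormedModule)).
rewrite Rmin_left, Rmax_right by auto. intros t Ht. apply Ccont_hline. auto.
Qed.

Lemma ex_Cint_v f a b x : a <= b -> (forall t, a <= t <= b -> Ccont f (x, t)) ->
  ex_Cint (fun t => f (x, t)) a b.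
Proof.
intros Hab H. apply (ex_RInt_continuous (V := C_R_CompleteNormedModule)).
rewrite Rmin_left, Rmax_right by auto. intros t Ht. apply Ccont_vline. auto.
Qed.


Global Opaque Cint ex_Cint Ccont.

(** * Goursat's theorem on rectangles *)

(** The integral of f dz around the rectangle [a, b] x [c, d], counterclockwise: bottom, right, top,
    left, with dz = i dt on the vertical sides. *)
Definition contour_int (f : C -> C) (a b c d : R) : C :=
  (Cint (fun t => f (t, c)) a b + Ci * Cint (fun t => f (b, t)) c d
   - Cint (fun t => f (t, d)) a b - Ci * Cint (fun t => f (a, t)) c d)%C.

Lemma contour_int_splitx f a m b c d : a <= m <= b ->
  (forall t, a <= t <= b -> Ccont f (t, c)) -> (forall t, a <= t <= b -> Ccont f (t, d)) ->
  contour_int f a b c d = (contour_int f a m c d + contour_int f m b c d)%C.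
Proof.
intros Hm Hc Hd. unfold contour_int.
rewrite <- (Cint_chasles (fun t => f (t, c)) a m b), <- (Cint_chasles (fun t => f (t, d)) a m b);
  try (apply ex_Cint_h; [lra|]; intros; (apply Hc || apply Hd); lra).
ring.
Qed.

Lemma contour_int_splity f a b c m d : c <= m <= d ->
  (forall t, c <= t <= d -> Ccont f (a, t)) -> (forall t, c <= t <= d -> Ccont f (b, t)) ->
  contour_int f a b c d = (contour_int f a b c m + contour_int f a b m d)%C.
Proof.
intros Hm Hc Hd. unfold contour_int.
rewrite <- (Cint_chasles (fun t => f (a, t)) c m d), <- (Cint_chasles (fun t => f (b, t)) c m d);
  try (apply ex_Cint_v; [lra|]; intros; (apply Hc || apply Hd); lra).
ring.
Qed.

Definition bdry (a b c d : R) (z : C) : Prop :=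
  (a <= fst z <= b /\ (snd z = c \/ snd z = d)) \/
  (c <= snd z <= d /\ (fst z = a \/ fst z = b)).

Ltac bd_side := first [apply ex_Cint_h | apply ex_Cint_v]; auto; intros; 
  match goal with H : _ |- Ccont _ _ => apply H end; unfold bdry; simpl; auto.

Lemma contour_int_minus f g a b c d : a <= b -> c <= d ->
  (forall z, bdry a b c d z -> Ccont f z) -> (forall z, bdry a b c d z -> Ccont g z) ->
  contour_int (fun z => f z - g z)%C a b c d = (contour_int f a b c d - contour_int g a b c d)%C.
Proof.
intros Hab Hcd Hf Hg. unfold contour_int.
rewrite !Cint_minus; try bd_side. ring.
Qed.

Lemma contour_int_scal k f a b c d : a <= b -> c <= d ->
  (forall z, bdry a b c d z -> Ccont f z) ->
  contour_int (fun z => k * f z)%C a b c d = (k * contour_int f a b c d)%C.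
Proof.
intros Hab Hcd Hf. unfold contour_int.
rewrite !Cint_scal; try bd_side. ring.
Qed.

Lemma contour_int_bound f a b c d M : a <= b -> c <= d ->
  (forall z, bdry a b c d z -> Ccont f z) ->
  (forall z, bdry a b c d z -> Cmod (f z) <= M) ->
  Cmod (contour_int f a b c d) <= 2 * ((b - a) + (d - c)) * M.
Proof.
intros Hab Hcd Hf HM. unfold contour_int, Cminus.
assert (H1 : Cmod (Cint (fun t => f (t, c)) a b) <= (b - a) * M).
{ apply Cint_bound; auto; try bd_side; intros; apply HM; unfold bdry; simpl; auto. }
assert (H2 : Cmod (Cint (fun t => f (t, d)) a b) <= (b - a) * M).
{ apply Cint_bound; auto; try bd_side; intros; apply HM; unfold bdry; simpl; auto. }
assert (H3 : Cmod (Cint (fun t => f (a, t)) c d) <= (d - c) * M).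
{ apply Cint_bound; auto; try bd_side; intros; apply HM; unfold bdry; simpl; auto. }
assert (H4 : Cmod (Cint (fun t => f (b, t)) c d) <= (d - c) * M).
{ apply Cint_bound; auto; try bd_side; intros; apply HM; unfold bdry; simpl; auto. }
eapply Rle_trans; [apply Cmod_triangle|].
eapply Rle_trans; [apply Rplus_le_compat_r, Cmod_triangle|].
eapply Rle_trans; [apply Rplus_le_compat_r, Rplus_le_compat_r, Cmod_triangle|].
rewrite !Cmod_opp, !Cmod_mult, Cmod_Ci. lra.
Qed.

(** Evaluated side by side from the integrals of 1 and t. In Goursat's argument it removes the
    first-order part of the function at a point. *)
Lemma contour_int_affine p q a b c d : a <= b -> c <= d -> contour_int (fun z => p + q * z)%C a b c d = 0.
Proof.
intros Hab Hcd.
assert (Hh : forall y, Cint (fun t => p + q * (t, y))%C a b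
   = (RtoC (b - a) * (p + q * (0, y)) + q * RtoC ((b * b - a * a) / 2))%C).
{ intros y. rewrite (Cint_ext _ (fun t => (p + q * (0, y)) + q * RtoC t)%C).
  - rewrite Cint_plus, Cint_const, Cint_scal, Cint_id; auto using ex_Cint_id, ex_Cint_const, ex_Cint_scal.
  - intros t _. unfold RtoC, Cmult, Cplus; simpl; f_equal; ring. }
assert (Hv : forall x, Cint (fun t => p + q * (x, t))%C c d
   = (RtoC (d - c) * (p + q * RtoC x) + q * Ci * RtoC ((d * d - c * c) / 2))%C).
{ intros x. rewrite (Cint_ext _ (fun t => (p + q * RtoC x) + q * Ci * RtoC t)%C).
  - rewrite Cint_plus, Cint_const, Cint_scal, Cint_id; auto using ex_Cint_id, ex_Cint_const, ex_Cint_scal.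
  - intros t _. unfold RtoC, Cmult, Cplus, Ci; simpl; f_equal; ring. }
unfold contour_int. rewrite !Hh, !Hv.
destruct p as [p1 p2], q as [q1 q2].
unfold RtoC, Cminus, Copp, Cmult, Cplus, Ci; simpl. f_equal; field.
Qed.

Definition on_rect (a b c d : R) (z : C) : Prop := a <= fst z <= b /\ c <= snd z <= d.

Lemma bdry_on_rect a b c d z : a <= b -> c <= d -> bdry a b c d z -> on_rect a b c d z.
Proof. unfold bdry, on_rect. intros. lra. Qed.

(* Compactness of the rectangle, in the form of a Cousin-type induction: halve both
   sides repeatedly. *)
Lemma rect_bisection (P : R -> R -> R -> R -> Prop) (a b c d : R) :
  a <= b -> c <= d ->
  (forall a' b' c' d', a <= a' <= b' /\ b' <= b -> c <= c' <= d' /\ d' <= d ->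
     P a' ((a' + b') / 2) c' ((c' + d') / 2) -> P ((a' + b') / 2) b' c' ((c' + d') / 2) ->
     P a' ((a' + b') / 2) ((c' + d') / 2) d' -> P ((a' + b') / 2) b' ((c' + d') / 2) d' ->
     P a' b' c' d') ->
  (forall x y, a <= x <= b -> c <= y <= d -> exists e, 0 < e /\
     forall a' b' c' d', a <= a' <= x /\ x <= b' <= b -> c <= c' <= y /\ y <= d' <= d ->
     b' - a' < e -> d' - c' < e -> P a' b' c' d') ->
  P a b c d.
Proof.
intros Hab Hcd Hsub Hloc. apply NNPP. intros Hn.
set (good := fun q : R * R * R * R => let '(a', b', c', d') := q in
  (a <= a' <= b' /\ b' <= b) /\ (c <= c' <= d' /\ d' <= d) /\ ~ P a' b' c' d').
assert (step : forall q : {q | good q}, {q' : {q | good q} |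
   let '(a0, b0, c0, d0) := proj1_sig q in let '(a1, b1, c1, d1) := proj1_sig q' in
   a0 <= a1 /\ b1 <= b0 /\ c0 <= c1 /\ d1 <= d0 /\ b1 - a1 = (b0 - a0) / 2 /\ d1 - c1 = (d0 - c0) / 2}).
{ intros [[[[a0 b0] c0] d0] Hq]. apply constructive_indefinite_description. simpl.
  destruct Hq as [H1 [H2 H3]].
  destruct (classic (P a0 ((a0 + b0) / 2) c0 ((c0 + d0) / 2))) as [P1|P1].
  2: { unshelve eexists (exist _ (a0, ((a0 + b0) / 2), c0, ((c0 + d0) / 2)) _); simpl; repeat split; try lra; auto. }
  destruct (classic (P ((a0 + b0) / 2) b0 c0 ((c0 + d0) / 2))) as [P2|P2].
  2: { unshelve eexists (exist _ (((a0 + b0) / 2), b0, c0, ((c0 + d0) / 2)) _); simpl; repeat split; try lra; auto. }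
  destruct (classic (P a0 ((a0 + b0) / 2) ((c0 + d0) / 2) d0)) as [P3|P3].
  2: { unshelve eexists (exist _ (a0, ((a0 + b0) / 2), ((c0 + d0) / 2), d0) _); simpl; repeat split; try lra; auto. }
  destruct (classic (P ((a0 + b0) / 2) b0 ((c0 + d0) / 2) d0)) as [P4|P4].
  2: { unshelve eexists (exist _ (((a0 + b0) / 2), b0, ((c0 + d0) / 2), d0) _); simpl; repeat split; try lra; auto. }
  exfalso. apply H3. apply Hsub; auto. }
assert (g0 : good (a, b, c, d)) by (simpl; repeat split; try lra; auto).
set (s := fix s (n : nat) : {q | good q} :=
  match n with O => exist _ _ g0 | S n => proj1_sig (step (s n)) end).
set (A := fun n => fst (fst (fst (proj1_sig (s n))))).
set (B := fun n => snd (fst (fst (proj1_sig (s n))))).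
set (E := fun n => snd (fst (proj1_sig (s n)))).
set (D := fun n => snd (proj1_sig (s n))).
assert (Hgood : forall n, (a <= A n <= B n /\ B n <= b) /\ (c <= E n <= D n /\ D n <= d) /\ ~ P (A n) (B n) (E n) (D n)).
{ intros n. unfold A, B, E, D. destruct (s n) as [[[[a0 b0] c0] d0] Hq]. exact Hq. }
assert (Hstep : forall n, A n <= A (S n) /\ B (S n) <= B n /\ E n <= E (S n) /\ D (S n) <= D n /\
  B (S n) - A (S n) = (B n - A n) / 2 /\ D (S n) - E (S n) = (D n - E n) / 2).
{ intros n. unfold A, B, E, D. simpl. destruct (step (s n)) as [q' Hq']. simpl.
  destruct (proj1_sig (s n)) as [[[a0 b0] c0] d0]. destruct (proj1_sig q') as [[[a1 b1] c1] d1]. exact Hq'. }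
assert (Hmono : forall n m, A n <= A (n + m)%nat /\ B (n + m)%nat <= B n /\ E n <= E (n + m)%nat /\ D (n + m)%nat <= D n).
{ intros n m. induction m as [|m IH].
  - rewrite Nat.add_0_r. lra.
  - rewrite Nat.add_succ_r. specialize (Hstep (n + m)%nat). lra. }
assert (Hcross : forall n m, A n <= B m /\ E n <= D m).
{ intros n m. destruct (Nat.le_ge_cases n m) as [H|H].
  - destruct (Hmono n (m - n)%nat) as [H1 [H2 [H3 H4]]].
    replace (n + (m - n))%nat with m in * by lia. specialize (Hgood m). lra.
  - destruct (Hmono m (n - m)%nat) as [H1 [H2 [H3 H4]]].
    replace (m + (n - m))%nat with n in * by lia. specialize (Hgood n). lra. }
assert (Hsup : forall (u v : nat -> R), (forall n m, u n <= v m) -> exists x, forall n, u n <= x <= v n).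
{ intros u v Huv.
  destruct (completeness (fun r => exists n, r = u n)) as [x [Hx1 Hx2]].
  - exists (v O). intros r [n ->]. apply Huv.
  - exists (u O), O. reflexivity.
  - exists x. intros n. split; [apply Hx1; exists n; auto|]. apply Hx2. intros r [m ->]. apply Huv. }
destruct (Hsup A B) as [x Hx]; [intros; apply Hcross|].
destruct (Hsup E D) as [y Hy]; [intros; apply Hcross|].
destruct (Hloc x y) as [e [He Hp]].
{ specialize (Hx O). exact Hx. }
{ specialize (Hy O). exact Hy. }
assert (Hw : forall n, B n - A n = (b - a) * (/ 2) ^ n /\ D n - E n = (d - c) * (/ 2) ^ n).
{ induction n as [|n [IH1 IH2]]; [split; simpl; unfold A, B, E, D; simpl; ring|].
  destruct (Hstep n) as (_ & _ & _ & _ & H1 & H2). rewrite H1, H2, IH1, IH2. simpl. split; field. }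
assert (Hhalf : Rabs (/ 2) < 1) by (rewrite Rabs_right; lra).
(* The denominator exceeds both side lengths, so N halvings make both sides shorter than [e]; the
   summand 1 keeps it positive for a degenerate rectangle. *)
assert (He' : 0 < e / ((b - a) + (d - c) + 1)) by (apply Rdiv_lt_0_compat; lra).
destruct (pow_lt_1_zero _ Hhalf _ He') as [N HN].
specialize (HN N (le_n N)). rewrite Rabs_right in HN by (apply Rle_ge, pow_le; lra).
apply Rlt_div_r in HN; [|lra].
assert (Hpos : 0 <= (/ 2) ^ N) by (apply pow_le; lra).
destruct (Hgood N) as [G1 [G2 G3]]. apply G3. destruct (Hw N) as [W1 W2].
specialize (Hx N). specialize (Hy N).
apply Hp; try lra; rewrite ?W1, ?W2; nra.
Qed.

(** The bound e s^2, with s half the perimeter, is compatible with quartering: the four quarters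
    contribute e (s/2)^2 each. Hence [rect_bisection] applies to this bound, and it only has to hold
    for small rectangles containing a given point, where f differs from an affine function by
    o(s). *)
Lemma goursat f a b c d : a <= b -> c <= d ->
  (forall z, on_rect a b c d z -> exists l, @is_derive C_AbsRing C_NormedModule f z l) ->
  contour_int f a b c d = 0.
Proof.
intros Hab Hcd Hf.
assert (Hcont : forall z, on_rect a b c d z -> Ccont f z).
{ intros z Hz. destruct (Hf z Hz) as [l Hl]. eapply is_derive_Ccont, Hl. }
apply Cmod_eq_0. apply Rle_antisym; [|apply Cmod_ge_0].
apply le_epsilon. intros eps Heps. rewrite Rplus_0_l.
set (e := eps / (((b - a) + (d - c)) ^ 2 + 1)).
assert (He : 0 < e) by (apply Rdiv_lt_0_compat; [lra|]; pose proof (pow2_ge_0 ((b - a) + (d - c))); lra).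
assert (HB : Cmod (contour_int f a b c d) <= e * ((b - a) + (d - c)) ^ 2).
{ apply (rect_bisection (fun a b c d => Cmod (contour_int f a b c d) <= e * ((b - a) + (d - c)) ^ 2)); auto.
  - intros a' b' c' d' H1 H2 P1 P2 P3 P4.
    rewrite (contour_int_splitx f a' ((a' + b') / 2) b'); [|lra| |]; try (intros; apply Hcont; unfold on_rect; simpl; lra).
    rewrite (contour_int_splity f a' _ c' ((c' + d') / 2) d'); [|lra| |]; try (intros; apply Hcont; unfold on_rect; simpl; lra).
    rewrite (contour_int_splity f _ b' c' ((c' + d') / 2) d'); [|lra| |]; try (intros; apply Hcont; unfold on_rect; simpl; lra).
    eapply Rle_trans; [apply Cmod_triangle|].
    eapply Rle_trans; [apply Rplus_le_compat; apply Cmod_triangle|].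
    eapply Rle_trans; [exact (Rplus_le_compat _ _ _ _ (Rplus_le_compat _ _ _ _ P1 P3) (Rplus_le_compat _ _ _ _ P2 P4))|].
    right. field.
  - intros x y Hx Hy. destruct (Hf (x, y)) as [l Hl]; [split; auto|].
    (* With error at most (e/2) s on a contour of length 2 s the integral is at most e s^2. Sides
       shorter than r/2 keep the whole rectangle within distance r of the point. *)
    rewrite is_derive_C_iff in Hl. destruct (Hl (e / 2)) as [r [Hr Hr']]; [lra|].
    exists (r / 2). split; [lra|]. intros a' b' c' d' H1 H2 H3 H4.
    set (p := (f (x, y) - l * (x, y))%C).
    assert (Hsub : forall z, bdry a' b' c' d' z -> Ccont f z).
    { intros z Hz. apply Hcont. apply bdry_on_rect in Hz; [|lra|lra]. unfold on_rect in *; lra. }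
    assert (Haff : forall z, Ccont (fun z => p + l * z)%C z).
    { intros z. apply Ccont_plus; [apply Ccont_const|]. apply Ccont_mult; [apply Ccont_const|apply Ccont_id]. }
    replace (contour_int f a' b' c' d') with (contour_int (fun z => f z - (p + l * z))%C a' b' c' d').
    2: { rewrite contour_int_minus, contour_int_affine; auto; try lra. ring. }
    eapply Rle_trans; [apply contour_int_bound with (M := e / 2 * ((b' - a') + (d' - c')))|].
    + lra. + lra.
    + intros z Hz. apply Ccont_minus; auto.
    + intros z Hz. apply bdry_on_rect in Hz; [|lra|lra]. destruct z as [z1 z2]. destruct Hz as [Z1 Z2]; simpl in Z1, Z2.
      assert (Hd : Cmod ((z1, z2) - (x, y))%C <= (b' - a') + (d' - c')).
      { eapply Rle_trans; [apply Cmod_le_sum|]. simpl. unfold Rabs; destruct Rcase_abs; destruct Rcase_abs; lra. }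
      replace (f (z1, z2) - (p + l * (z1, z2)))%C with (f (z1, z2) - f (x, y) - ((z1, z2) - (x, y)) * l)%C by (unfold p; ring).
      eapply Rle_trans; [apply Hr'; lra|]. apply Rmult_le_compat_l; lra.
    + right. field. }
eapply Rle_trans; [exact HB|]. unfold e.
pose proof (pow2_ge_0 ((b - a) + (d - c))).
unfold Rdiv. rewrite Rmult_assoc. rewrite <- (Rmult_1_r eps) at 2. apply Rmult_le_compat_l; [lra|].
rewrite Rmult_comm. apply Rle_div_l; lra.
Qed.

(** * Cauchy's formula *)

Definition Cdiff (f : C -> C) (z : C) := exists l, @is_derive C_AbsRing C_NormedModule f z l.

Lemma Cdiff_Ccont f z : Cdiff f z -> Ccont f z.
Proof. intros [l H]. eapply is_derive_Ccont, H. Qed.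

(** [C] is a normed module over itself in two ways with the same norm; the product and chain rules
    below are taken from the second one. *)
Lemma is_derive_C_AbsRing (u : C -> C) (z l : C) :
  @is_derive C_AbsRing C_NormedModule u z l <->
  @is_derive C_AbsRing (AbsRing_NormedModule C_AbsRing) u z l.
Proof. split; (intros [_ H]; split; [apply is_linear_scal_l|exact H]). Qed.

Lemma is_derive_Cmult (f g : C -> C) (z l m : C) :
  @is_derive C_AbsRing C_NormedModule f z l -> @is_derive C_AbsRing C_NormedModule g z m ->
  @is_derive C_AbsRing C_NormedModule (fun y => f y * g y)%C z (l * g z + f z * m)%C.
Proof.
intros Hl Hm. apply is_derive_C_AbsRing in Hl, Hm. apply is_derive_C_AbsRing.
exact (is_derive_mult (K := C_AbsRing) f g z l m Hl Hm Cmult_comm).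
Qed.

Lemma Cdiff_mult f g z : Cdiff f z -> Cdiff g z -> Cdiff (fun y => f y * g y)%C z.
Proof. intros [l Hl] [m Hm]. eexists. apply is_derive_Cmult; eassumption. Qed.

Lemma Cdiff_minus f g z : Cdiff f z -> Cdiff g z -> Cdiff (fun y => f y - g y)%C z.
Proof. intros [l Hl] [m Hm]. exists (l - m)%C. exact (is_derive_minus (K := C_AbsRing) (V := C_NormedModule) f g z l m Hl Hm). Qed.

Lemma is_derive_Csub (c z : C) : @is_derive C_AbsRing C_NormedModule (fun y => y - c)%C z (RtoC 1).
Proof.
apply is_derive_C_iff. intros eps He. exists 1. split; [lra|]. intros y _.
replace (y - c - (z - c) - (y - z) * 1)%C with (RtoC 0) by ring. rewrite Cmod_0.
pose proof (Cmod_ge_0 (y - z)%C). nra.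
Qed.

Lemma is_derive_Cinv_comp (f : C -> C) (z l : C) :
  @is_derive C_AbsRing C_NormedModule f z l -> f z <> 0 ->
  @is_derive C_AbsRing C_NormedModule (fun y => / f y)%C z (l * - / (f z * f z))%C.
Proof.
intros Hl H0. apply is_derive_C_AbsRing in Hl.
exact (is_derive_comp (K := C_AbsRing) (V := C_NormedModule) Cinv f z _ l (is_derive_Cinv _ H0) Hl).
Qed.

Lemma Cdiff_inv f z : Cdiff f z -> f z <> 0 -> Cdiff (fun y => / f y)%C z.
Proof. intros [l Hl] H0. eexists. apply is_derive_Cinv_comp; eassumption. Qed.

Lemma contour_int_hole f a b c d x y e :
  a < x - e -> x + e < b -> c < y - e -> y + e < d -> 0 < e ->
  (forall z, on_rect a b c d z -> z <> (x, y) -> Cdiff f z) ->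
  contour_int f a b c d = contour_int f (x - e) (x + e) (y - e) (y + e).
Proof.
intros Ha Hb Hc Hd He Hf.
assert (Hne : forall u v, (u <> x \/ v <> y) -> (u, v) <> (x, y)) by (intros u v H E; injection E; intros; destruct H; auto).
assert (HC : forall u v, a <= u <= b -> c <= v <= d -> (u <> x \/ v <> y) -> Ccont f (u, v)).
{ intros u v H1 H2 H3. apply Cdiff_Ccont, Hf; auto. split; auto. }
rewrite (contour_int_splitx f a (x - e) b) by first [lra | intros; apply HC; lra].
rewrite (contour_int_splitx f (x - e) (x + e) b) by first [lra | intros; apply HC; lra].
rewrite (contour_int_splity f (x - e) (x + e) c (y - e) d) by first [lra | intros; apply HC; lra].
rewrite (contour_int_splity f (x - e) (x + e) (y - e) (y + e) d) by first [lra | intros; apply HC; lra].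
rewrite (goursat f a (x - e) c d), (goursat f (x + e) b c d),
  (goursat f (x - e) (x + e) c (y - e)), (goursat f (x - e) (x + e) (y + e) d);
  try lra; try (intros [u v] [H1 H2]; simpl in *; apply Hf; [unfold on_rect; simpl; lra|apply Hne; lra]).
ring.
Qed.

(* In fact [2 i PI]; only a lower bound of its modulus is needed. *)
Definition cauchy_const : C := contour_int Cinv (-1) 1 (-1) 1.

Lemma Cint_affine f e x a b : 
  ex_Cint f (e * a + x) (e * b + x) ->
  Cint f (e * a + x) (e * b + x) = Cint (fun t => RtoC e * f (e * t + x)%R)%C a b.
Proof.
intros H. Transparent Cint ex_Cint.
unfold Cint. rewrite <- (RInt_comp_lin (V := C_R_CompleteNormedModule) f e x a b H).
apply (RInt_ext (V := C_R_CompleteNormedModule)). intros t _. apply scal_R_Cmult.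
Qed.
Opaque Cint ex_Cint.

Lemma fst_ne (z w : C) : fst z <> fst w -> (z - w)%C <> 0.
Proof. intros H E. apply (f_equal fst) in E. simpl in E. lra. Qed.
Lemma snd_ne (z w : C) : snd z <> snd w -> (z - w)%C <> 0.
Proof. intros H E. apply (f_equal snd) in E. simpl in E. lra. Qed.

Lemma Cinv_scale (e : R) (w : C) : e <> 0 -> w <> 0 -> (RtoC e * / (RtoC e * w))%C = (/ w)%C.
Proof. intros He Hw. field. split; auto. intros E. apply RtoC_inj in E. auto. Qed.

(** The form dz / z is invariant under dilations: z = (x, y) + e s carries the square with centre 0
    and half side 1 to the given one. *)
Lemma contour_int_kernel_small x y e : 0 < e ->
  contour_int (fun z => / (z - (x, y)))%C (x - e) (x + e) (y - e) (y + e) = cauchy_const.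
Proof.
intros He. set (k := fun z : C => (/ (z - (x, y)))%C).
assert (Hk : forall z : C, fst z <> x \/ snd z <> y -> Ccont k z).
{ intros z Hz. apply Ccont_inv; [apply Ccont_minus; [apply Ccont_id|apply Ccont_const]|].
  destruct Hz; [apply fst_ne|apply snd_ne]; auto. }
assert (E : forall u v : R, u <> 0 \/ v <> 0 -> (RtoC e * k (e * u + x, e * v + y)%R)%C = (/ (u, v))%C).
{ intros u v Huv. unfold k. replace (((e * u + x)%R, (e * v + y)%R) - (x, y))%C with (RtoC e * (u, v))%C.
  - apply Cinv_scale; [lra|]. intros E. injection E; intros; lra.
  - unfold RtoC, Cminus, Cmult, Cplus, Copp; simpl; f_equal; ring. }
unfold cauchy_const, contour_int.
replace (x - e) with (e * -1 + x) by ring. replace (x + e) with (e * 1 + x) by ring.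
replace (y - e) with (e * -1 + y) by ring. replace (y + e) with (e * 1 + y) by ring.
rewrite (Cint_affine (fun t => k (t, e * -1 + y))), (Cint_affine (fun t => k (t, e * 1 + y))),
  (Cint_affine (fun t => k (e * -1 + x, t))), (Cint_affine (fun t => k (e * 1 + x, t)));
  try (first [apply ex_Cint_h|apply ex_Cint_v]; [nra|]; intros; apply Hk; simpl; nra).
rewrite (Cint_ext (fun t => RtoC e * k (e * t + x, e * -1 + y)%R)%C (fun t => / (t, (-1)))%C) by (intros; apply E; lra).
rewrite (Cint_ext (fun t => RtoC e * k (e * t + x, e * 1 + y)%R)%C (fun t => / (t, 1))%C) by (intros; apply E; lra).
rewrite (Cint_ext (fun t => RtoC e * k (e * -1 + x, e * t + y)%R)%C (fun t => / (-1, t))%C) by (intros; apply E; lra).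
rewrite (Cint_ext (fun t => RtoC e * k (e * 1 + x, e * t + y)%R)%C (fun t => / (1, t))%C) by (intros; apply E; lra).
reflexivity.
Qed.

(** At equal parameter t the four sides add up to 4 i / (1 + t^2), whose modulus is at least 2 on an
    interval of length 2. *)
Lemma cauchy_const_ge4 : 4 <= Cmod cauchy_const.
Proof.
assert (Hk : forall z : C, fst z <> 0 \/ snd z <> 0 -> Ccont Cinv z).
{ intros z Hz. apply (Ccont_inv (fun z => z)); [apply Ccont_id|]. intros E. subst z. simpl in Hz. lra. }
set (p := fun t : R => 4 / (1 + t * t)).
assert (E : cauchy_const = Cint (fun t => (0, p t)) (-1) 1).
{ unfold cauchy_const, contour_int.
  rewrite <- !Cint_scal by (apply ex_Cint_v; [lra|]; intros; apply Hk; simpl; lra).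
  rewrite <- Cint_plus, <- !Cint_minus; try (apply Cint_ext);
  repeat first [apply ex_Cint_minus | apply ex_Cint_plus | apply ex_Cint_scal | apply ex_Cint_h; [lra|]; intros; apply Hk; simpl; lra
     | apply ex_Cint_v; [lra|]; intros; apply Hk; simpl; lra].
  intros t _. unfold p, Cinv, Cminus, Cplus, Copp, Cmult, Ci; simpl.
  assert (1 + t * t <> 0) by nra.
  f_equal; field; nra. }
assert (Hp : ex_RInt p (-1) 1).
{ apply (ex_RInt_continuous (V := R_CompleteNormedModule)). intros t _. apply (ex_derive_continuous (V := R_NormedModule)).
  unfold p. auto_derive. nra. }
assert (E2 : cauchy_const = (0, RInt p (-1) 1)).
{ rewrite E. Transparent Cint. unfold Cint. apply (is_RInt_unique (V := C_R_CompleteNormedModule)).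
  apply (is_RInt_fct_extend_pair (U := R_NormedModule) (V := R_NormedModule)); simpl.
  - pose proof (is_RInt_const (V := R_NormedModule) (-1) 1 0) as E0.
    change (@is_RInt R_NormedModule (fun _ => 0) (-1) 1 ((1 - -1) * 0)) in E0. rewrite Rmult_0_r in E0. exact E0.
  - exact (RInt_correct (V := R_CompleteNormedModule) p (-1) 1 Hp). }
assert (H4 : 4 <= RInt p (-1) 1).
{ replace 4 with (RInt (fun _ => 2) (-1) 1) by (rewrite RInt_const; unfold scal; simpl; unfold mult; simpl; ring).
  apply RInt_le; [lra|apply ex_RInt_const|exact Hp|]. intros t Ht. unfold p. apply Rle_div_r; nra. }
rewrite E2. replace (0, RInt p (-1) 1) with (Ci * RtoC (RInt p (-1) 1))%C by (unfold Ci, RtoC, Cmult; simpl; f_equal; ring).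
rewrite Cmod_mult, Cmod_Ci, Cmod_R. rewrite Rabs_right; lra.
Qed.
Opaque Cint.

Lemma cauchy_const_neq0 : cauchy_const <> 0.
Proof. apply Cmod_gt_0. pose proof cauchy_const_ge4. lra. Qed.

Lemma rect_inner_square a b c d x y e0 : a < x < b -> c < y < d -> 0 < e0 ->
  exists e, 0 < e /\ e < e0 /\ a < x - e /\ x + e < b /\ c < y - e /\ y + e < d.
Proof.
intros. set (m := Rmin (Rmin (x - a) (b - x)) (Rmin (Rmin (y - c) (d - y)) e0)).
assert (Hm : 0 < m) by (unfold m; repeat apply Rmin_pos; lra).
assert (m <= x - a) by (unfold m; eapply Rle_trans; [apply Rmin_l|apply Rmin_l]).
assert (m <= b - x) by (unfold m; eapply Rle_trans; [apply Rmin_l|apply Rmin_r]).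
assert (m <= e0) by (unfold m; eapply Rle_trans; [apply Rmin_r|apply Rmin_r]).
assert (m <= y - c) by (unfold m; eapply Rle_trans; [apply Rmin_r|]; eapply Rle_trans; [apply Rmin_l|apply Rmin_l]).
assert (m <= d - y) by (unfold m; eapply Rle_trans; [apply Rmin_r|]; eapply Rle_trans; [apply Rmin_l|apply Rmin_r]).
exists (m / 2). lra.
Qed.

(** Shrink the contour to a small square and subtract f(x, y) times the integral of the kernel. What
    is left is the integral of (f(z) - f(x, y)) / (z - (x, y)), small by continuity of f at (x,
    y). *)
Theorem cauchy_rect f a b c d x y : a < x < b -> c < y < d ->
  (forall z, on_rect a b c d z -> Cdiff f z) ->
  contour_int (fun z => f z / (z - (x, y)))%C a b c d = (f (x, y) * cauchy_const)%C.
Proof.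
intros Hx Hy Hf.
assert (Hsub : forall z, Cdiff (fun z => z - (x, y))%C z) by (intros z; exists (RtoC 1); apply is_derive_Csub).
assert (Hne0 : forall z : C, z <> (x, y) -> (z - (x, y))%C <> 0).
{ intros z Hz E. apply Hz. apply Ceq_minus. exact E. }
assert (Hk : forall z : C, z <> (x, y) -> Cdiff (fun z => / (z - (x, y)))%C z) by (intros; apply Cdiff_inv; auto).
set (g := fun z => (f z / (z - (x, y)))%C).
set (h := fun z => (f (x, y) * / (z - (x, y)))%C).
assert (Hg : forall z, on_rect a b c d z -> z <> (x, y) -> Cdiff g z).
{ intros z Hz Hz'. apply Cdiff_mult; auto. }
assert (Hcd : forall k z, Cdiff (fun _ => k) z).
{ intros k z. exists (RtoC 0). apply is_derive_C_iff. intros eps He. exists 1. split; [lra|]. intros w _.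
  replace (k - k - (w - z) * 0)%C with (RtoC 0) by ring. rewrite Cmod_0. pose proof (Cmod_ge_0 (w - z)%C). nra. }
assert (Hh : forall z, z <> (x, y) -> Cdiff h z).
{ intros z Hz. apply Cdiff_mult; auto. }
apply Ceq_minus, Cmod_eq_0. apply Rle_antisym; [|apply Cmod_ge_0].
apply le_epsilon. intros eps Heps. rewrite Rplus_0_l.
assert (Hxy : on_rect a b c d (x, y)) by (unfold on_rect; simpl; lra).
destruct (proj1 (Ccont_iff f (x, y)) (Cdiff_Ccont _ _ (Hf _ Hxy)) (eps / 8)) as [r [Hr Hr']]; [lra|].
destruct (rect_inner_square a b c d x y (r / 2) Hx Hy) as [e He]; [lra|].
rewrite (contour_int_hole g a b c d x y e); auto; try lra.
rewrite <- (contour_int_kernel_small x y e) by lra.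
assert (Hb : forall z, bdry (x - e) (x + e) (y - e) (y + e) z -> z <> (x, y) /\ on_rect a b c d z /\ e <= Cmod (z - (x, y))%C < r).
{ intros [z1 z2] Hz. unfold bdry in Hz; simpl in Hz.
  split; [intros E; injection E; lra|]. split; [unfold on_rect; simpl; lra|].
  split.
  - eapply Rle_trans; [|apply Rmax_Cmod]. simpl.
    destruct Hz as [[_ Hz]|[_ Hz]].
    + eapply Rle_trans; [|apply Rmax_r]. destruct Hz; subst; unfold Rabs; destruct Rcase_abs; lra.
    + eapply Rle_trans; [|apply Rmax_l]. destruct Hz; subst; unfold Rabs; destruct Rcase_abs; lra.
  - eapply Rle_lt_trans; [apply Cmod_le_sum|]. simpl. unfold Rabs. destruct Rcase_abs, Rcase_abs; lra. }
rewrite <- contour_int_scal, <- contour_int_minus; try lra.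
2,3,4: intros z Hz; apply Cdiff_Ccont; destruct (Hb z Hz) as [B1 [B2 B3]]; (apply Hg + apply Hk + apply Hh); auto.
(* On the square |z - (x, y)| >= e while f varies by less than eps / 8; the perimeter 8 e turns this
   [M] into exactly eps. *)
eapply Rle_trans; [apply contour_int_bound with (M := eps / 8 / e)|].
- lra. - lra.
- intros z Hz. destruct (Hb z Hz) as [B1 [B2 B3]]. apply Cdiff_Ccont, Cdiff_minus; [apply Hg|apply Hh]; auto.
- intros z Hz. destruct (Hb z Hz) as [B1 [B2 B3]]. unfold g.
  replace (f z / (z - (x, y)) - f (x, y) * / (z - (x, y)))%C with ((f z - f (x, y)) / (z - (x, y)))%C by (field; auto).
  rewrite Cmod_div by auto. specialize (Hr' z (proj2 B3)).
  apply Rmult_le_compat; [apply Cmod_ge_0|left; apply Rinv_0_lt_compat; lra|lra|apply Rinv_le_contravar; lra].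
- right. field. lra.
Qed.

(** * Differentiation under the contour integral *)

Lemma is_derive_C_ext (f g : C -> C) (z l : C) (r : R) : 0 < r ->
  (forall w : C, Cmod (w - z)%C < r -> f w = g w) ->
  @is_derive C_AbsRing C_NormedModule f z l -> @is_derive C_AbsRing C_NormedModule g z l.
Proof.
intros Hr Hfg Hf. apply is_derive_C_iff. intros eps Heps. rewrite is_derive_C_iff in Hf.
destruct (Hf eps Heps) as [s [Hs Hs']]. exists (Rmin r s). split; [apply Rmin_pos; auto|].
intros y Hy. rewrite <- !Hfg.
- apply Hs'. eapply Rlt_le_trans; [exact Hy|apply Rmin_r].
- replace (z - z)%C with (RtoC 0) by ring. rewrite Cmod_0; auto.
- eapply Rlt_le_trans; [exact Hy|apply Rmin_l].
Qed.

Lemma is_derive_Cconst_scal (f : C -> C) (z l k : C) :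
  @is_derive C_AbsRing C_NormedModule f z l ->
  @is_derive C_AbsRing C_NormedModule (fun y => k * f y)%C z (k * l)%C.
Proof.
intros Hf. apply is_derive_C_iff. intros eps Heps. rewrite is_derive_C_iff in Hf.
pose proof (Cmod_ge_0 k).
destruct (Hf (eps / (Cmod k + 1))) as [s [Hs Hs']]; [apply Rdiv_lt_0_compat; lra|].
exists s. split; auto. intros y Hy.
replace (k * f y - k * f z - (y - z) * (k * l))%C with (k * (f y - f z - (y - z) * l))%C by ring.
rewrite Cmod_mult. specialize (Hs' y Hy).
apply Rle_trans with (Cmod k * (eps / (Cmod k + 1) * Cmod (y - z)%C)); [apply Rmult_le_compat_l; auto|].
rewrite <- Rmult_assoc. apply Rmult_le_compat_r; [apply Cmod_ge_0|].
unfold Rdiv. rewrite <- Rmult_assoc. apply Rle_div_l; nra.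
Qed.

(** Continuity gives a bound near each point, and bounds on four quarters add up to one on the
    whole, so [rect_bisection] applies. *)
Lemma Ccont_bounded_rect f a b c d : a <= b -> c <= d ->
  (forall z, on_rect a b c d z -> Ccont f z) ->
  exists M, 0 <= M /\ forall z, on_rect a b c d z -> Cmod (f z) <= M.
Proof.
intros Hab Hcd Hf.
apply (rect_bisection (fun a b c d => exists M, 0 <= M /\ forall z, on_rect a b c d z -> Cmod (f z) <= M)); auto.
- intros a' b' c' d' _ _ [M1 [P1 H1]] [M2 [P2 H2]] [M3 [P3 H3]] [M4 [P4 H4]].
  exists (M1 + M2 + M3 + M4). split; [lra|]. intros z [Z1 Z2].
  destruct (Rle_dec (fst z) ((a' + b') / 2)); destruct (Rle_dec (snd z) ((c' + d') / 2)).
  + assert (T : Cmod (f z) <= M1) by (apply H1; split; lra). lra.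
  + assert (T : Cmod (f z) <= M3) by (apply H3; split; lra). lra.
  + assert (T : Cmod (f z) <= M2) by (apply H2; split; lra). lra.
  + assert (T : Cmod (f z) <= M4) by (apply H4; split; lra). lra.
- intros x y Hx Hy.
  destruct (proj1 (Ccont_iff f (x, y)) (Hf (x, y) (conj Hx Hy)) 1 Rlt_0_1) as [r [Hr Hr']].
  exists (r / 2). split; [lra|]. intros a' b' c' d' H1 H2 H3 H4.
  exists (Cmod (f (x, y)) + 1). split; [pose proof (Cmod_ge_0 (f (x, y))); lra|].
  intros [z1 z2] [Z1 Z2]; simpl in Z1, Z2.
  assert (Hz : Cmod ((z1, z2) - (x, y))%C < r).
  { eapply Rle_lt_trans; [apply Cmod_le_sum|]. simpl. unfold Rabs; destruct Rcase_abs; destruct Rcase_abs; lra. }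
  specialize (Hr' _ Hz).
  replace (f (z1, z2)) with ((f (z1, z2) - f (x, y)) + f (x, y))%C by ring.
  eapply Rle_trans; [apply Cmod_triangle|]. lra.
Qed.

(** [k'] is the derivative of the kernel in its second variable at z. A quadratic remainder that is
    uniform on the boundary integrates to a quadratic remainder. *)
Lemma contour_int_param_derive (phi : C -> C) (k : C -> C -> C) (k' : C -> C) a b c d z M r :
  a <= b -> c <= d -> 0 < r -> 0 <= M ->
  (forall s w, bdry a b c d s -> Cmod (w - z)%C < r -> Ccont (fun s => phi s * k s w)%C s) ->
  (forall s, bdry a b c d s -> Ccont (fun s => phi s * k' s)%C s) ->
  (forall s w, bdry a b c d s -> Cmod (w - z)%C < r ->
     Cmod (phi s * (k s w - k s z - (w - z) * k' s))%C <= M * Cmod (w - z)%C ^ 2) ->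
  @is_derive C_AbsRing C_NormedModule (fun w => contour_int (fun s => phi s * k s w)%C a b c d) z
    (contour_int (fun s => phi s * k' s)%C a b c d).
Proof.
intros Hab Hcd Hr HM Hk Hk' HB. apply is_derive_C_iff. intros eps Heps.
set (P := 2 * ((b - a) + (d - c)) * M).
assert (HP : 0 <= P) by (unfold P; nra).
exists (Rmin r (eps / (P + 1))). split; [apply Rmin_pos; auto; apply Rdiv_lt_0_compat; lra|].
intros w Hw.
assert (Hw1 : Cmod (w - z)%C < r) by (eapply Rlt_le_trans; [exact Hw|apply Rmin_l]).
assert (Hw2 : Cmod (w - z)%C < eps / (P + 1)) by (eapply Rlt_le_trans; [exact Hw|apply Rmin_r]).
assert (Hz : Cmod (z - z)%C < r) by (replace (z - z)%C with (RtoC 0) by ring; rewrite Cmod_0; auto).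
assert (H1 : forall s, bdry a b c d s -> Ccont (fun s => phi s * k s w - phi s * k s z)%C s) by (intros; apply Ccont_minus; apply Hk; auto).
assert (H2 : forall s, bdry a b c d s -> Ccont (fun s => (w - z) * (phi s * k' s))%C s) by (intros; apply Ccont_mult; [apply Ccont_const|apply Hk'; auto]).
rewrite <- contour_int_scal, <- contour_int_minus, <- contour_int_minus; auto.
apply Rlt_div_r in Hw2; [|lra].
pose proof (Cmod_ge_0 (w - z)%C) as H0.
apply Rle_trans with (P * Cmod (w - z)%C ^ 2); [|nra].
eapply Rle_trans; [apply contour_int_bound with (M := M * Cmod (w - z)%C ^ 2); auto|].
- intros s Hs. apply Ccont_minus; auto.
- intros s Hs.
  replace (phi s * k s w - phi s * k s z - (w - z) * (phi s * k' s))%C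
    with (phi s * (k s w - k s z - (w - z) * k' s))%C by ring. auto.
- unfold P. right. ring.
Qed.

(** The remainder equals h^2 / (u^2 (u - h)), and |u - h| >= r / 2. *)
Lemma kernel1_taylor (u h : C) (r : R) : 0 < r -> r <= Cmod u -> Cmod h < r / 2 ->
  Cmod (/ (u - h) - / u - h * / (u * u))%C <= 2 / r ^ 3 * Cmod h ^ 2.
Proof.
intros Hr Hu Hh.
assert (Hd : r / 2 <= Cmod (u - h)%C).
{ assert (T := Cmod_triangle (u - h)%C h). replace (u - h + h)%C with u in T by ring. lra. }
assert (u <> 0) by (apply Cmod_gt_0; lra).
assert ((u - h)%C <> 0) by (apply Cmod_gt_0; lra).
replace (/ (u - h) - / u - h * / (u * u))%C with (h * h * (/ u * / u * / (u - h)))%C by (field; auto).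
rewrite !Cmod_mult, !Cmod_inv by auto.
replace (2 / r ^ 3 * Cmod h ^ 2) with (Cmod h * Cmod h * (/ r * / r * / (r / 2))) by (field; lra).
assert (Hi1 : / Cmod u <= / r) by (apply Rinv_le_contravar; lra).
assert (Hi2 : / Cmod (u - h)%C <= / (r / 2)) by (apply Rinv_le_contravar; lra).
assert (0 < / Cmod u) by (apply Rinv_0_lt_compat; lra).
assert (0 < / Cmod (u - h)%C) by (apply Rinv_0_lt_compat; lra).
pose proof (Cmod_ge_0 h).
apply Rmult_le_compat_l; [nra|].
apply Rmult_le_compat; [nra|lra| |lra]. apply Rmult_le_compat; lra.
Qed.

(** The remainder equals h^2 (3 u - 2 h) / (u^3 (u - h)^2). The constant comes from |3 u - 2 h| <= 4
    |u| and |u - h| >= |u| / 2. *)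
Lemma kernel2_taylor (u h : C) (r : R) : 0 < r -> r <= Cmod u -> Cmod h < r / 2 ->
  Cmod (/ ((u - h) * (u - h)) - / (u * u) - h * (2 * / (u * u * u)))%C <= 16 / r ^ 4 * Cmod h ^ 2.
Proof.
intros Hr Hu Hh.
assert (Hd : Cmod u / 2 <= Cmod (u - h)%C).
{ assert (T := Cmod_triangle (u - h)%C h). replace (u - h + h)%C with u in T by ring. lra. }
assert (u <> 0) by (apply Cmod_gt_0; lra).
assert ((u - h)%C <> 0) by (apply Cmod_gt_0; lra).
assert (H4 : Cmod (3 * u - 2 * h)%C <= 4 * Cmod u).
{ unfold Cminus. eapply Rle_trans; [apply Cmod_triangle|]. rewrite Cmod_opp, !Cmod_mult, !Cmod_R, !Rabs_right; lra. }
replace (/ ((u - h) * (u - h)) - / (u * u) - h * (2 * / (u * u * u)))%C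
  with (h * h * ((3 * u - 2 * h) * / (u * u * u)) * (/ (u - h) * / (u - h)))%C by (field; auto).
rewrite !Cmod_mult, !Cmod_inv by (repeat apply Cmult_neq_0; auto).
rewrite !Cmod_mult.
set (U := Cmod u) in *. set (V := Cmod (u - h)%C) in *. set (W := Cmod (3 * u - 2 * h)%C) in *. set (H' := Cmod h).
assert (Hi : / V <= 2 / U).
{ replace (2 / U) with (/ (U / 2)) by (field; lra). apply Rinv_le_contravar; lra. }
assert (HV : 0 < / V) by (apply Rinv_0_lt_compat; lra).
assert (HU : 0 < / U) by (apply Rinv_0_lt_compat; lra).
assert (HUr : / U <= / r) by (apply Rinv_le_contravar; lra).
assert (HW : W * / (U * U * U) <= 4 * (/ U * / U)).
{ replace (4 * (/ U * / U)) with (4 * U * / (U * U * U)) by (field; lra).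
  apply Rmult_le_compat_r; [|lra]. left. apply Rinv_0_lt_compat. repeat apply Rmult_lt_0_compat; lra. }
assert (HVV : / V * / V <= 4 * (/ U * / U)).
{ apply Rle_trans with (2 / U * (2 / U)); [apply Rmult_le_compat; lra|]. right. field. lra. }
assert (HUU : / U * / U <= / r * / r) by (apply Rmult_le_compat; lra).
assert (Hr' : 0 < / r) by (apply Rinv_0_lt_compat; lra).
replace (16 / r ^ 4 * H' ^ 2) with (H' * H' * (4 * (/ r * / r)) * (4 * (/ r * / r))) by (field; lra).
assert (0 <= H') by apply Cmod_ge_0. assert (0 <= W) by apply Cmod_ge_0.
assert (0 <= W * / (U * U * U)).
{ apply Rmult_le_pos; auto. left. apply Rinv_0_lt_compat. repeat apply Rmult_lt_0_compat; lra. }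
apply Rmult_le_compat; [apply Rmult_le_pos; [nra|auto]|nra| |lra].
apply Rmult_le_compat_l; [nra|lra].
Qed.

Lemma bdry_far a b c d x y : a < x < b -> c < y < d -> exists r, 0 < r /\
  (forall s, bdry a b c d s -> r <= Cmod (s - (x, y))%C) /\
  (forall w : C, Cmod (w - (x, y))%C < r -> a < fst w < b /\ c < snd w < d).
Proof.
intros Hx Hy. destruct (rect_inner_square a b c d x y 1 Hx Hy) as [e He]; [lra|].
exists e. split; [lra|]. split.
- intros [s1 s2] Hs. unfold bdry in Hs; simpl in Hs.
  eapply Rle_trans; [|apply Rmax_Cmod]. simpl.
  destruct Hs as [[_ Hz]|[_ Hz]].
  + eapply Rle_trans; [|apply Rmax_r]. destruct Hz; subst; unfold Rabs; destruct Rcase_abs; lra.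
  + eapply Rle_trans; [|apply Rmax_l]. destruct Hz; subst; unfold Rabs; destruct Rcase_abs; lra.
- intros [w1 w2] Hw. eapply Rle_lt_trans in Hw; [|apply Rmax_Cmod]. simpl in *.
  apply Rmax_Rlt in Hw. destruct Hw as [W1 W2]. apply Rabs_def2 in W1, W2. lra.
Qed.

Section CauchyDerivative.
Variables (f : C -> C) (a b c d : R).
Hypothesis Hf : forall z, on_rect a b c d z -> Cdiff f z.

(** The Cauchy integral of f and its first two derivatives in w. Up to the factor [cauchy_const]
    they represent f, f' and f'' inside the rectangle. *)
Let G1 w := contour_int (fun s => f s * / (s - w))%C a b c d.
Let G2 w := contour_int (fun s => f s * / ((s - w) * (s - w)))%C a b c d.
Let G3 w := contour_int (fun s => f s * (2 * / ((s - w) * (s - w) * (s - w))))%C a b c d.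

Lemma cauchy_integral_derive x y : a < x < b -> c < y < d ->
  @is_derive C_AbsRing C_NormedModule G1 (x, y) (G2 (x, y)) /\
  @is_derive C_AbsRing C_NormedModule G2 (x, y) (G3 (x, y)).
Proof.
intros Hx Hy.
assert (Hab : a <= b) by lra. assert (Hcd : c <= d) by lra.
assert (Hc : forall s, bdry a b c d s -> Ccont f s).
{ intros s Hs. apply Cdiff_Ccont, Hf, bdry_on_rect; auto. }
destruct (Ccont_bounded_rect f a b c d Hab Hcd) as [M [HM0 HM]].
{ intros z Hz. apply Cdiff_Ccont, Hf; auto. }
destruct (bdry_far a b c d x y Hx Hy) as [r [Hr [Hfar Hin]]].
assert (Hsub : forall w s, Ccont (fun s => s - w)%C s) by (intros; apply Ccont_minus; [apply Ccont_id|apply Ccont_const]).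
assert (Hne : forall s w, bdry a b c d s -> Cmod (w - (x, y))%C < r / 2 -> (s - w)%C <> 0).
{ intros s w Hs Hw. apply Cmod_gt_0. assert (T := Cmod_triangle (s - w)%C (w - (x, y))%C).
  replace (s - w + (w - (x, y)))%C with (s - (x, y))%C in T by ring. specialize (Hfar s Hs). lra. }
assert (Hz : Cmod ((x, y) - (x, y))%C < r / 2) by (replace ((x, y) - (x, y))%C with (RtoC 0) by ring; rewrite Cmod_0; lra).
assert (Hpos : forall n, 0 < r ^ n) by (intros; apply pow_lt; auto).
split.
- apply (contour_int_param_derive f (fun s w => / (s - w))%C (fun s => / ((s - (x, y)) * (s - (x, y))))%C a b c d (x, y) (M * (2 / r ^ 3)) (r / 2)); auto; try lra.
  + apply Rmult_le_pos; auto. left. apply Rdiv_lt_0_compat; auto; lra.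
  + intros s w Hs Hw. apply Ccont_mult; auto. apply Ccont_inv; auto.
  + intros s Hs. apply Ccont_mult; auto. apply Ccont_inv; [apply Ccont_mult; auto|apply Cmult_neq_0; auto].
  + intros s w Hs Hw. rewrite Cmod_mult, Rmult_assoc.
    apply Rmult_le_compat; try apply Cmod_ge_0; [apply HM, bdry_on_rect; auto|].
    replace (s - w)%C with ((s - (x, y)) - (w - (x, y)))%C by ring. apply kernel1_taylor; auto.
- apply (contour_int_param_derive f (fun s w => / ((s - w) * (s - w)))%C (fun s => 2 * / ((s - (x, y)) * (s - (x, y)) * (s - (x, y))))%C a b c d (x, y) (M * (16 / r ^ 4)) (r / 2)); auto; try lra.
  + apply Rmult_le_pos; auto. left. apply Rdiv_lt_0_compat; auto; lra.
  + intros s w Hs Hw. apply Ccont_mult; auto. apply Ccont_inv; [apply Ccont_mult; auto|apply Cmult_neq_0; auto].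
  + intros s Hs. apply Ccont_mult; auto. apply Ccont_mult; [apply Ccont_const|].
    apply Ccont_inv; [repeat apply Ccont_mult; auto|repeat apply Cmult_neq_0; auto].
  + intros s w Hs Hw. rewrite Cmod_mult, Rmult_assoc.
    apply Rmult_le_compat; try apply Cmod_ge_0; [apply HM, bdry_on_rect; auto|].
    replace (s - w)%C with ((s - (x, y)) - (w - (x, y)))%C by ring. apply kernel2_taylor; auto.
Qed.

Lemma cauchy_rect_derive x y : a < x < b -> c < y < d ->
  @is_derive C_AbsRing C_NormedModule f (x, y) (/ cauchy_const * G2 (x, y))%C.
Proof.
intros Hx Hy. destruct (bdry_far a b c d x y Hx Hy) as [r [Hr [Hfar Hin]]].
apply (is_derive_C_ext (fun w => / cauchy_const * G1 w)%C f (x, y) _ r Hr).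
- intros [w1 w2] Hw. destruct (Hin _ Hw) as [W1 W2]; simpl in W1, W2.
  unfold G1. pose proof (cauchy_rect f a b c d w1 w2 W1 W2 Hf) as E. unfold Cdiv in E.
  rewrite E. field. apply cauchy_const_neq0.
- apply is_derive_Cconst_scal. exact (proj1 (cauchy_integral_derive x y Hx Hy)).
Qed.

(** Near (x, y) the derivative agrees with [G2] divided by [cauchy_const], and [G2] has derivative
    [G3]. This yields the regularity of derivatives that pointwise differentiability does not
    contain. *)
Lemma Cdiff_C_derive x y : a < x < b -> c < y < d -> Cdiff (C_derive f) (x, y).
Proof.
intros Hx Hy. destruct (bdry_far a b c d x y Hx Hy) as [r [Hr [Hfar Hin]]].
exists (/ cauchy_const * G3 (x, y))%C.
apply (is_derive_C_ext (fun w => / cauchy_const * G2 w)%C _ (x, y) _ r Hr).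
- intros [w1 w2] Hw. destruct (Hin _ Hw) as [W1 W2]; simpl in W1, W2.
  symmetry. apply is_C_derive_unique. apply cauchy_rect_derive; auto.
- apply is_derive_Cconst_scal. exact (proj2 (cauchy_integral_derive x y Hx Hy)).
Qed.

End CauchyDerivative.

(** * Bounds for a function and its derivative by integrals over the sides *)

Lemma Ccont_Cmod_hline (f : C -> C) (x y : R) : Ccont f (x, y) ->
  continuous (fun t => Cmod (f (t, y))) x.
Proof.
intros H. rewrite Ccont_iff in H. intros P [e He].
destruct (H e (cond_pos e)) as [d [Hd Hd']].
exists (mkposreal d Hd). intros t Ht. apply He.
change (Rabs (Cmod (f (t, y)) - Cmod (f (x, y))) < e).
assert (T : Cmod (f (t, y) - f (x, y))%C < e).
{ apply Hd'. eapply Rle_lt_trans; [apply Cmod_le_sum|]. simpl.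
  replace (y + - y) with 0 by ring. rewrite Rabs_R0, Rplus_0_r. exact Ht. }
assert (T1 := Cmod_triangle (f (t, y) - f (x, y))%C (f (x, y))).
assert (T2 := Cmod_triangle (f (x, y) - f (t, y))%C (f (t, y))).
replace (f (t, y) - f (x, y) + f (x, y))%C with (f (t, y)) in T1 by ring.
replace (f (x, y) - f (t, y) + f (t, y))%C with (f (x, y)) in T2 by ring.
replace (f (x, y) - f (t, y))%C with (- (f (t, y) - f (x, y)))%C in T2 by ring. rewrite Cmod_opp in T2.
apply Rabs_def1; lra.
Qed.

Lemma Ccont_Cmod_vline (f : C -> C) (x y : R) : Ccont f (x, y) ->
  continuous (fun t => Cmod (f (x, t))) y.
Proof.
intros H. rewrite Ccont_iff in H. intros P [e He].
destruct (H e (cond_pos e)) as [d [Hd Hd']].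
exists (mkposreal d Hd). intros t Ht. apply He.
change (Rabs (Cmod (f (x, t)) - Cmod (f (x, y))) < e).
assert (T : Cmod (f (x, t) - f (x, y))%C < e).
{ apply Hd'. eapply Rle_lt_trans; [apply Cmod_le_sum|]. simpl.
  replace (x + - x) with 0 by ring. rewrite Rabs_R0, Rplus_0_l. exact Ht. }
assert (T1 := Cmod_triangle (f (x, t) - f (x, y))%C (f (x, y))).
assert (T2 := Cmod_triangle (f (x, y) - f (x, t))%C (f (x, t))).
replace (f (x, t) - f (x, y) + f (x, y))%C with (f (x, t)) in T1 by ring.
replace (f (x, y) - f (x, t) + f (x, t))%C with (f (x, y)) in T2 by ring.
replace (f (x, y) - f (x, t))%C with (- (f (x, t) - f (x, y)))%C in T2 by ring. rewrite Cmod_opp in T2.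
apply Rabs_def1; lra.
Qed.

Definition hside (f : C -> C) (y a b : R) : R := RInt (fun t => Cmod (f (t, y))) a b.
Definition vside (f : C -> C) (x a b : R) : R := RInt (fun t => Cmod (f (x, t))) a b.

Lemma ex_hside f y a b : a <= b -> (forall t, a <= t <= b -> Ccont f (t, y)) ->
  ex_RInt (fun t => Cmod (f (t, y))) a b.
Proof.
intros Hab H. apply (ex_RInt_continuous (V := R_CompleteNormedModule)).
rewrite Rmin_left, Rmax_right by auto. intros t Ht. apply Ccont_Cmod_hline. auto.
Qed.

Lemma ex_vside f x a b : a <= b -> (forall t, a <= t <= b -> Ccont f (x, t)) ->
  ex_RInt (fun t => Cmod (f (x, t))) a b.
Proof.
intros Hab H. apply (ex_RInt_continuous (V := R_CompleteNormedModule)).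
rewrite Rmin_left, Rmax_right by auto. intros t Ht. apply Ccont_Cmod_vline. auto.
Qed.

Lemma Cint_le_RInt (g : R -> C) (h : R -> R) a b K : a <= b -> ex_Cint g a b -> ex_RInt h a b ->
  (forall t, a <= t <= b -> Cmod (g t) <= K * h t) ->
  Cmod (Cint g a b) <= K * RInt h a b.
Proof.
intros Hab Hg Hh HK. Transparent Cint ex_Cint. rewrite <- norm_C.
apply (norm_RInt_le (V := C_R_NormedModule) g (fun t => K * h t) a b); auto.
- intros t Ht. rewrite norm_C. auto.
- exact (RInt_correct (V := C_R_CompleteNormedModule) g a b Hg).
- apply (is_RInt_scal (V := R_NormedModule) h a b K). exact (RInt_correct (V := R_CompleteNormedModule) h a b Hh).
Qed.
Opaque Cint ex_Cint.

Lemma contour_int_le_sides (f k : C -> C) a b c d K : a <= b -> c <= d ->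
  (forall s, bdry a b c d s -> Ccont f s) ->
  (forall s, bdry a b c d s -> Ccont k s) ->
  (forall s, bdry a b c d s -> Cmod (k s) <= K) ->
  Cmod (contour_int (fun s => f s * k s)%C a b c d)
  <= K * (hside f c a b + hside f d a b + vside f a c d + vside f b c d).
Proof.
intros Hab Hcd Hf Hk HK.
assert (Hm : forall s, bdry a b c d s -> Cmod (f s * k s)%C <= K * Cmod (f s)).
{ intros s Hs. rewrite Cmod_mult, Rmult_comm. apply Rmult_le_compat_r; [apply Cmod_ge_0|auto]. }
assert (Hfk : forall s, bdry a b c d s -> Ccont (fun s => f s * k s)%C s) by (intros; apply Ccont_mult; auto).
unfold contour_int, Cminus.
assert (H1 : Cmod (Cint (fun t => f (t, c) * k (t, c))%C a b) <= K * hside f c a b).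
{ apply Cint_le_RInt; auto.
  - apply (ex_Cint_h (fun s => f s * k s)%C); auto; intros; apply Hfk; unfold bdry; simpl; auto.
  - apply ex_hside; auto; intros; apply Hf; unfold bdry; simpl; auto.
  - intros; apply Hm; unfold bdry; simpl; auto. }
assert (H2 : Cmod (Cint (fun t => f (t, d) * k (t, d))%C a b) <= K * hside f d a b).
{ apply Cint_le_RInt; auto.
  - apply (ex_Cint_h (fun s => f s * k s)%C); auto; intros; apply Hfk; unfold bdry; simpl; auto.
  - apply ex_hside; auto; intros; apply Hf; unfold bdry; simpl; auto.
  - intros; apply Hm; unfold bdry; simpl; auto. }
assert (H3 : Cmod (Cint (fun t => f (a, t) * k (a, t))%C c d) <= K * vside f a c d).
{ apply Cint_le_RInt; auto.
  - apply (ex_Cint_v (fun s => f s * k s)%C); auto; intros; apply Hfk; unfold bdry; simpl; auto.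
  - apply ex_vside; auto; intros; apply Hf; unfold bdry; simpl; auto.
  - intros; apply Hm; unfold bdry; simpl; auto. }
assert (H4 : Cmod (Cint (fun t => f (b, t) * k (b, t))%C c d) <= K * vside f b c d).
{ apply Cint_le_RInt; auto.
  - apply (ex_Cint_v (fun s => f s * k s)%C); auto; intros; apply Hfk; unfold bdry; simpl; auto.
  - apply ex_vside; auto; intros; apply Hf; unfold bdry; simpl; auto.
  - intros; apply Hm; unfold bdry; simpl; auto. }
eapply Rle_trans; [apply Cmod_triangle|].
eapply Rle_trans; [apply Rplus_le_compat_r, Cmod_triangle|].
eapply Rle_trans; [apply Rplus_le_compat_r, Rplus_le_compat_r, Cmod_triangle|].
rewrite !Cmod_opp, !Cmod_mult, Cmod_Ci. lra.
Qed.

Lemma RInt_sub_le (g : R -> R) a a' b' b : a <= a' -> a' <= b' -> b' <= b ->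
  (forall t, a <= t <= b -> continuous g t) -> (forall t, 0 <= g t) ->
  RInt g a' b' <= RInt g a b.
Proof.
intros H1 H2 H3 Hc Hp.
assert (ex : forall u v, a <= u -> u <= v -> v <= b -> ex_RInt g u v).
{ intros u v Hu Huv Hv. apply (ex_RInt_continuous (V := R_CompleteNormedModule)).
  rewrite Rmin_left, Rmax_right by auto. intros; apply Hc; lra. }
rewrite <- (RInt_Chasles g a a' b), <- (RInt_Chasles g a' b' b) by (apply ex; lra).
assert (0 <= RInt g a a') by (apply RInt_ge_0; auto; apply ex; lra).
assert (0 <= RInt g b' b) by (apply RInt_ge_0; auto; apply ex; lra).
unfold plus; simpl. lra.
Qed.

Section Estimates.
Variables (f : C -> C) (x y r : R).
Hypothesis Hr : 0 < r.
Hypothesis Hf : forall z, on_rect (x - r) (x + r) (y - r) (y + r) z -> Cdiff f z.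
Variables (a b c d : R).
Hypotheses (Ha : x - r <= a <= x - r / 2) (Hb : x + r / 2 <= b <= x + r)
  (Hc : y - r <= c <= y - r / 2) (Hd : y + r / 2 <= d <= y + r).

(** Each side is prolonged to the full width of the large square. Its integral then depends on one
    of [a], [b], [c], [d] only, which is what allows the four positions to be chosen independently
    of each other in [local_mean]. *)
Let S := hside f c (x - r) (x + r) + hside f d (x - r) (x + r)
       + vside f a (y - r) (y + r) + vside f b (y - r) (y + r).

Lemma contour_int_le_S k K : 0 <= K ->
  (forall s, bdry a b c d s -> Ccont k s) ->
  (forall s, bdry a b c d s -> Cmod (k s) <= K) ->
  Cmod (contour_int (fun s => f s * k s)%C a b c d) <= K * S.
Proof.
intros HK Hk HkK. assert (Hcont : forall u v, x - r <= u <= x + r -> y - r <= v <= y + r -> Ccont f (u, v)).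
{ intros. apply Cdiff_Ccont, Hf. split; auto. }
eapply Rle_trans; [apply contour_int_le_sides with (K := K); auto; try lra|].
- intros [u v] Hs. unfold bdry in Hs; simpl in Hs. apply Hcont; lra.
- apply Rmult_le_compat_l; auto. unfold S, hside, vside.
  repeat apply Rplus_le_compat; (apply RInt_sub_le; try lra; [|intros; apply Cmod_ge_0]);
  intros t Ht; first [apply Ccont_Cmod_hline|apply Ccont_Cmod_vline]; apply Hcont; lra.
Qed.

Lemma far_bdry s : bdry a b c d s -> r / 2 <= Cmod (s - (x, y))%C.
Proof.
destruct s as [s1 s2]. intros Hs. unfold bdry in Hs; simpl in Hs.
eapply Rle_trans; [|apply Rmax_Cmod]. simpl.
destruct Hs as [[_ Hz]|[_ Hz]].
- eapply Rle_trans; [|apply Rmax_r]. destruct Hz; subst; unfold Rabs; destruct Rcase_abs; lra.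
- eapply Rle_trans; [|apply Rmax_l]. destruct Hz; subst; unfold Rabs; destruct Rcase_abs; lra.
Qed.

Lemma Cmod_Ninv_le (G : C) : Cmod (/ cauchy_const * G)%C <= Cmod G / 4.
Proof.
rewrite Cmod_mult, Cmod_inv by apply cauchy_const_neq0.
rewrite Rmult_comm. apply Rmult_le_compat_l; [apply Cmod_ge_0|].
apply Rinv_le_contravar; [lra|apply cauchy_const_ge4].
Qed.

Let Hrect : forall z, on_rect a b c d z -> Cdiff f z.
Proof. intros z [H1 H2]. apply Hf. unfold on_rect. lra. Qed.

(** The sides stay at distance at least r / 2 from the centre, so the kernel is at most 2 / r; with
    the factor 1/4 from [cauchy_const] this gives S / 2. *)
Lemma value_le_sides : r * Cmod (f (x, y)) <= S.
Proof.
assert (E : f (x, y) = (/ cauchy_const * contour_int (fun s => f s * / (s - (x, y)))%C a b c d)%C).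
{ pose proof (cauchy_rect f a b c d x y) as E. unfold Cdiv in E. rewrite E; auto; try lra.
  field. apply cauchy_const_neq0. }
rewrite E. apply Rle_trans with (r * (/ (r / 2) * S / 4)).
- apply Rmult_le_compat_l; [lra|]. eapply Rle_trans; [apply Cmod_Ninv_le|].
  apply Rmult_le_compat_r; [lra|].
  assert (Hne : forall s, bdry a b c d s -> (s - (x, y))%C <> 0).
  { intros s Hs. apply Cmod_gt_0. pose proof (far_bdry s Hs). lra. }
  apply contour_int_le_S.
  + left. apply Rinv_0_lt_compat. lra.
  + intros s Hs. apply Ccont_inv; auto. apply Ccont_minus; [apply Ccont_id|apply Ccont_const].
  + intros s Hs. rewrite Cmod_inv by auto. apply Rinv_le_contravar; [lra|apply far_bdry; auto].
(* Nonnegativity of [S] is read off from the same estimate with the zero kernel and [K] equal to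
   1. *)
- assert (0 <= S).
  { assert (T := contour_int_le_S (fun _ => 0) 1 Rle_0_1 (fun s _ => Ccont_const 0 s)).
    apply Rle_trans with (1 * S); [|lra]. eapply Rle_trans; [apply Cmod_ge_0|apply T].
    intros. rewrite Cmod_0. lra. }
  replace (r * (/ (r / 2) * S / 4)) with (S / 2) by (field; lra). lra.
Qed.

(** Now the kernel is at most 4 / r^2, and the factor 1/4 from [cauchy_const] is used up
    entirely. *)
Lemma derive_le_sides : r ^ 2 * Cmod (C_derive f (x, y)) <= S.
Proof.
assert (E : C_derive f (x, y) = (/ cauchy_const * contour_int (fun s => f s * / ((s - (x, y)) * (s - (x, y))))%C a b c d)%C).
{ apply is_C_derive_unique. apply cauchy_rect_derive; auto; lra. }
rewrite E. apply Rle_trans with (r ^ 2 * (/ (r / 2 * (r / 2)) * S / 4)).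
- apply Rmult_le_compat_l; [nra|]. eapply Rle_trans; [apply Cmod_Ninv_le|].
  apply Rmult_le_compat_r; [lra|].
  assert (Hne : forall s, bdry a b c d s -> (s - (x, y))%C <> 0).
  { intros s Hs. apply Cmod_gt_0. pose proof (far_bdry s Hs). lra. }
  assert (Hcs : forall s, Ccont (fun s => s - (x, y))%C s) by (intros; apply Ccont_minus; [apply Ccont_id|apply Ccont_const]).
  apply contour_int_le_S.
  + left. apply Rinv_0_lt_compat. nra.
  + intros s Hs. apply Ccont_inv; [apply Ccont_mult; auto|apply Cmult_neq_0; auto].
  + intros s Hs. rewrite Cmod_inv, Cmod_mult by (apply Cmult_neq_0; auto).
    pose proof (far_bdry s Hs). apply Rinv_le_contravar; [nra|]. apply Rmult_le_compat; lra.
- right. field. lra.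
Qed.

End Estimates.

(** * Wirtinger derivatives and the Schwarzian *)

(* [p] and [q] are the values at [z] of [Dz G] and [Dzb G], so that the partial
   derivatives of [G] are [p + q] and [i (p - q)]. *)
Definition has_wirtinger (G : C -> C) (z p q : C) : Prop :=
  is_derive (fun t => fst (G (t, snd z))) (fst z) (fst p + fst q) /\
  is_derive (fun t => snd (G (t, snd z))) (fst z) (snd p + snd q) /\
  is_derive (fun t => fst (G (fst z, t))) (snd z) (snd q - snd p) /\
  is_derive (fun t => snd (G (fst z, t))) (snd z) (fst p - fst q).

Ltac split4 := split; [|split; [|split]].
Ltac rring := match goal with |- @eq _ ?a ?b => change (@eq R a b) end;
  unfold minus, plus, opp, scal, zero; simpl; unfold mult; simpl; ring.

Lemma has_wirtinger_Dz G z p q : has_wirtinger G z p q -> Dz G z = p.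
Proof.
intros (H1 & H2 & H3 & H4). unfold Dz, dx, dy.
assert (E1 : Derive (fun t : R => fst (G (t, snd z))) (fst z) = fst p + fst q) by exact (is_derive_unique _ _ _ H1).
assert (E2 : Derive (fun t : R => snd (G (t, snd z))) (fst z) = snd p + snd q) by exact (is_derive_unique _ _ _ H2).
assert (E3 : Derive (fun t : R => fst (G (fst z, t))) (snd z) = snd q - snd p) by exact (is_derive_unique _ _ _ H3).
assert (E4 : Derive (fun t : R => snd (G (fst z, t))) (snd z) = fst p - fst q) by exact (is_derive_unique _ _ _ H4).
rewrite E1, E2, E3, E4.
destruct p, q. unfold Cmult, Cminus, Cplus, Copp, RtoC, Ci; simpl. f_equal; field.
Qed.

Lemma is_derive_val (f : R -> R) x l l' : is_derive f x l -> l = l' -> is_derive f x l'.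
Proof. intros H <-. exact H. Qed.

Lemma has_wirtinger_val G z p q p' q' : has_wirtinger G z p q -> p = p' -> q = q' -> has_wirtinger G z p' q'.
Proof. intros H <- <-. exact H. Qed.

Lemma has_wirtinger_ext G K z p q r : 0 < r -> (forall w : C, Cmod (w - z)%C < r -> G w = K w) ->
  has_wirtinger G z p q -> has_wirtinger K z p q.
Proof.
intros Hr HGK (H1 & H2 & H3 & H4).
assert (Ex : locally (fst z) (fun t => G (t, snd z) = K (t, snd z))).
{ exists (mkposreal r Hr). intros t Ht. apply HGK. eapply Rle_lt_trans; [apply Cmod_le_sum|]. simpl.
  replace (snd z + - snd z) with 0 by ring. rewrite Rabs_R0, Rplus_0_r. exact Ht. }
assert (Ey : locally (snd z) (fun t => G (fst z, t) = K (fst z, t))).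
{ exists (mkposreal r Hr). intros t Ht. apply HGK. eapply Rle_lt_trans; [apply Cmod_le_sum|]. simpl.
  replace (fst z + - fst z) with 0 by ring. rewrite Rabs_R0, Rplus_0_l. exact Ht. }
split4; (eapply is_derive_ext_loc; [|first [exact H1|exact H2|exact H3|exact H4]]);
  (eapply filter_imp; [|first [exact Ex|exact Ey]]); simpl; intros t ->; reflexivity.
Qed.

(** The vanishing second component is the Cauchy-Riemann system: increments along the real axis give
    l, those along the imaginary axis give i l. *)
Lemma has_wirtinger_analytic u z l : @is_derive C_AbsRing C_NormedModule u z l -> has_wirtinger u z l 0.
Proof.
intros H. rewrite is_derive_C_iff in H.
assert (Hx : forall eps, 0 < eps -> exists d, 0 < d /\ forall t, Rabs (t - fst z) < d ->
  Cmod (u (t, snd z) - u z - RtoC (t - fst z) * l)%C <= eps * Rabs (t - fst z)).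
{ intros eps He. destruct (H eps He) as [d [Hd Hd']]. exists d. split; auto. intros t Ht.
  assert (E : ((t, snd z) - z)%C = RtoC (t - fst z)).
  { destruct z; unfold RtoC, Cminus, Cplus, Copp; simpl; f_equal; ring. }
  specialize (Hd' (t, snd z)). rewrite E, Cmod_R in Hd'. auto. }
assert (Hy : forall eps, 0 < eps -> exists d, 0 < d /\ forall t, Rabs (t - snd z) < d ->
  Cmod (u (fst z, t) - u z - RtoC (t - snd z) * (Ci * l))%C <= eps * Rabs (t - snd z)).
{ intros eps He. destruct (H eps He) as [d [Hd Hd']]. exists d. split; auto. intros t Ht.
  assert (E : ((fst z, t) - z)%C = (RtoC (t - snd z) * Ci)%C).
  { destruct z; unfold RtoC, Cminus, Cmult, Cplus, Copp, Ci; simpl; f_equal; ring. }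
  specialize (Hd' (fst z, t)). rewrite E, Cmod_mult, Cmod_Ci, Cmod_R, Rmult_1_r in Hd'.
  rewrite Cmult_assoc. auto. }
assert (K : forall (v : R -> C) (x0 : R) (m : C),
  (forall eps, 0 < eps -> exists d, 0 < d /\ forall t, Rabs (t - x0) < d ->
    Cmod (v t - v x0 - RtoC (t - x0) * m)%C <= eps * Rabs (t - x0)) ->
  is_derive (fun t => fst (v t)) x0 (fst m) /\ is_derive (fun t => snd (v t)) x0 (snd m)).
{ intros v x0 m Hv.
  assert (Q : forall pr : C -> R, (forall y, Rabs (pr y) <= Cmod y) ->
     (forall y (k : R), pr (v y - v x0 - RtoC k * m)%C = pr (v y) - pr (v x0) - k * pr m) ->
     is_derive (fun t => pr (v t)) x0 (pr m)).
  { intros pr Hp1 Hp2. split; [apply is_linear_scal_l|].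
    intros y Hy0. apply (is_filter_lim_locally_unique (K := R_AbsRing) (V := R_NormedModule)) in Hy0. subst y.
    intros [eps He]. destruct (Hv eps He) as [d [Hd Hd']]. exists (mkposreal d Hd). intros t Ht.
    change (Rabs (pr (v t) - pr (v x0) - (t - x0) * pr m) <= eps * Rabs (t - x0)).
    rewrite <- Hp2. eapply Rle_trans; [apply Hp1|]. apply Hd'. exact Ht. }
  split; [apply (Q (fun y : C => fst y))|apply (Q (fun y : C => snd y))].
  - intros y. eapply Rle_trans; [|apply Rmax_Cmod]. apply Rmax_l.
  - intros y k. destruct (v y), (v x0), m. simpl. ring.
  - intros y. eapply Rle_trans; [|apply Rmax_Cmod]. apply Rmax_r.
  - intros y k. destruct (v y), (v x0), m. simpl. ring. }
assert (Ez : u z = u (fst z, snd z)) by (destruct z; reflexivity).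
destruct (K (fun t => u (t, snd z)) (fst z) l) as [K1 K2]; [rewrite <- Ez; exact Hx|].
destruct (K (fun t => u (fst z, t)) (snd z) (Ci * l)%C) as [K3 K4]; [rewrite <- Ez; exact Hy|].
unfold has_wirtinger; split4;
(eapply is_derive_val; [first [exact K1|exact K2|exact K3|exact K4]|]); simpl; ring.
Qed.

Lemma has_wirtinger_conj G z p q : has_wirtinger G z p q -> has_wirtinger (fun w => Cconj (G w)) z (Cconj q) (Cconj p).
Proof.
intros (H1 & H2 & H3 & H4). unfold has_wirtinger; simpl. split4.
- eapply is_derive_val; [exact H1|rring].
- eapply is_derive_val; [exact (is_derive_opp _ _ _ H2)|]. rring.
- eapply is_derive_val; [exact H3|rring].
- eapply is_derive_val; [exact (is_derive_opp _ _ _ H4)|]. rring.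
Qed.

Lemma has_wirtinger_minus G K z p q p' q' : has_wirtinger G z p q -> has_wirtinger K z p' q' ->
  has_wirtinger (fun w => G w - K w)%C z (p - p')%C (q - q')%C.
Proof.
intros (H1 & H2 & H3 & H4) (K1 & K2 & K3 & K4). unfold has_wirtinger; simpl. split4;
(eapply is_derive_val; [first [exact (is_derive_minus _ _ _ _ _ H1 K1)|exact (is_derive_minus _ _ _ _ _ H2 K2)|exact (is_derive_minus _ _ _ _ _ H3 K3)|exact (is_derive_minus _ _ _ _ _ H4 K4)]|]);
rring.
Qed.

Lemma has_wirtinger_mult G K z p q p' q' : has_wirtinger G z p q -> has_wirtinger K z p' q' ->
  has_wirtinger (fun w => G w * K w)%C z (p * K z + G z * p')%C (q * K z + G z * q')%C.
Proof.
intros (H1 & H2 & H3 & H4) (K1 & K2 & K3 & K4).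
assert (Ez : z = (fst z, snd z)) by (destruct z; reflexivity).
assert (M : forall (f g : R -> R) x l m, is_derive f x l -> is_derive g x m -> is_derive (fun t => f t * g t) x (l * g x + f x * m)).
{ intros f g x l m Hf Hg. exact (is_derive_mult (K := R_AbsRing) f g x l m Hf Hg Rmult_comm). }
unfold has_wirtinger; simpl. split4;
(eapply is_derive_val;
 [first [exact (is_derive_minus _ _ _ _ _ (M _ _ _ _ _ H1 K1) (M _ _ _ _ _ H2 K2))
        |exact (is_derive_plus _ _ _ _ _ (M _ _ _ _ _ H1 K2) (M _ _ _ _ _ H2 K1))
        |exact (is_derive_minus _ _ _ _ _ (M _ _ _ _ _ H3 K3) (M _ _ _ _ _ H4 K4))
        |exact (is_derive_plus _ _ _ _ _ (M _ _ _ _ _ H3 K4) (M _ _ _ _ _ H4 K3))]|]);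
simpl; rewrite <- Ez; rring.
Qed.

(** As the function is real, its imaginary part has derivative 0 in both directions, so p and q are
    conjugate. These relations are recovered from uniqueness of the derivative and make the
    imaginary part of the result vanish as well. *)
Lemma has_wirtinger_real (J : C -> R) (phi : R -> R) z p q l :
  has_wirtinger (fun w => RtoC (J w)) z p q -> is_derive phi (J z) l ->
  has_wirtinger (fun w => RtoC (phi (J w))) z (RtoC l * p)%C (RtoC l * q)%C.
Proof.
intros (H1 & H2 & H3 & H4) Hp. simpl in *.
assert (Ez : z = (fst z, snd z)) by (destruct z; reflexivity).
assert (E2 := is_derive_unique _ _ _ H2). assert (E4 := is_derive_unique _ _ _ H4).
rewrite Derive_const in E2, E4.
rewrite Ez in Hp.
unfold has_wirtinger; simpl. split4.
- eapply is_derive_val; [exact (is_derive_comp phi (fun t => J (t, snd z)) _ _ _ Hp H1)|]. rring.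
- eapply is_derive_val; [apply is_derive_const|]. transitivity (l * (snd p + snd q)); [rewrite <- E2|]; rring.
- eapply is_derive_val; [exact (is_derive_comp phi (fun t => J (fst z, t)) _ _ _ Hp H3)|]. rring.
- eapply is_derive_val; [apply is_derive_const|]. transitivity (l * (fst p - fst q)); [rewrite <- E4|]; rring.
Qed.

(** * Analytic functions on the disk *)

Lemma cder_spec u z : analytic_on_D u -> inD z -> @is_derive C_AbsRing C_NormedModule u z (cder u z).
Proof. intros H Hz. apply C_derive_correct; auto. Qed.

Lemma inD_nbhd z w : Cmod (w - z)%C < 1 - Cmod z -> inD w.
Proof.
intros H. unfold inD. replace w with ((w - z) + z)%C by ring.
eapply Rle_lt_trans; [apply Cmod_triangle|]. lra.
Qed.

Lemma inD_square (z w : C) r : 2 * r < 1 - Cmod z ->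
  on_rect (fst z - r) (fst z + r) (snd z - r) (snd z + r) w -> inD w.
Proof.
intros Hr [H1 H2]. apply (inD_nbhd z). destruct z as [x y], w as [u v]; simpl in *.
eapply Rle_lt_trans; [apply Cmod_le_sum|]. simpl. unfold Rabs; destruct Rcase_abs, Rcase_abs; lra.
Qed.

Lemma analytic_cder u : analytic_on_D u -> analytic_on_D (cder u).
Proof.
intros Hu z Hz. set (r := (1 - Cmod z) / 3). assert (0 < r) by (unfold r, inD in *; lra).
assert (Hrect : forall w, on_rect (fst z - r) (fst z + r) (snd z - r) (snd z + r) w -> Cdiff u w).
{ intros w Hw. apply Hu, (inD_square z w r); [unfold r, inD in *; lra|exact Hw]. }
destruct z as [x y]. simpl in Hrect. apply (Cdiff_C_derive u (x - r) (x + r) (y - r) (y + r) Hrect); lra.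
Qed.

Lemma analytic_div u v : analytic_on_D u -> analytic_on_D v -> (forall z, inD z -> v z <> 0) ->
  analytic_on_D (fun z => u z / v z)%C.
Proof. intros Hu Hv H0 z Hz. apply Cdiff_mult; [apply Hu; auto|]. apply Cdiff_inv; [apply Hv; auto|auto]. Qed.

Definition preschwarz (h : C -> C) (z : C) : C := (cder (cder h) z / cder h z)%C.

(** * The derivative F_z and the Schwarzian in terms of h''/h' and the dilatation *)

Section Formulas.
Variables (h g : C -> C).
Hypotheses (Hh : analytic_on_D h) (Hg : analytic_on_D g).
Hypothesis Hh0 : forall z, inD z -> cder h z <> 0.
Hypothesis Hw1 : forall z, inD z -> Cmod (dilatation h g z) < 1.

Let H z := cder h z.
Let H1 z := cder (cder h) z.
Let H2 z := cder (cder (cder h)) z.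
Let G z := cder g z.
Let G1 z := cder (cder g) z.
Let G2 z := cder (cder (cder g)) z.
Let J z := jacobian h g z.
(** The z-derivative of the Jacobian h' conj(h') - g' conj(g'): the conjugate factors are
    annihilated. *)
Let P z := (H1 z * Cconj (H z) - G1 z * Cconj (G z))%C.

Let AH : analytic_on_D H. Proof. apply analytic_cder, Hh. Qed.
Let AH1 : analytic_on_D H1. Proof. apply analytic_cder, AH. Qed.
Let AG : analytic_on_D G. Proof. apply analytic_cder, Hg. Qed.
Let AG1 : analytic_on_D G1. Proof. apply analytic_cder, AG. Qed.

Lemma jacobian_pos z : inD z -> 0 < J z.
Proof.
intros Hz. unfold J, jacobian. specialize (Hw1 z Hz). unfold dilatation in Hw1.
rewrite Cmod_div in Hw1 by auto.
assert (0 < Cmod (cder h z)) by (apply Cmod_gt_0; auto).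
apply Rlt_div_l in Hw1; auto. pose proof (Cmod_ge_0 (cder g z)). nra.
Qed.

Lemma has_wirtinger_jacobian z : inD z -> has_wirtinger (fun w => RtoC (J w)) z (P z) (H z * Cconj (H1 z) - G z * Cconj (G1 z))%C.
Proof.
intros Hz.
assert (WH : has_wirtinger H z (H1 z) 0) by exact (has_wirtinger_analytic _ _ _ (cder_spec H z AH Hz)).
assert (WG : has_wirtinger G z (G1 z) 0) by exact (has_wirtinger_analytic _ _ _ (cder_spec G z AG Hz)).
assert (W := has_wirtinger_minus _ _ _ _ _ _ _ (has_wirtinger_mult _ _ _ _ _ _ _ WH (has_wirtinger_conj _ _ _ _ WH)) (has_wirtinger_mult _ _ _ _ _ _ _ WG (has_wirtinger_conj _ _ _ _ WG))).
assert (E0 : Cconj 0 = 0) by (unfold Cconj, RtoC; simpl; f_equal; ring).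
rewrite E0 in W.
assert (E : forall w, Cmod (w - z)%C < 1 -> (H w * Cconj (H w) - G w * Cconj (G w))%C = RtoC (J w)).
{ intros w _. unfold J, jacobian. rewrite RtoC_minus, !Cmod2_conj. reflexivity. }
eapply has_wirtinger_val; [exact (has_wirtinger_ext _ _ _ _ _ 1 Rlt_0_1 E W)|unfold P; ring|ring].
Qed.

Lemma Dz_logJ z : inD z -> Dz (logJ h g) z = (RtoC (/ J z) * P z)%C.
Proof.
intros Hz. eapply has_wirtinger_Dz.
apply (has_wirtinger_real J ln z _ _ (/ J z) (has_wirtinger_jacobian z Hz)).
apply is_derive_ln, jacobian_pos; auto.
Qed.

(** F_z = P / J holds on a whole neighbourhood of z, so it may be differentiated: F_zz = P_z / J -
    (P / J)^2, and the term -1/2 F_z^2 of the definition makes the coefficient -3/2. *)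
Lemma schwarzian_formula z : inD z -> schwarzian h g z =
  (RtoC (/ J z) * (H2 z * Cconj (H z) - G2 z * Cconj (G z))
   - (3 / 2)%R * ((RtoC (/ J z) * P z) * (RtoC (/ J z) * P z)))%C.
Proof.
intros Hz. unfold schwarzian. rewrite (Dz_logJ z Hz).
assert (HJ := jacobian_pos z Hz).
assert (WH : has_wirtinger H z (H1 z) 0) by exact (has_wirtinger_analytic _ _ _ (cder_spec H z AH Hz)).
assert (WG : has_wirtinger G z (G1 z) 0) by exact (has_wirtinger_analytic _ _ _ (cder_spec G z AG Hz)).
assert (WH1 : has_wirtinger H1 z (H2 z) 0) by exact (has_wirtinger_analytic _ _ _ (cder_spec H1 z AH1 Hz)).
assert (WG1 : has_wirtinger G1 z (G2 z) 0) by exact (has_wirtinger_analytic _ _ _ (cder_spec G1 z AG1 Hz)).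
assert (WP := has_wirtinger_minus _ _ _ _ _ _ _ (has_wirtinger_mult _ _ _ _ _ _ _ WH1 (has_wirtinger_conj _ _ _ _ WH)) (has_wirtinger_mult _ _ _ _ _ _ _ WG1 (has_wirtinger_conj _ _ _ _ WG))).
assert (WJ : has_wirtinger (fun w => RtoC (/ J w)) z (RtoC (- / (J z * J z)) * P z)%C (RtoC (- / (J z * J z)) * (H z * Cconj (H1 z) - G z * Cconj (G1 z)))%C).
{ apply (has_wirtinger_real J Rinv z _ _ (- / (J z * J z)) (has_wirtinger_jacobian z Hz)).
  eapply is_derive_val; [apply is_derive_inv; [apply is_derive_id|lra]|]. unfold one; simpl. unfold pow. field. lra. }
assert (W := has_wirtinger_mult _ _ _ _ _ _ _ WJ WP).
assert (E0 : Cconj 0 = 0) by (unfold Cconj, RtoC; simpl; f_equal; ring).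
rewrite E0 in W.
assert (HC : 0 < 1 - Cmod z) by (unfold inD in Hz; lra).
assert (E : forall w, Cmod (w - z)%C < 1 - Cmod z -> (RtoC (/ J w) * P w)%C = Dz (logJ h g) w).
{ intros w Hw. symmetry. apply Dz_logJ. eapply inD_nbhd, Hw. }
rewrite (has_wirtinger_Dz _ _ _ _ (has_wirtinger_ext _ _ _ _ _ _ HC E W)). unfold P.
rewrite RtoC_opp, Rinv_mult, RtoC_mult, RtoC_div, !RtoC_inv by lra. field.
intros E2. apply RtoC_inj in E2. lra.
Qed.

Let q := preschwarz h.
Let w := dilatation h g.

Lemma analytic_preschwarz : analytic_on_D q.
Proof. apply analytic_div; auto using analytic_cder. Qed.

Lemma analytic_dilatation : analytic_on_D w.
Proof. apply analytic_div; auto using analytic_cder. Qed.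

Let HE z : inD z -> H1 z = (q z * H z)%C.
Proof. intros Hz. unfold q, preschwarz, H1, H. field. auto. Qed.
Let GE z : inD z -> G z = (w z * H z)%C.
Proof. intros Hz. unfold w, dilatation, G, H. field. auto. Qed.

Lemma cder_mult_on_D (u v f : C -> C) z : analytic_on_D u -> analytic_on_D v ->
  (forall y, inD y -> f y = (u y * v y)%C) -> inD z ->
  cder f z = (cder u z * v z + u z * cder v z)%C.
Proof.
intros Hu Hv E Hz. apply is_C_derive_unique.
apply (is_derive_C_ext (fun y => u y * v y)%C f z _ (1 - Cmod z)).
- unfold inD in Hz; lra.
- intros y Hy. symmetry. apply E. eapply inD_nbhd, Hy.
- apply is_derive_Cmult; apply cder_spec; auto.
Qed.

Let HE2 z : inD z -> H2 z = ((cder q z + q z * q z) * H z)%C.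
Proof.
intros Hz. unfold H2. rewrite (cder_mult_on_D q H (cder (cder h)) z); auto using analytic_preschwarz.
change (cder H z) with (H1 z). rewrite HE by auto. ring.
Qed.

Let GE1 z : inD z -> G1 z = ((cder w z + w z * q z) * H z)%C.
Proof.
intros Hz. unfold G1. rewrite (cder_mult_on_D w H (cder g) z); auto using analytic_dilatation.
change (cder H z) with (H1 z). rewrite HE by auto. ring.
Qed.

Let GE2 z : inD z -> G2 z = ((cder (cder w) z + 2 * cder w z * q z + w z * (cder q z + q z * q z)) * H z)%C.
Proof.
intros Hz. unfold G2.
assert (Aw := analytic_dilatation). assert (Aq := analytic_preschwarz).
(* By the formula for g'', this is the factor with g'' = v h'; the product rule is applied once
   more. *)
set (v := fun y => (cder w y + w y * q y)%C).
assert (Av : forall z, inD z -> @is_derive C_AbsRing C_NormedModule v z (cder (cder w) z + (cder w z * q z + w z * cder q z))%C).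
{ intros y Hy. apply is_derive_C_iff. intros eps He.
  pose proof (proj1 (is_derive_C_iff _ _ _) (cder_spec _ _ (analytic_cder _ Aw) Hy) (eps / 2)) as [d1 [D1 D1']]; [lra|].
  pose proof (proj1 (is_derive_C_iff _ _ _) (is_derive_Cmult _ _ _ _ _ (cder_spec _ _ Aw Hy) (cder_spec _ _ Aq Hy)) (eps / 2)) as [d2 [D2 D2']]; [lra|].
  exists (Rmin d1 d2). split; [apply Rmin_pos; auto|]. intros s Hs.
  assert (S1 : Cmod (s - y)%C < d1) by (eapply Rlt_le_trans; [exact Hs|apply Rmin_l]).
  assert (S2 : Cmod (s - y)%C < d2) by (eapply Rlt_le_trans; [exact Hs|apply Rmin_r]).
  specialize (D1' s S1). specialize (D2' s S2). unfold v.
  replace (cder w s + w s * q s - (cder w y + w y * q y) - (s - y) * (cder (cder w) y + (cder w y * q y + w y * cder q y)))%C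
    with ((cder w s - cder w y - (s - y) * cder (cder w) y) + (w s * q s - w y * q y - (s - y) * (cder w y * q y + w y * cder q y)))%C by ring.
  eapply Rle_trans; [apply Cmod_triangle|]. lra. }
rewrite (cder_mult_on_D v H (cder (cder g)) z); auto.
- unfold cder at 1. rewrite (is_C_derive_unique _ _ _ (Av z Hz)).
  change (cder H z) with (H1 z). rewrite HE by auto. unfold v. ring.
- intros y Hy. eexists. apply Av; auto.
Qed.

Lemma jacobian_w z : inD z -> J z = Cmod (H z) ^ 2 * (1 - Cmod (w z) ^ 2).
Proof.
intros Hz. unfold J, jacobian. fold (G z). fold (H z). rewrite GE by auto. rewrite Cmod_mult. ring.
Qed.

(** After substituting g' = w h' and h'' = q h', both P and J contain |h'|^2, which cancels; the
    terms with q recombine to the factor 1 - |w|^2. *)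
Lemma Dz_logJ_w z : inD z -> Dz (logJ h g) z =
  (q z - RtoC (/ (1 - Cmod (w z) ^ 2)) * (Cconj (w z) * cder w z))%C.
Proof.
intros Hz. rewrite Dz_logJ, jacobian_w by auto. unfold P.
assert (Hw := Hw1 z Hz). fold (w z) in Hw. pose proof (Cmod_ge_0 (w z)) as Hwz0.
assert (H0 : H z <> 0) by (apply Hh0; auto).
assert (Hm : 0 < Cmod (H z)) by (apply Cmod_gt_0; auto).
assert (Hs : 1 - Cmod (w z) ^ 2 <> 0) by nra.
rewrite HE, GE1, GE, Cmult_conj by auto.
rewrite Rinv_mult, RtoC_mult.
rewrite (RtoC_inv (Cmod (H z) ^ 2)), (RtoC_inv (1 - _)) by (auto; nra).
assert (Hs' : RtoC (1 - Cmod (w z) ^ 2) <> 0) by (intros E; apply RtoC_inj in E; auto).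
rewrite RtoC_minus, !Cmod2_conj in *.
assert (Hc : Cconj (H z) <> 0) by (intros E; apply H0; rewrite <- (Cconj_conj (H z)), E; unfold Cconj, RtoC; simpl; f_equal; ring).
field. auto.
Qed.

(** The same cancellation: the part w (q' + q^2) of g''' / h' combines with h''' / h' to (1 - |w|^2)
    (q' + q^2). *)
Lemma schwarzian_w z : inD z -> schwarzian h g z =
  (cder q z + q z * q z - RtoC (/ (1 - Cmod (w z) ^ 2)) * (Cconj (w z) * (cder (cder w) z + 2 * cder w z * q z))
   - (3 / 2)%R * (Dz (logJ h g) z * Dz (logJ h g) z))%C.
Proof.
intros Hz. rewrite schwarzian_formula by auto. rewrite <- Dz_logJ by auto. f_equal.
rewrite jacobian_w by auto.
assert (Hw := Hw1 z Hz). fold (w z) in Hw. pose proof (Cmod_ge_0 (w z)) as Hwz0.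
assert (H0 : H z <> 0) by (apply Hh0; auto).
assert (Hm : 0 < Cmod (H z)) by (apply Cmod_gt_0; auto).
assert (Hs : 1 - Cmod (w z) ^ 2 <> 0) by nra.
rewrite HE2, GE2, GE, Cmult_conj by auto.
rewrite Rinv_mult, RtoC_mult.
rewrite (RtoC_inv (Cmod (H z) ^ 2)), (RtoC_inv (1 - _)) by (auto; nra).
assert (Hs' : RtoC (1 - Cmod (w z) ^ 2) <> 0) by (intros E; apply RtoC_inj in E; auto).
rewrite RtoC_minus, !Cmod2_conj in *.
assert (Hc : Cconj (H z) <> 0) by (intros E; apply H0; rewrite <- (Cconj_conj (H z)), E; unfold Cconj, RtoC; simpl; f_equal; ring).
field. auto.
Qed.

(** The first bound controls q by F_z; the second eliminates F_z again, so that only moduli of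
    analytic functions remain. The factor 1 / (1 - |w|^2) is at most 1 / (1 - c^2), and mixed
    products are split by 2 a b <= a^2 + b^2. *)
Lemma schwarzian_bounds c : c < 1 -> (forall z, inD z -> Cmod (w z) <= c) ->
  exists K, 0 <= K /\ forall z, inD z ->
    Cmod (q z) <= Cmod (Dz (logJ h g) z) + K * Cmod (cder w z) /\
    Cmod (schwarzian h g z) <= K * (Cmod (cder q z) + Cmod (cder (cder w) z) + Cmod (q z) ^ 2 + Cmod (cder w z) ^ 2).
Proof.
intros Hc Hwc.
assert (Hc0 : 0 <= c).
{ eapply Rle_trans; [apply Cmod_ge_0|apply (Hwc 0)]. unfold inD. rewrite Cmod_0. lra. }
assert (Hc2 : 0 < 1 - c ^ 2) by nra.
set (k := / (1 - c ^ 2)). assert (Hk : 0 < k) by (apply Rinv_0_lt_compat; auto).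
(* The coefficients that arise are at most 1 for |q'|, k for |w''|, 4 + k for |q|^2 and k + 3 k^2
   for |w'|^2; the first inequality needs k. *)
exists (4 + 4 * k + 3 * k ^ 2). split; [nra|]. intros z Hz.
assert (Hwz := Hwc z Hz). pose proof (Cmod_ge_0 (w z)) as Hw0.
set (s := / (1 - Cmod (w z) ^ 2)).
assert (Hs : 0 < s <= k).
{ split; [apply Rinv_0_lt_compat; nra|]. apply Rinv_le_contravar; nra. }
set (F := Dz (logJ h g) z).
assert (E : F = (q z - RtoC s * (Cconj (w z) * cder w z))%C) by (apply Dz_logJ_w; auto).
assert (T : forall y, Cmod (RtoC s * (Cconj (w z) * y))%C <= k * Cmod y).
{ intros y. rewrite !Cmod_mult, Cmod_R, Cmod_conj, Rabs_right by lra.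
  pose proof (Cmod_ge_0 y). apply Rmult_le_compat; try lra; nra. }
pose proof (Cmod_ge_0 (q z)) as Q0. pose proof (Cmod_ge_0 (cder q z)) as Q1.
pose proof (Cmod_ge_0 (cder w z)) as W1. pose proof (Cmod_ge_0 (cder (cder w) z)) as W2.
split.
- replace (q z) with (F + RtoC s * (Cconj (w z) * cder w z))%C by (rewrite E; ring).
  eapply Rle_trans; [apply Cmod_triangle|]. specialize (T (cder w z)). nra.
- assert (HF : Cmod F <= Cmod (q z) + k * Cmod (cder w z)).
  { rewrite E. unfold Cminus. eapply Rle_trans; [apply Cmod_triangle|]. rewrite Cmod_opp. specialize (T (cder w z)). lra. }
  assert (HF2 : Cmod F ^ 2 <= 2 * Cmod (q z) ^ 2 + 2 * k ^ 2 * Cmod (cder w z) ^ 2).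
  { apply Rle_trans with ((Cmod (q z) + k * Cmod (cder w z)) ^ 2).
    - apply pow_incr. split; [apply Cmod_ge_0|auto].
    - pose proof (pow2_ge_0 (Cmod (q z) - k * Cmod (cder w z))). nra. }
  rewrite schwarzian_w by auto. fold F. fold s.
  set (V := (cder (cder w) z + 2 * cder w z * q z)%C).
  assert (HV : Cmod V <= Cmod (cder (cder w) z) + Cmod (cder w z) ^ 2 + Cmod (q z) ^ 2).
  { eapply Rle_trans; [apply Cmod_triangle|]. rewrite !Cmod_mult, Cmod_R, Rabs_right by lra.
    pose proof (pow2_ge_0 (Cmod (cder w z) - Cmod (q z))). nra. }
  specialize (T V). unfold Cminus.
  eapply Rle_trans; [apply Cmod_triangle|].
  eapply Rle_trans; [apply Rplus_le_compat_r, Cmod_triangle|].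
  eapply Rle_trans; [apply Rplus_le_compat_r, Rplus_le_compat_r, Cmod_triangle|].
  rewrite !Cmod_opp, !Cmod_mult, !Cmod_R, (Rabs_right (3 / 2)), (Rabs_right s) by lra.
  rewrite !Cmod_mult, Cmod_R, (Rabs_right s) in T by lra.
  pose proof (pow2_ge_0 (Cmod (q z))) as A1. pose proof (pow2_ge_0 (Cmod (cder w z))) as A2.
  apply Rle_trans with (Cmod (cder q z) + Cmod (q z) ^ 2
    + k * (Cmod (cder (cder w) z) + Cmod (cder w z) ^ 2 + Cmod (q z) ^ 2)
    + 3 / 2 * (2 * Cmod (q z) ^ 2 + 2 * k ^ 2 * Cmod (cder w z) ^ 2)).
  + repeat apply Rplus_le_compat; try lra.
    * rewrite <- Rmult_assoc in T. eapply Rle_trans; [rewrite <- Rmult_assoc; exact T|]. apply Rmult_le_compat_l; lra.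
  + nra.
Qed.

End Formulas.

(** * Restrictions of analytic functions to segments in the disk *)

Lemma analytic_side_bounds u x y r a b c d : analytic_on_D u -> 0 < r -> 2 * r < 1 - Cmod (x, y) ->
  x - r <= a <= x - r / 2 -> x + r / 2 <= b <= x + r ->
  y - r <= c <= y - r / 2 -> y + r / 2 <= d <= y + r ->
  let S := hside u c (x - r) (x + r) + hside u d (x - r) (x + r)
       + vside u a (y - r) (y + r) + vside u b (y - r) (y + r) in
  r * Cmod (u (x, y)) <= S /\ r ^ 2 * Cmod (cder u (x, y)) <= S.
Proof.
intros Hu Hr Hr2 Ha Hb Hc Hd S.
assert (Hrect : forall z, on_rect (x - r) (x + r) (y - r) (y + r) z -> Cdiff u z).
{ intros w Hw. apply Hu, (inD_square (x, y) w r); auto. }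
split; [apply (value_le_sides u x y r Hr Hrect a b c d)|apply (derive_le_sides u x y r Hr Hrect a b c d)]; auto.
Qed.

Lemma analytic_Cmod_cont u z : analytic_on_D u -> inD z -> forall e, 0 < e -> exists d, 0 < d /\
  forall w : C, Rabs (fst w - fst z) < d -> Rabs (snd w - snd z) < d -> Rabs (Cmod (u w) - Cmod (u z)) < e.
Proof.
intros Hu Hz e He.
destruct (proj1 (Ccont_iff u z) (Cdiff_Ccont _ _ (Hu z Hz)) e He) as [d [Hd Hd']].
exists (d / 2). split; [lra|]. intros [w1 w2] H1 H2. destruct z as [z1 z2]; simpl in H1, H2.
assert (T : Cmod (u (w1, w2) - u (z1, z2))%C < e).
{ apply Hd'. eapply Rle_lt_trans; [apply Cmod_le_sum|]. simpl. unfold Rminus in *. lra. }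
assert (T1 := Cmod_triangle (u (w1, w2) - u (z1, z2))%C (u (z1, z2))).
assert (T2 := Cmod_triangle (u (z1, z2) - u (w1, w2))%C (u (w1, w2))).
replace (u (w1, w2) - u (z1, z2) + u (z1, z2))%C with (u (w1, w2)) in T1 by ring.
replace (u (z1, z2) - u (w1, w2) + u (w1, w2))%C with (u (z1, z2)) in T2 by ring.
replace (u (z1, z2) - u (w1, w2))%C with (- (u (w1, w2) - u (z1, z2)))%C in T2 by ring. rewrite Cmod_opp in T2.
apply Rabs_def1; lra.
Qed.

(** Continuity on a margin of width [e] makes the derivative two-sided at the end points too. *)
Lemma RInt_primitive (phi : R -> R) a b e : 0 < e -> a <= b ->
  (forall t, a - e < t < b + e -> continuity_pt phi t) ->
  forall t, a <= t <= b -> derivable_pt_lim (fun s => RInt phi a s) t (phi t).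
Proof.
intros He Hab Hc t Ht. apply is_derive_Reals.
assert (Hc' : forall t, a - e < t < b + e -> continuous phi t).
{ intros s Hs. apply continuity_pt_filterlim, Hc, Hs. }
apply (is_derive_RInt phi (fun s => RInt phi a s) a t).
- exists (mkposreal e He). intros s Hs.
  assert (Hs' : Rabs (s - t) < e) by exact Hs. apply Rabs_def2 in Hs'.
  apply (RInt_correct (V := R_CompleteNormedModule)).
  apply (ex_RInt_continuous (V := R_CompleteNormedModule)).
  intros v Hv. apply Hc'. unfold Rmin, Rmax in Hv. destruct Rle_dec; lra.
- apply Hc'; lra.
Qed.

Lemma vside_cont u X t : analytic_on_D u -> inD (X, t) -> continuity_pt (fun t => Cmod (u (X, t))) t.
Proof.
intros Hu Hz. apply continuity_pt_filterlim. apply (Ccont_Cmod_vline u X t), Cdiff_Ccont, Hu, Hz.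
Qed.
Lemma hside_cont u Y t : analytic_on_D u -> inD (t, Y) -> continuity_pt (fun t => Cmod (u (t, Y))) t.
Proof.
intros Hu Hz. apply continuity_pt_filterlim. apply (Ccont_Cmod_hline u t Y), Cdiff_Ccont, Hu, Hz.
Qed.

Lemma Cmod_lipschitz (w z : C) : Rabs (Cmod w - Cmod z) <= Rabs (fst w - fst z) + Rabs (snd w - snd z).
Proof.
assert (T1 := Cmod_triangle (w - z)%C z).
assert (T2 := Cmod_triangle (z - w)%C w).
replace (w - z + z)%C with w in T1 by ring.
replace (z - w + w)%C with z in T2 by ring.
replace (z - w)%C with (- (w - z))%C in T2 by ring. rewrite Cmod_opp in T2.
assert (T3 : Cmod (w - z)%C <= Rabs (fst w - fst z) + Rabs (snd w - snd z)).
{ destruct w, z. apply Cmod_le_sum. }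
apply Rabs_le. lra.
Qed.

End ComplexAnalysis.

Module BesovEstimates.
Import structures all_boot all_order all_algebra all_classical all_reals all_analysis.
Import Rstruct Rstruct_topology measurable_realfun lra ring.
Set Implicit Arguments. Unset Strict Implicit. Unset Printing Implicit Defensive.
Import Order.TTheory GRing.Theory Num.Theory numFieldNormedType.Exports.
Local Open Scope classical_set_scope.
Local Open Scope ring_scope.

Local Open Scope ereal_scope.

(** * Comparison of integrals, and measurability in the plane *)

(** The integral of a nonnegative function is a supremum over the simple functions below it, and
    enlarging the function enlarges this family. *)
Lemma ge0_le_integral_nonmeasurable d (T : measurableType d) (R : realType) (mu : {measure set T -> \bar R})
  (D : set T) (f g : T -> \bar R) :
  (forall x, D x -> 0 <= f x) -> (forall x, D x -> f x <= g x) ->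
  \int[mu]_(x in D) f x <= \int[mu]_(x in D) g x.
Proof.
move=> f0 fg.
rewrite !ge0_integralE//; last by move=> x Dx; exact: le_trans (f0 _ Dx) (fg _ Dx).
apply: ereal_sup_le => _ [h hf <-]; exists h => // x.
apply: le_trans (hf x) _; rewrite /patch; case: ifPn => // xD.
by apply: fg; rewrite inE in xD.
Qed.

Section Generic.
Variable R : realType.

(** Openness by boxes written out in coordinates: this form is easy to transfer from [Stdlib] reals
    and fits the covering by rational boxes. *)
Definition open2 (U : set (R * R)) := forall z, U z -> exists2 e : R, (0 < e)%R &
  forall w : R * R, (`|w.1 - z.1| < e)%R -> (`|w.2 - z.2| < e)%R -> U w.

Lemma open2_measurable (U : set (R * R)) : open2 U -> measurable U.
Proof.
move=> oU.
pose S (a b c : rat) : set (R * R) :=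
  (ball (ratr a : R) (ratr c : R)) `*` (ball (ratr b : R) (ratr c : R)).
pose S' a b c := if `[< S a b c `<=` U >] then S a b c else set0.
have -> : U = \bigcup_a \bigcup_b \bigcup_c S' a b c.
  apply/seteqP; split => [[x y] Uz|z [a _ [b _ [c _]]]]; last first.
    by rewrite /S'; case: asboolP => // h; exact: h.
  have [e e0 eU] := oU _ Uz.
  (* The rational half side lies between e/4 and e/2 and the rational centre within e/4 in each
     coordinate: the box contains the point and stays within 3e/4 of it. *)
  have e4 : (0 < e / 4)%R by rewrite divr_gt0.
  have [c] := @rat_in_itvoo R (e / 4)%R (e / 2)%R ltac:(lra).
  rewrite in_itv /= => /andP[c1 c2].
  have [a] := @rat_in_itvoo R (x - e / 4)%R (x + e / 4)%R ltac:(lra).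
  rewrite in_itv /= => /andP[a1 a2].
  have [b] := @rat_in_itvoo R (y - e / 4)%R (y + e / 4)%R ltac:(lra).
  rewrite in_itv /= => /andP[b1 b2].
  exists a => //; exists b => //; exists c => //.
  rewrite /S'; case: asboolP => [_|]; last first.
    case=> -[u v] []; rewrite /ball /= !ltr_distl => /andP[u1 u2] /andP[v1 v2].
    by apply: eU => /=; rewrite ltr_distl; apply/andP; split; lra.
  by split => /=; rewrite /ball /= ltr_distl; apply/andP; split; lra.
apply: bigcupT_measurable_rat => a; apply: bigcupT_measurable_rat => b.
apply: bigcupT_measurable_rat => c; rewrite /S'; case: asboolP => _ //.
by apply: measurableX; exact: measurable_realfun.measurable_ball.
Qed.

Definition cont2 (f : R * R -> R) (z : R * R) := forall e : R, (0 < e)%R -> exists2 d : R, (0 < d)%R &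
  forall w : R * R, (`|w.1 - z.1| < d)%R -> (`|w.2 - z.2| < d)%R -> (`|f w - f z| < e)%R.

Lemma cont2_measurable (U : set (R * R)) (f : R * R -> R) :
  open2 U -> (forall z, U z -> cont2 f z) -> measurable_fun U f.
Proof.
move=> oU cf; apply: (measurability _ (measurable_realfun.RGenOInfty.measurableE R)).
move=> _ [_ [a ->] <-]; apply: open2_measurable => z [Uz] /=.
rewrite in_itv /= andbT => az.
have [e e0 eU] := oU z Uz.
have [d d0 dU] := cf z Uz (f z - a)%R ltac:(lra).
exists (Num.min e d); first by rewrite lt_min e0 d0.
move=> w; rewrite !lt_min => /andP[w1 w2] /andP[w3 w4]; split; first exact: eU.
have := dU w w2 w4; rewrite /= in_itv /= andbT ltr_distl => /andP[? ?]; lra.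
Qed.

End Generic.

Local Close Scope ereal_scope.

(** * Riemann integrals as Lebesgue integrals *)

Notation Rr := (Rdefinitions.R : realType).

Lemma derivable_pt_lim_cvg (F : Rr^o -> Rr^o) (x l : Rr^o) : derivable_pt_lim F x l ->
  (h : Rr)^-1 *: (F (h *: (1 : Rr^o) + x) - F x) @[h --> (0 : Rr)^'] --> l.
Proof.
move=> H; apply/cvgrPdist_lt => e e0.
have [[d d0] Hd] := H e (elimT RltP e0).
exists d => /=; first exact/RltP.
move=> h /=; rewrite sub0r normrN => hd h0.
have /RltP := Hd h (elimN eqP h0) (elimT RltP hd).
rewrite !RealsE distrC /GRing.scale /= mulr1 (addrC x h) => hh.
by rewrite mulrC.
Qed.

Lemma derivable_pt_lim_is_derive (F : Rr^o -> Rr^o) (x l : Rr^o) : derivable_pt_lim F x l ->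
  is_derive x (1 : Rr^o) F l.
Proof.
move=> /derivable_pt_lim_cvg H; split; first by apply/cvg_ex; exists l.
exact/cvg_lim.
Qed.

(** With [RInt_primitive] this identifies the two integrals along a segment: both are the increment
    of the same primitive. *)
Lemma integral_primitive (phi F : R -> R) (a b e : R) : a < b -> 0 < e ->
  (forall t, a - e < t -> t < b + e -> continuity_pt phi t) ->
  (forall t, a <= t -> t <= b -> derivable_pt_lim F t (phi t)) ->
  (\int[@lebesgue_measure Rr]_(x in `[a, b]) (phi x)%:E = (F b - F a)%:E)%E.
Proof.
move=> ab e0 cphi dF.
have dF' t : a <= t -> t <= b -> is_derive (t : Rr^o) (1 : Rr^o) (F : Rr^o -> Rr^o) (phi t : Rr^o).
  by move=> ? ?; apply: derivable_pt_lim_is_derive; exact: dF.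
have cF t : a <= t -> t <= b -> {for t, continuous F}.
  move=> ta tb; have := dF' _ ta tb => -[F't _].
  by have /derivable1_diffP/differentiable_continuous := F't.
rewrite (@continuous_FTC2 Rr phi F) //.
- apply: continuous_in_subspaceT => t /[!inE] /=; rewrite in_itv /= => /andP[ta tb].
  by apply/continuity_pt_cvg/cphi; lra.
- split.
  + move=> t; rewrite in_itv /= => /andP[ta tb].
    by have [] := dF' t (ltW ta) (ltW tb).
  + by apply: cvg_at_right_filter; apply: cF; lra.
  + by apply: cvg_at_left_filter; apply: cF; lra.
- move=> t; rewrite in_itv /= => /andP[ta tb].
  have [_ <-] := dF' t (ltW ta) (ltW tb).
  by rewrite derive1E.
Qed.

(** * Mean value estimates over squares *)

Local Open Scope ereal_scope.

Section Mean.
Variable R : realType.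
Notation mu := (@lebesgue_measure R).
Notation mu2 := (mu \x mu).

(** Tonelli's theorem, keeping only the strip a <= X <= b of the outer integral. *)
Lemma slab1 (Psi : R * R -> \bar R) (a b c : R) : measurable_fun setT Psi -> (forall z, 0 <= Psi z) ->
  (a <= b)%R -> (0 <= c)%R -> (forall X, (a <= X <= b)%R -> c%:E <= \int[mu]_y Psi (X, y)) ->
  ((b - a) * c)%:E <= \int[mu2]_z Psi z.
Proof.
move=> mPsi Psi0 ab c0 H; rewrite (@fubini_tonelli1 _ _ _ _ R mu mu Psi mPsi Psi0).
have mF := measurable_fun_fubini_tonelli_F (m2 := mu) Psi mPsi Psi0.
have F0 x : 0 <= fubini_F mu Psi x by exact: integral_ge0.
apply: (@le_trans _ _ (\int[mu]_(x in `[a, b]) fubini_F mu Psi x)); last first.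
  by apply: ge0_subset_integral => //; exact: measurable_itv.
apply: (@le_trans _ _ (\int[mu]_(x in `[a, b]) c%:E)).
  rewrite integral_cst //= lebesgue_measure_itv /= lte_fin.
  case: ltP => [_|]; first by rewrite -EFinD -EFinM lee_fin mulrC.
  by move=> ba; rewrite mule0 lee_fin mulr_le0_ge0 // subr_le0.
by apply: ge0_le_integral_nonmeasurable => [x _|x /=]; [rewrite lee_fin|rewrite in_itv /=; exact: H].
Qed.

Lemma slab2 (Psi : R * R -> \bar R) (a b c : R) : measurable_fun setT Psi -> (forall z, 0 <= Psi z) ->
  (a <= b)%R -> (0 <= c)%R -> (forall Y, (a <= Y <= b)%R -> c%:E <= \int[mu]_x Psi (x, Y)) ->
  ((b - a) * c)%:E <= \int[mu2]_z Psi z.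
Proof.
move=> mPsi Psi0 ab c0 H; rewrite (@fubini_tonelli2 _ _ _ _ R mu mu Psi mPsi Psi0).
have mF := measurable_fun_fubini_tonelli_G (m1 := mu) Psi mPsi Psi0.
have F0 x : 0 <= fubini_G mu Psi x by exact: integral_ge0.
apply: (@le_trans _ _ (\int[mu]_(x in `[a, b]) fubini_G mu Psi x)); last first.
  by apply: ge0_subset_integral => //; exact: measurable_itv.
apply: (@le_trans _ _ (\int[mu]_(x in `[a, b]) c%:E)).
  rewrite integral_cst //= lebesgue_measure_itv /= lte_fin.
  case: ltP => [_|]; first by rewrite -EFinD -EFinM lee_fin mulrC.
  by move=> ba; rewrite mule0 lee_fin mulr_le0_ge0 // subr_le0.
by apply: ge0_le_integral_nonmeasurable => [x _|x /=]; [rewrite lee_fin|rewrite in_itv /=; exact: H].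
Qed.

(* Replaces Jensen's inequality when passing from the mean of [v] to that of [v `^ p]. *)
Lemma young_powR (v l p : R) : (0 <= v)%R -> (0 <= l)%R -> (1 < p)%R ->
  (l `^ (p - 1) * v <= l `^ p + v `^ p)%R.
Proof.
move=> v0 l0 p1; have p0 : (0 < p)%R by lra.
have [vl|lv] := leP v l.
  rewrite -(mulr_powRB1 l0 p0) mulrC; apply: ler_wpDr; first exact: powR_ge0.
  by rewrite ler_wpM2r // powR_ge0.
rewrite -(mulr_powRB1 v0 p0) [(v * _)%R]mulrC; apply: ler_wpDl; first exact: powR_ge0.
by rewrite ler_wpM2r // ge0_ler_powR ?nnegrE //; lra.
Qed.

(** Integrating [young_powR] gives 2 (b - a) l^p <= (b - a) l^p + int v^p. The factor 2 in the
    hypothesis pays for the first summand on the right. *)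
Lemma young_integral (v : R -> R) (a b l p : R) : (a < b)%R -> (0 <= l)%R -> (1 < p)%R ->
  measurable_fun `[a, b] v -> (forall t, 0 <= v t)%R ->
  (2 * (b - a) * l)%:E <= \int[mu]_(t in `[a, b]) (v t)%:E ->
  ((b - a) * l `^ p)%:E <= \int[mu]_(t in `[a, b]) (v t `^ p)%:E.
Proof.
move=> ab l0 p1 mv v0 H; have p0 : (0 < p)%R by lra.
have mI : measurable (`[a, b]%classic : set R) by exact: measurable_itv.
have mvp : measurable_fun `[a, b] (EFin \o (fun t => v t `^ p)%R).
  by apply/measurable_EFinP; apply: (measurableT_comp (measurable_powR _)).
have H1 : (l `^ (p - 1))%:E * (2 * (b - a) * l)%:E <=
    ((b - a) * l `^ p)%:E + \int[mu]_(t in `[a, b]) (v t `^ p)%:E.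
  apply: (@le_trans _ _ ((l `^ (p - 1))%:E * \int[mu]_(t in `[a, b]) (v t)%:E)).
    by rewrite lee_wpmul2l // lee_fin powR_ge0.
  rewrite -ge0_integralZl_EFin ?powR_ge0 //; last 2 first.
    by move=> t _; rewrite lee_fin.
    exact/measurable_EFinP.
  apply: (@le_trans _ _ (\int[mu]_(t in `[a, b]) ((l `^ p)%:E + (v t `^ p)%:E))).
    apply: ge0_le_integral_nonmeasurable => t _; first by rewrite -EFinM lee_fin mulr_ge0 ?powR_ge0.
    by rewrite -EFinM -EFinD lee_fin young_powR.
  rewrite ge0_integralD //; last 2 first.
    by move=> t _; rewrite lee_fin powR_ge0.
    by move=> t _; rewrite lee_fin powR_ge0.
  rewrite leeD2r // integral_cst //= lebesgue_measure_itv /= lte_fin ab.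
  by rewrite -EFinD -EFinM mulrC.
move: H1; rewrite -EFinM.
have -> : (l `^ (p - 1) * (2 * (b - a) * l) = (b - a) * l `^ p + (b - a) * l `^ p)%R.
  by rewrite -(mulr_powRB1 l0 p0); ring.
by rewrite EFinD leeD2lE.
Qed.

Definition rect (x y r : R) : set (R * R) := `[(x - r)%R, (x + r)%R] `*` `[(y - r)%R, (y + r)%R].

Lemma measurable_rect x y r : measurable (rect x y r).
Proof. by apply: measurableX; exact: measurable_itv. Qed.

Lemma patch_rect1 (g : R * R -> \bar R) x y r X : (x - r <= X <= x + r)%R ->
  \int[mu]_t (g \_ (rect x y r)) (X, t) = \int[mu]_(t in `[(y - r)%R, (y + r)%R]) g (X, t).
Proof.
move=> hX; rewrite [RHS]integral_mkcond; apply: eq_integral => t _.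
rewrite /patch; congr (if _ then _ else _).
apply/idP/idP; rewrite !inE; first by case.
by move=> ht; split => //=; rewrite in_itv.
Qed.

Lemma patch_rect2 (g : R * R -> \bar R) x y r Y : (y - r <= Y <= y + r)%R ->
  \int[mu]_t (g \_ (rect x y r)) (t, Y) = \int[mu]_(t in `[(x - r)%R, (x + r)%R]) g (t, Y).
Proof.
move=> hX; rewrite [RHS]integral_mkcond; apply: eq_integral => t _.
rewrite /patch; congr (if _ then _ else _).
apply/idP/idP; rewrite !inE; first by case.
by move=> ht; split => //=; rewrite in_itv.
Qed.

(* If one of the four sides can always contribute at least [T / 4], integrate over its
   positions; otherwise four bad positions contradict the hypothesis. *)
Lemma local_mean (v : R * R -> R) (x y r T p : R) :
  (0 < r)%R -> (1 < p)%R -> (0 <= T)%R ->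
  measurable_fun (rect x y r) v -> (forall z, 0 <= v z)%R ->
  (forall X1 X2 Y1 Y2 : R, (x - r <= X1 <= x - r / 2)%R -> (x + r / 2 <= X2 <= x + r)%R ->
     (y - r <= Y1 <= y - r / 2)%R -> (y + r / 2 <= Y2 <= y + r)%R ->
     T%:E <= \int[mu]_(t in `[(x - r)%R, (x + r)%R]) (v (t, Y1))%:E
          + \int[mu]_(t in `[(x - r)%R, (x + r)%R]) (v (t, Y2))%:E
          + \int[mu]_(t in `[(y - r)%R, (y + r)%R]) (v (X1, t))%:E
          + \int[mu]_(t in `[(y - r)%R, (y + r)%R]) (v (X2, t))%:E) ->
  ((T / (16 * r)) `^ p * r ^+ 2)%:E <= \int[mu2]_(z in rect x y r) (v z `^ p)%:E.
Proof.
move=> r0 p1 T0 mv v0 H; have p0 : (0 < p)%R by lra.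
(* Chosen so that a side of length 2 r whose integral is at least T / 4 satisfies the hypothesis of
   [young_integral] with this level. *)
set l := (T / (16 * r))%R; have l0 : (0 <= l)%R by rewrite divr_ge0 //; lra.
have Tl : (T / 4 = 2 * ((2 * r)) * l)%R by rewrite /l; field; lra.
rewrite integral_mkcond.
set Psi := _ \_ _.
have mQ := measurable_rect x y r.
have mPsi : measurable_fun setT Psi.
  apply/(measurable_restrictT _ _).1 => //; apply/measurable_EFinP.
  exact: (measurableT_comp (measurable_powR _)).
have Psi0 z : 0 <= Psi z by apply: erestrict_ge0 => ? _; rewrite lee_fin powR_ge0.
have mvs : measurable_fun setT (v \_ (rect x y r)) by apply/(measurable_restrictT _ _).1.
have mvX X : (x - r <= X <= x + r)%R -> measurable_fun `[(y - r)%R, (y + r)%R] (fun t => v (X, t)).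
  move=> hX; apply: (@eq_measurable_fun _ _ _ _ _ (fun t => (v \_ (rect x y r)) (X, t))).
    move=> t; rewrite inE /= => ht.
    have hm : (X, t) \in rect x y r by rewrite inE; split => //=; rewrite in_itv.
    by rewrite /patch hm.
  by apply: measurable_funTS; exact: (measurableT_comp mvs (measurable_pair1 _)).
have mvY Y : (y - r <= Y <= y + r)%R -> measurable_fun `[(x - r)%R, (x + r)%R] (fun t => v (t, Y)).
  move=> hX; apply: (@eq_measurable_fun _ _ _ _ _ (fun t => (v \_ (rect x y r)) (t, Y))).
    move=> t; rewrite inE /= => ht.
    have hm : (t, Y) \in rect x y r by rewrite inE; split => //=; rewrite in_itv.
    by rewrite /patch hm.
  by apply: measurable_funTS; exact: (measurableT_comp mvs (measurable_pair2 _)).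
have sX a : (x - r <= a)%R -> (a + r / 2 <= x + r)%R ->
   (forall X, (a <= X <= a + r / 2)%R -> (T / 4)%:E <= \int[mu]_(t in `[(y - r)%R, (y + r)%R]) (v (X, t))%:E) ->
   (l `^ p * r ^+ 2)%:E <= \int[mu2]_z Psi z.
  move=> a1 a2 hA.
  (* The positions fill an interval of length r / 2, and each contributes 2 r l^p. *)
  have -> : (l `^ p * r ^+ 2 = ((a + r / 2) - a) * (2 * r * l `^ p))%R by field.
  apply: slab1 => //; [lra|by rewrite mulr_ge0 ?powR_ge0 //; lra|move=> X hX].
  have hX' : (x - r <= X <= x + r)%R by move: hX => /andP[? ?]; apply/andP; split; lra.
  rewrite patch_rect1 //.
  have -> : (2 * r = (y + r) - (y - r))%R by ring.
  apply: young_integral => //; [lra|exact: mvX|].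
  by have := hA X hX; rewrite Tl; congr (_ <= _); congr EFin; ring.
have sY a : (y - r <= a)%R -> (a + r / 2 <= y + r)%R ->
   (forall X, (a <= X <= a + r / 2)%R -> (T / 4)%:E <= \int[mu]_(t in `[(x - r)%R, (x + r)%R]) (v (t, X))%:E) ->
   (l `^ p * r ^+ 2)%:E <= \int[mu2]_z Psi z.
  move=> a1 a2 hA.
  have -> : (l `^ p * r ^+ 2 = ((a + r / 2) - a) * (2 * r * l `^ p))%R by field.
  apply: slab2 => //; [lra|by rewrite mulr_ge0 ?powR_ge0 //; lra|move=> X hX].
  have hX' : (y - r <= X <= y + r)%R by move: hX => /andP[? ?]; apply/andP; split; lra.
  rewrite patch_rect2 //.
  have -> : (2 * r = (x + r) - (x - r))%R by ring.
  apply: young_integral => //; [lra|exact: mvY|].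
  by have := hA X hX; rewrite Tl; congr (_ <= _); congr EFin; ring.
(* If the conclusion fails, each of the four position intervals contains a side with integral below
   T / 4. *)
apply: contrapT => nH.
have nX a : (x - r <= a)%R -> (a + r / 2 <= x + r)%R -> exists2 X, (a <= X <= a + r / 2)%R &
    \int[mu]_(t in `[(y - r)%R, (y + r)%R]) (v (X, t))%:E < (T / 4)%:E.
  move=> a1 a2; apply: contrapT => nE; apply: nH; apply: (sX a) => // X hX.
  by rewrite leNgt; apply/negP => hlt; apply: nE; exists X.
have nY a : (y - r <= a)%R -> (a + r / 2 <= y + r)%R -> exists2 X, (a <= X <= a + r / 2)%R &
    \int[mu]_(t in `[(x - r)%R, (x + r)%R]) (v (t, X))%:E < (T / 4)%:E.
  move=> a1 a2; apply: contrapT => nE; apply: nH; apply: (sY a) => // X hX.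
  by rewrite leNgt; apply/negP => hlt; apply: nE; exists X.
have [X1 /andP[a1 a2] h1] := nX (x - r)%R ltac:(lra) ltac:(lra).
have [X2 /andP[b1 b2] h2] := nX (x + r / 2)%R ltac:(lra) ltac:(lra).
have [Y1 /andP[c1 c2] h3] := nY (y - r)%R ltac:(lra) ltac:(lra).
have [Y2 /andP[d1 d2] h4] := nY (y + r / 2)%R ltac:(lra) ltac:(lra).
have := H X1 X2 Y1 Y2 ltac:(lra) ltac:(lra) ltac:(lra) ltac:(lra).
apply/negP; rewrite -ltNge.
have -> : T%:E = (T / 4)%:E + (T / 4)%:E + (T / 4)%:E + (T / 4)%:E.
  by rewrite -!EFinD; congr EFin; field.
by rewrite !lteD.
Qed.

End Mean.

Local Close Scope ereal_scope.

Notation Cmod := Coquelicot.Complex.Cmod.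
Notation C := Coquelicot.Complex.C.
Notation leb := (@lebesgue_measure Rr).

(** * Measurability of the disk and of moduli of analytic functions *)

Lemma cont2_Stdlib (f : Rr * Rr -> Rr) (z : Rr * Rr) :
  (forall e : R, Rlt 0%coqR e -> exists d : R, Rlt 0%coqR d /\
     forall w : C, Rlt (Rabs (Rminus w.1 z.1)) d -> Rlt (Rabs (Rminus w.2 z.2)) d ->
       Rlt (Rabs (Rminus (f w) (f z))) e) -> cont2 f z.
Proof.
move=> H e /RltP e0; have [d [/RltP d0 Hd]] := H e e0.
exists d => // w w1 w2; apply/RltP; rewrite -RabsE.
by apply: Hd; apply/RltP; rewrite RabsE.
Qed.

Lemma cont2_Cmod (z : Rr * Rr) : cont2 (R := Rr) Cmod z.
Proof.
apply: cont2_Stdlib => e e0; exists (Rdiv e 2%coqR); split.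
  by apply: Rdiv_lt_0_compat => //; exact: Rlt_0_2.
move=> w w1 w2; apply: Rle_lt_trans (ComplexAnalysis.Cmod_lipschitz w z) _.
rewrite [X in Rlt _ X]double_var; exact: Rplus_lt_compat.
Qed.

Lemma open2_disk : open2 (R := Rr) diskset.
Proof.
move=> z; rewrite /diskset /= /inD => /RltP hz.
have [d d0 H] := @cont2_Cmod z (1 - Cmod z) ltac:(rewrite subr_gt0; exact: hz).
exists d => // w w1 w2; have := H w w1 w2; rewrite ltr_distl => /andP[_].
by rewrite [(_ + (_ - _))%R]addrC subrK => h; exact/RltP.
Qed.

Lemma measurable_disk : measurable (diskset : set (Rr * Rr)).
Proof. by apply: (@open2_measurable Rr); exact: open2_disk. Qed.

Lemma measurable_Cmod : measurable_fun [set: Rr * Rr] (Cmod : Rr * Rr -> Rr).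
Proof.
have oT : open2 [set: Rr * Rr] by move=> z _; exists 1; rewrite ?ltr01.
by apply: (cont2_measurable oT) => z _; exact: cont2_Cmod.
Qed.

Lemma measurable_analytic (u : C -> C) : analytic_on_D u ->
  measurable_fun (diskset : set (Rr * Rr)) (fun z => Cmod (u z) : Rr).
Proof.
move=> Hu; apply: cont2_measurable; first exact: open2_disk.
move=> z Dz; apply: cont2_Stdlib => e e0; exact: ComplexAnalysis.analytic_Cmod_cont.
Qed.

Lemma Cmod_ge0 (z : C) : 0 <= (Cmod z : Rr).
Proof. apply/RleP; exact: Coquelicot.Complex.Cmod_ge_0. Qed.

Lemma rect_disk (x y r : Rr) (w : C) : 2 * r < 1 - Cmod (x, y) -> 
  x - r <= w.1 <= x + r -> y - r <= w.2 <= y + r -> inD w.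
Proof.
move=> hr /andP[/RleP h1 /RleP h2] /andP[/RleP h3 /RleP h4].
apply: (ComplexAnalysis.inD_square (x, y) w r); last by split; split.
by apply/RltP.
Qed.

Lemma itv_widen (K : realFieldType) (x r e X : K) : 0 < e -> x - r <= X -> X <= x + r ->
  x - (r + e) <= X <= x + (r + e).
Proof. by move=> *; apply/andP; split; lra. Qed.

Lemma itv_widen_lt (K : realFieldType) (x r e X : K) : x - r - e < X -> X < x + r + e ->
  x - (r + e) <= X <= x + (r + e).
Proof. by move=> *; apply/andP; split; lra. Qed.

Lemma itv_lt (K : realFieldType) (x r : K) : 0 < r -> x - r < x + r.
Proof. by move=> *; lra. Qed.

Lemma itv_left (K : realFieldType) (x r X : K) : 0 < r -> x - r <= X <= x - r / 2 -> x - r <= X <= x + r.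
Proof. by move=> ? /andP[? ?]; apply/andP; split; lra. Qed.

Lemma itv_right (K : realFieldType) (x r X : K) : 0 < r -> x + r / 2 <= X <= x + r -> x - r <= X <= x + r.
Proof. by move=> ? /andP[? ?]; apply/andP; split; lra. Qed.

(** * Mean value estimates for analytic functions on squares in the disk *)

Section Side.
Variables (u : C -> C) (x y r : Rr).
Hypothesis Hu : analytic_on_D u.
Hypothesis r0 : 0 < r.
Hypothesis hr : 2 * r < 1 - Cmod (x, y).

(** The margin required by the fundamental theorem of calculus: enlarging the half side by [e] uses
    half of the slack, and the larger square still lies in the disk. *)
Let e : Rr := (1 - Cmod (x, y) - 2 * r) / 4.
Let e0 : 0 < e. Proof. by rewrite /e; move: hr; set c := Cmod _ => h; lra. Qed.

Let hr' : 2 * (r + e) < 1 - Cmod (x, y). Proof. by rewrite /e; move: hr; set c := Cmod _ => h; lra. Qed.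

Lemma vside_integral (X : Rr) : x - r <= X <= x + r ->
  (\int[leb]_(t in `[(y - r)%R, (y + r)%R]) (Cmod (u (X, t)) : Rr)%:E = (ComplexAnalysis.vside u X (y - r) (y + r) : Rr)%:E)%E.
Proof.
move=> /andP[X1 X2].
have cphi t : (y - r) - e < t -> t < (y + r) + e -> continuity_pt (fun t => Cmod (u (X, t))) t.
  move=> t1 t2; apply: ComplexAnalysis.vside_cont => //; apply: (@rect_disk x y (r + e)) => //=; [exact: itv_widen|exact: itv_widen_lt].
rewrite (@integral_primitive (fun t => Cmod (u (X, t))) (fun s => ComplexAnalysis.vside u X (y - r) s) _ _ e) //; last 2 first.
- exact: itv_lt.
- move=> t t1 t2; apply: (ComplexAnalysis.RInt_primitive _ _ (y + r) e).
  + exact/RltP.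
  + exact/RleP/ltW/itv_lt.
  + by move=> s [/RltP s1 /RltP s2]; exact: cphi.
  + by split; apply/RleP.
by rewrite {2}/ComplexAnalysis.vside Coquelicot.RInt.RInt_point /Coquelicot.Hierarchy.zero /= subr0.
Qed.

Lemma hside_integral (Y : Rr) : y - r <= Y <= y + r ->
  (\int[leb]_(t in `[(x - r)%R, (x + r)%R]) (Cmod (u (t, Y)) : Rr)%:E = (ComplexAnalysis.hside u Y (x - r) (x + r) : Rr)%:E)%E.
Proof.
move=> /andP[X1 X2].
have cphi t : (x - r) - e < t -> t < (x + r) + e -> continuity_pt (fun t => Cmod (u (t, Y))) t.
  move=> t1 t2; apply: ComplexAnalysis.hside_cont => //; apply: (@rect_disk x y (r + e)) => //=; [exact: itv_widen_lt|exact: itv_widen].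
rewrite (@integral_primitive (fun t => Cmod (u (t, Y))) (fun s => ComplexAnalysis.hside u Y (x - r) s) _ _ e) //; last 2 first.
- exact: itv_lt.
- move=> t t1 t2; apply: (ComplexAnalysis.RInt_primitive _ _ (x + r) e).
  + exact/RltP.
  + exact/RleP/ltW/itv_lt.
  + by move=> s [/RltP s1 /RltP s2]; exact: cphi.
  + by split; apply/RleP.
by rewrite {2}/ComplexAnalysis.hside Coquelicot.RInt.RInt_point /Coquelicot.Hierarchy.zero /= subr0.
Qed.

Lemma rect_sub_disk : rect x y r `<=` diskset.
Proof. by move=> w [/=]; rewrite !in_itv /=; exact: rect_disk. Qed.

Lemma analytic_local_mean (T p : Rr) : 1 < p -> 0 <= T ->
  T = r * Cmod (u (x, y)) \/ T = r ^+ 2 * Cmod (cder u (x, y)) ->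
  (((T / (16 * r)) `^ p * r ^+ 2)%:E <= \int[leb \x leb]_(z in rect x y r) ((Cmod (u z) : Rr) `^ p)%:E)%E.
Proof.
move=> p1 T0 HT; apply: local_mean => //.
- by apply: measurable_funS (measurable_analytic Hu); [exact: measurable_disk|exact: rect_sub_disk].
- by move=> z; exact: Cmod_ge0.
move=> X1 X2 Y1 Y2 hX1 hX2 hY1 hY2.
have [a1 a2] : x - r <= X1 /\ X1 <= x - r / 2 by move: hX1 => /andP.
have [b1 b2] : x + r / 2 <= X2 /\ X2 <= x + r by move: hX2 => /andP.
have [c1 c2] : y - r <= Y1 /\ Y1 <= y - r / 2 by move: hY1 => /andP.
have [d1 d2] : y + r / 2 <= Y2 /\ Y2 <= y + r by move: hY2 => /andP.
rewrite !hside_integral ?vside_integral; try solve [exact: itv_left|exact: itv_right].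
rewrite -!EFinD lee_fin.
have [] := @ComplexAnalysis.analytic_side_bounds u x y r X1 X2 Y1 Y2 Hu (elimT RltP r0) (elimT RltP hr).
- by split; apply/RleP.
- by split; apply/RleP.
- by split; apply/RleP.
- by split; apply/RleP.
move=> /RleP h1 /RleP h2; case: HT => ->; first exact: h1.
by move: h2; rewrite RpowE.
Qed.

End Side.

(** * Comparison of weights on a square *)

(** Comparability is assumed in both directions because the exponent may have either sign; it will
    be p - 2 or p - 4. *)
Lemma powR_ratio (K : realType) (a b s : K) : 0 < a -> 0 < b -> a <= 4 * b -> b <= 4 * a ->
  b `^ s <= 4 `^ `|s| * a `^ s.
Proof.
move=> a0 b0 ab ba; have [s0|s0] := leP 0 s.
  rewrite ger0_norm // -powRM; [|lra|lra].
  by apply: ge0_ler_powR; rewrite ?nnegrE //; lra.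
have [t t0 ->] : exists2 t, 0 <= t & s = - t by exists (- s); lra.
rewrite normrN ger0_norm // !powRN.
have h : a `^ t <= 4 `^ t * b `^ t.
  rewrite -powRM; [|lra|lra].
  by apply: ge0_ler_powR; rewrite ?nnegrE //; lra.
have at0 : 0 < a `^ t by exact: powR_gt0.
have bt0 : 0 < b `^ t by exact: powR_gt0.
rewrite ler_pdivlMr // mulrC ler_pdivrMr //.
Qed.

Lemma powRD2 (K : realType) (x s : K) : 0 < x -> x `^ (s + 2) = x `^ s * x ^+ 2.
Proof.
by move=> x0; rewrite powRD ?powR_mulrn ?ltW //; apply/implyP => _; rewrite gt_eqF.
Qed.

(** Here c and c' are moduli of points: 1 - c' lies between 1/2 and 3/2 times 1 - c, and 1 - c^2
    lies between 1 - c and 2 (1 - c). *)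
Lemma hyp_compare (K : realFieldType) (c c' r : K) : 0 <= c -> c < 1 -> 0 <= c' -> c' < 1 ->
  r = (1 - c) / 4 -> `|c' - c| <= 2 * r ->
  [/\ 1 - c' ^+ 2 <= 4 * (1 - c ^+ 2), 1 - c ^+ 2 <= 4 * (1 - c' ^+ 2),
    r <= 1 - c' ^+ 2 & (1 - c ^+ 2) / 8 <= r].
Proof.
move=> c0 c1 c0' c1' ->; rewrite ler_distl => /andP[h1 h2].
split; nra.
Qed.

Section Weight.
Definition weight (z : C) : Rr := 1 - (Cmod z : Rr) ^+ 2.
Definition rad (z : C) : Rr := (1 - Cmod z) / 4.

Lemma inD_lt z : inD z -> (Cmod z : Rr) < 1.
Proof. by move=> /RltP. Qed.

Lemma weight_gt0 z : inD z -> 0 < weight z.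
Proof. by move=> /inD_lt h; rewrite /weight subr_gt0 expr_lt1 // Cmod_ge0. Qed.

Lemma rad_gt0 z : inD z -> 0 < rad z.
Proof. by move=> /inD_lt h; rewrite /rad divr_gt0 // subr_gt0. Qed.

Lemma rad_small z : inD z -> 2 * rad z < 1 - Cmod z.
Proof.
move=> /inD_lt; rewrite /rad; set c : Rr := Cmod z.
by move: c => c h; lra.
Qed.

Lemma dist_Cmod (z w : C) (r : Rr) : `|w.1 - z.1 : Rr| <= r -> `|w.2 - z.2 : Rr| <= r ->
  `|(Cmod w : Rr) - Cmod z| <= 2 * r.
Proof.
move=> h1 h2; have /RleP := ComplexAnalysis.Cmod_lipschitz w z.
rewrite !RealsE => h; apply: le_trans h _.
by rewrite mulr2n mulrDl mul1r; apply: lerD.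
Qed.

Lemma compare_weights z w : inD z -> inD w ->
  `|w.1 - z.1 : Rr| <= rad z -> `|w.2 - z.2 : Rr| <= rad z ->
  [/\ weight w <= 4 * weight z, weight z <= 4 * weight w, rad z <= weight w & weight z / 8 <= rad z].
Proof.
move=> hz hw h1 h2; have := @hyp_compare Rr (Cmod z) (Cmod w) (rad z).
by apply => //; [exact: Cmod_ge0|exact: inD_lt|exact: Cmod_ge0|exact: inD_lt|exact: dist_Cmod].
Qed.

Lemma rect_dist (x y r : Rr) w : rect x y r w -> `|w.1 - x| <= r /\ `|w.2 - y| <= r.
Proof.
by move=> [/=]; rewrite !in_itv /= => /andP[? ?] /andP[? ?]; rewrite !ler_distl; split; apply/andP.
Qed.

Lemma measurable_weight : measurable_fun [set: Rr * Rr] weight.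
Proof.
apply: measurable_funB => //; apply: (measurable_funX 2); exact: measurable_Cmod.
Qed.

Lemma measurable_weighted (u : C -> C) (p s : Rr) : analytic_on_D u ->
  measurable_fun (diskset : set (Rr * Rr)) (fun z => (Cmod (u z) : Rr) `^ p * weight z `^ s).
Proof.
move=> Hu; apply: measurable_funM.
  by apply: (measurableT_comp (measurable_powR _)); exact: measurable_analytic.
apply: (measurableT_comp (measurable_powR _)); exact: measurable_funTS measurable_weight.
Qed.

Lemma rect_in_disk z : inD z -> rect z.1 z.2 (rad z) `<=` diskset.
Proof.
move=> hz; have -> : z = (z.1, z.2) by case: z {hz}.
apply: rect_sub_disk; rewrite -surjective_pairing; exact: rad_small.
Qed.

(** On the square all weights are comparable, so the weight moves under the integral, and the area,
    comparable to the squared weight, raises the exponent by 2. Keeping s free serves both uses: s =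
    p - 2 for the pointwise bound, s = p - 4 for the derivative. *)
Lemma weighted_mean (u : C -> C) (p s : Rr) : 1 < p -> analytic_on_D u ->
  exists2 c : Rr, 0 <= c & forall z, inD z -> forall a : Rr,
    a = Cmod (u z) \/ a = weight z * Cmod (cder u z) ->
    ((a `^ p * weight z `^ (s + 2))%:E <=
     c%:E * \int[leb \x leb]_(w in rect z.1 z.2 (rad z)) ((Cmod (u w) : Rr) `^ p * weight w `^ s)%:E)%E.
Proof.
move=> p1 Hu; have p0 : 0 < p by lra.
(* The mean value estimate bounds |u| / 16 or rad |u'| / 16, and weight <= 8 rad makes both at least
   a / 128; 64 comes from (weight / 8)^2 <= rad^2 and the last factor from [powR_ratio]. *)
exists (128 `^ p * 64 * 4 `^ `|s|); first by rewrite !mulr_ge0 ?powR_ge0.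
move=> z hz a Ha.
have r0 := rad_gt0 hz; have d0 := weight_gt0 hz.
have hc : 0 <= (Cmod (u z) : Rr) by exact: Cmod_ge0.
have hc' : 0 <= (Cmod (cder u z) : Rr) by exact: Cmod_ge0.
have z0 : `|z.1 - z.1 : Rr| <= rad z by rewrite subrr normr0 ltW.
have z0' : `|z.2 - z.2 : Rr| <= rad z by rewrite subrr normr0 ltW.
have [_ _ _ dr] := compare_weights hz hz z0 z0'.
have a0 : 0 <= a by case: Ha => ->; rewrite ?mulr_ge0 // ltW.
have zE : (z.1, z.2) = z by case: z {hz a Ha r0 d0 hc hc' z0 z0' dr a0}.
have hr : 2 * rad z < 1 - Cmod (z.1, z.2) by rewrite zE; exact: rad_small.
have mQ : measurable (rect z.1 z.2 (rad z) : set (Rr * Rr)) by exact: measurable_rect.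
set I := (X in (_ <= _ * X)%E).
have H1 : (((a / 128) `^ p * (weight z / 8) ^+ 2)%:E <=
   \int[leb \x leb]_(w in rect z.1 z.2 (rad z)) ((Cmod (u w) : Rr) `^ p)%:E)%E.
  have [T [T0 HT aT]] : exists T : Rr, [/\ 0 <= T,
     T = rad z * Cmod (u (z.1, z.2)) \/ T = rad z ^+ 2 * Cmod (cder u (z.1, z.2)) &
     a / 128 <= T / (16 * rad z)].
    rewrite zE; case: Ha => ->.
      exists (rad z * Cmod (u z)); split; [by rewrite mulr_ge0 // ltW|by left|].
      rewrite (_ : _ / (16 * _) = (Cmod (u z) : Rr) / 16); last by field; rewrite gt_eqF.
      by move: hc; set c : Rr := Cmod _; move: c => c hc2; lra.
    exists (rad z ^+ 2 * Cmod (cder u z)); split; [by rewrite mulr_ge0 // exprn_ge0 // ltW|by right|].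
    rewrite (_ : _ / (16 * _) = rad z * (Cmod (cder u z) : Rr) / 16); last by field; rewrite gt_eqF.
    move: hc' dr; set c : Rr := Cmod _; move: c (weight z) (rad z) => c d r hc2 hdr; nra.
  apply: (le_trans _ (analytic_local_mean Hu r0 hr p1 T0 HT)).
  rewrite lee_fin; apply: ler_pM; [exact: powR_ge0|exact: sqr_ge0| |].
    apply: ge0_ler_powR; rewrite ?nnegrE //; [lra|by rewrite divr_ge0|].
    by apply: (le_trans _ aT); apply: divr_ge0.
  apply: lerXn2r => //; rewrite nnegrE; last exact: ltW.
  by apply: divr_ge0 => //; exact: ltW.
have H2 : ((weight z `^ s)%:E * \int[leb \x leb]_(w in rect z.1 z.2 (rad z)) ((Cmod (u w) : Rr) `^ p)%:E <=
   (4 `^ `|s|)%:E * I)%E.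
  have mu_ : measurable_fun (rect z.1 z.2 (rad z)) (EFin \o (fun w : Rr * Rr => (Cmod (u w) : Rr) `^ p)).
    apply/measurable_EFinP; apply: (measurableT_comp (measurable_powR _)).
    by apply: measurable_funS (measurable_analytic Hu); [exact: measurable_disk|exact: rect_in_disk].
  have mw_ : measurable_fun (rect z.1 z.2 (rad z)) (EFin \o (fun w : Rr * Rr => (Cmod (u w) : Rr) `^ p * weight w `^ s)).
    apply/measurable_EFinP.
    by apply: measurable_funS (measurable_weighted p s Hu); [exact: measurable_disk|exact: rect_in_disk].
  rewrite -[X in (X <= _)%E]ge0_integralZl_EFin ?powR_ge0 //; last first.
    by move=> w _; rewrite lee_fin powR_ge0.
  rewrite -[X in (_ <= X)%E]ge0_integralZl_EFin ?powR_ge0 //; last first.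
    by move=> w _; rewrite lee_fin mulr_ge0 ?powR_ge0.
  apply: ge0_le_integral_nonmeasurable => w Qw; first by rewrite -EFinM lee_fin mulr_ge0 ?powR_ge0.
  have hw : inD w by exact: (rect_in_disk hz Qw).
  have [w1 w2] := rect_dist Qw.
  have [c1 c2 _ _] := compare_weights hz hw w1 w2.
  rewrite -!EFinM lee_fin mulrC mulrCA ler_wpM2l ?powR_ge0 //.
  by apply: powR_ratio => //; exact: weight_gt0.
have H3 : ((weight z `^ s)%:E * ((a / 128) `^ p * (weight z / 8) ^+ 2)%:E <= (4 `^ `|s|)%:E * I)%E.
  by apply: (le_trans _ H2); rewrite lee_wpmul2l // lee_fin powR_ge0.
have E1 : (a `^ p * weight z `^ (s + 2) = 128 `^ p * 64 * (weight z `^ s * ((a / 128) `^ p * (weight z / 8) ^+ 2)))%R.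
  have -> : a `^ p = 128 `^ p * (a / 128) `^ p.
    by rewrite -powRM //; [congr (_ `^ _); field|by rewrite divr_ge0].
  by rewrite powRD2 //; field.
rewrite E1 [X in (X <= _)%E]EFinM [X in (_ <= X * _)%E]EFinM -[X in (_ <= X)%E]muleA.
by rewrite lee_wpmul2l.
Qed.
End Weight.

Local Open Scope ereal_scope.

Notation leb2 := (leb \x leb).
Notation disk := (diskset : set (Rr * Rr)).

(** * Exchange of integration over pairs of points of the plane *)

(** Covers the degenerate square, which occurs as the first set of the exhaustion in
    [lebesgue2_sigma_finite]. *)
Lemma itv_collapse (K : realFieldType) (a r : K) : (0 <= r)%R -> (a + r <= a - r)%R -> r = 0%R.
Proof. by move=> *; lra. Qed.

Lemma lebesgue2_rect (R : realType) (x y r : R) : (0 <= r)%R ->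
  ((@lebesgue_measure R) \x (@lebesgue_measure R)) (rect x y r) = ((2 * r) ^+ 2)%:E.
Proof.
move=> r0; rewrite product_measure1E; [|exact: measurable_itv|exact: measurable_itv].
have E (a : R) : lebesgue_measure (`[(a - r)%R, (a + r)%R]%classic : set R) = (2 * r)%:E.
  rewrite lebesgue_measure_itv /= lte_fin.
  case: ltP => h; rewrite -?EFinD; congr EFin; first by ring.
  by rewrite (itv_collapse r0 h) mulr0.
transitivity ((2 * r)%:E * (2 * r)%:E); last by rewrite -EFinM expr2.
by congr (_ * _); exact: E.
Qed.

(** A bound of F by an integral of Psi over w becomes a bound by the integrals of Psi over z.
    Measurability is carried by Psi alone, so F and G may be given by pointwise estimates. *)
Lemma tonelli_bound d1 d2 (T1 : measurableType d1) (T2 : measurableType d2) (R : realType)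
  (m1 : {sigma_finite_measure set T1 -> \bar R}) (m2 : {sigma_finite_measure set T2 -> \bar R})
  (A : set T1) (Psi : T1 * T2 -> \bar R) (c : R) (F : T1 -> \bar R) (G : T2 -> \bar R) :
  measurable A -> measurable_fun setT Psi -> (forall zw, 0 <= Psi zw) -> (0 <= c)%R ->
  (forall z, A z -> 0 <= F z) ->
  (forall z, A z -> F z <= c%:E * \int[m2]_w Psi (z, w)) ->
  (forall w, \int[m1]_z Psi (z, w) <= G w) ->
  \int[m1]_(z in A) F z <= c%:E * \int[m2]_w G w.
Proof.
move=> mA mPsi Psi0 c0 F0 FPsi PsiG.
have mF := measurable_fun_fubini_tonelli_F (m2 := m2) Psi mPsi Psi0.
have I0 z : 0 <= \int[m2]_w Psi (z, w) by exact: integral_ge0.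
apply: (@le_trans _ _ (\int[m1]_(z in A) (c%:E * \int[m2]_w Psi (z, w)))).
  by apply: ge0_le_integral_nonmeasurable => z Az; [exact: F0|exact: FPsi].
rewrite ge0_integralZl_EFin //; last exact: measurable_funTS mF.
apply: (@le_trans _ _ (c%:E * \int[m1]_z \int[m2]_w Psi (z, w))).
  by rewrite lee_wpmul2l ?lee_fin //; exact: ge0_subset_integral.
rewrite (fubini_tonelli _ mPsi Psi0) lee_wpmul2l ?lee_fin //.
by apply: ge0_le_integral_nonmeasurable => w _; [exact: integral_ge0|exact: PsiG].
Qed.

Lemma lebesgue2_sigma_finite (R : realType) :
  sigma_finite setT ((@lebesgue_measure R) \x (@lebesgue_measure R)).
Proof.
exists (fun n => rect (0 : R)%R 0%R n%:R).
  apply/seteqP; split => // -[x y] _ /=.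
  exists (Num.truncn (Num.max `|x| `|y|)%R).+1 => //=.
  have h := truncnS_gt (Num.max `|x| `|y|)%R.
  by rewrite /rect; split => /=; rewrite in_itv /= sub0r add0r -ler_norml; apply: ltW;
    apply: le_lt_trans h; rewrite le_max lexx ?orbT.
move=> n; split; first by apply: measurableX; exact: measurable_itv.
by rewrite lebesgue2_rect // ltry.
Qed.

(* The sigma-finite structure that the library puts on product measures is shadowed
   by the one for products of subprobabilities, hence this explicit package. *)
Definition lebesgue2_sfin (R : realType) :
    {sigma_finite_measure set (measurableTypeR R * measurableTypeR R)%type -> \bar R} :=
  HB.pack ((@lebesgue_measure R) \x (@lebesgue_measure R))
    (Measure_isSigmaFinite.Build _ _ _ ((@lebesgue_measure R) \x (@lebesgue_measure R))
       (@lebesgue2_sigma_finite R)).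

Lemma tonelli_bound_plane (R : realType) (A : set (R * R)) (Psi : (R * R) * (R * R) -> \bar R)
  (c : R) (F G : R * R -> \bar R) :
  measurable A -> measurable_fun setT Psi -> (forall zw, 0 <= Psi zw) -> (0 <= c)%R ->
  (forall z, A z -> 0 <= F z) ->
  (forall z, A z -> F z <= c%:E * \int[(@lebesgue_measure R) \x (@lebesgue_measure R)]_w Psi (z, w)) ->
  (forall w, \int[(@lebesgue_measure R) \x (@lebesgue_measure R)]_z Psi (z, w) <= G w) ->
  \int[(@lebesgue_measure R) \x (@lebesgue_measure R)]_(z in A) F z <=
    c%:E * \int[(@lebesgue_measure R) \x (@lebesgue_measure R)]_w G w.
Proof. exact: (tonelli_bound (m1 := lebesgue2_sfin R) (m2 := lebesgue2_sfin R)). Qed.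

(** * Growth and derivative of a function with finite weighted integral *)

Section Derivative.
Variables (u : C -> C) (p : Rr).
Hypotheses (p1 : (1 < p)%R) (Hu : analytic_on_D u).
Hypothesis HM : \int[leb2]_(z in disk) ((Cmod (u z) : Rr) `^ p * weight z `^ (p - 2))%:E < +oo.

(** For s = p - 2 the left side of [weighted_mean] carries the weight to the power p, and the
    integral over the square is at most the one over the disk. *)
Lemma besov_bloch : exists2 K : Rr, (0 <= K)%R & forall z, inD z ->
  ((Cmod (u z) : Rr) `^ p * weight z `^ p <= K)%R.
Proof.
have [c c0 Hc] := weighted_mean (p - 2) p1 Hu.
pose M := \int[leb2]_(z in disk) ((Cmod (u z) : Rr) `^ p * weight z `^ (p - 2))%:E.
have HM' : M < +oo by exact: HM.
have M0 : 0 <= M by apply: integral_ge0 => z _; rewrite lee_fin mulr_ge0 ?powR_ge0.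
have Mf : M \is a fin_num by rewrite ge0_fin_numE.
exists (c * fine M)%R; first by rewrite mulr_ge0 // fine_ge0.
move=> z hz; rewrite -lee_fin [X in _ <= X]EFinM fineK //.
have := Hc z hz _ (or_introl erefl); rewrite subrK => h; apply: (le_trans h).
rewrite lee_wpmul2l ?lee_fin //; apply: ge0_subset_integral.
- exact: measurable_rect.
- exact: measurable_disk.
- by apply/measurable_EFinP; apply: measurable_weighted.
- by move=> w _; rewrite lee_fin mulr_ge0 ?powR_ge0.
- exact: rect_in_disk.
Qed.

(* The estimate of the derivative at [z] integrates [g] over a square around [z]; for a
   given [w], the points [z] whose square contains [w] lie in a square of comparable size. *)
Let g (w : Rr * Rr) : Rr := ((Cmod (u w) : Rr) `^ p * weight w `^ (p - 4))%R.
Let N : set ((Rr * Rr) * (Rr * Rr)) :=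
  [set zw | inD zw.1 /\ inD zw.2] `&`
  [set zw | (0 <= rad zw.1 - `|zw.2.1 - zw.1.1|)%R] `&`
  [set zw | (0 <= rad zw.1 - `|zw.2.2 - zw.1.2|)%R].

Let mN : measurable N.
Proof.
have mD1 : measurable [set zw : (Rr * Rr) * (Rr * Rr) | inD zw.1 /\ inD zw.2].
  exact: (measurableX measurable_disk measurable_disk).
have mrad : measurable_fun [set: (Rr * Rr) * (Rr * Rr)] (fun zw => rad zw.1).
  apply: measurable_funM => //; apply: measurable_funB => //.
  exact: (measurableT_comp measurable_Cmod measurable_fst).
have m11 : measurable_fun [set: (Rr * Rr) * (Rr * Rr)] (fun zw => zw.1.1).
  exact: (measurableT_comp measurable_fst measurable_fst).
have m12 : measurable_fun [set: (Rr * Rr) * (Rr * Rr)] (fun zw => zw.1.2).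
  exact: (measurableT_comp measurable_snd measurable_fst).
have m21 : measurable_fun [set: (Rr * Rr) * (Rr * Rr)] (fun zw => zw.2.1).
  exact: (measurableT_comp measurable_fst measurable_snd).
have m22 : measurable_fun [set: (Rr * Rr) * (Rr * Rr)] (fun zw => zw.2.2).
  exact: (measurableT_comp measurable_snd measurable_snd).
have key (F : (Rr * Rr) * (Rr * Rr) -> Rr) : measurable_fun setT F -> measurable [set zw | (0 <= F zw)%R].
  move=> mF; have := mF measurableT (`[0%R, +oo[%classic : set Rr) (measurable_itv _).
  rewrite setTI; congr measurable; apply/seteqP; split => z /=; by rewrite in_itv /= andbT.
apply: measurableI; first apply: measurableI => //.
- apply: key; apply: measurable_funB => //.
  exact: (measurableT_comp (@normr_measurable Rr setT) (measurable_funB m21 m11)).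
- apply: key; apply: measurable_funB => //.
  exact: (measurableT_comp (@normr_measurable Rr setT) (measurable_funB m22 m12)).
Qed.

(** [g] is cut off outside the disk because measurability of |u| is known only there; Tonelli's
    theorem wants a function measurable on the whole product. *)
Let Psi : (Rr * Rr) * (Rr * Rr) -> \bar Rr := (fun zw => ((g \_ disk) zw.2)%:E) \_ N.

Let g0 w : (0 <= g w)%R. Proof. by rewrite mulr_ge0 ?powR_ge0. Qed.

Let gD0 w : (0 <= (g \_ disk) w)%R. Proof. by rewrite /patch; case: ifP. Qed.

Let Psi0 zw : 0 <= Psi zw.
Proof. by apply: erestrict_ge0 => ? _; rewrite lee_fin. Qed.

Let mPsi : measurable_fun setT Psi.
Proof.
apply/(measurable_restrictT _ _).1 => //; apply: measurable_funTS.
apply/measurable_EFinP; apply: (measurableT_comp _ measurable_snd).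
apply/(measurable_restrictT _ _).1; first exact: measurable_disk.
exact: measurable_weighted.
Qed.

Lemma inner_ge z : inD z ->
  \int[leb2]_(w in rect z.1 z.2 (rad z)) (g w)%:E <= \int[leb2]_w Psi (z, w).
Proof.
move=> hz; rewrite integral_mkcond; apply: ge0_le_integral_nonmeasurable => w _.
  by apply: erestrict_ge0 => ? _; rewrite lee_fin.
rewrite {1}/patch; case: ifPn => [|_]; last exact: Psi0.
rewrite inE => Qw; have [w1 w2] := rect_dist Qw.
have hw := rect_in_disk hz Qw.
have hN : (z, w) \in N by rewrite inE; split; [split|] => //=; rewrite subr_ge0.
by rewrite /Psi /patch hN /= mem_set.
Qed.

(** If the square of z contains w then rad z <= weight w, so z lies in the square with centre w and
    half side weight w. Its area, 4 times the squared weight, turns the exponent p - 4 of [g] into p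
    - 2. *)
Lemma inner_le w : \int[leb2]_z Psi (z, w) <=
  4%:E * ((fun w => ((Cmod (u w) : Rr) `^ p * weight w `^ (p - 2))%:E) \_ disk) w.
Proof.
rewrite [X in _ <= _ * X]/patch; case: ifPn => [|nw]; last first.
  rewrite integral0_eq ?mule0 // => z _; rewrite /Psi /patch.
  by case: ifPn => // _; rewrite /= (negbTE nw).
rewrite inE => hw.
have d0 := weight_gt0 hw.
apply: (@le_trans _ _ (\int[leb2]_(z in rect w.1 w.2 (weight w)) (g w)%:E)).
  rewrite [X in _ <= X]integral_mkcond; apply: ge0_le_integral_nonmeasurable => z _ //.
  rewrite {1}/Psi {1}/patch; case: ifPn => [|_]; last by apply: erestrict_ge0 => ? _; rewrite lee_fin.
  rewrite inE => -[[[/= hz _]]]; rewrite !subr_ge0 => h1 h2.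
  have [_ _ rd _] := compare_weights hz hw h1 h2.
  have hQ : z \in rect w.1 w.2 (weight w).
    rewrite inE; split => /=; rewrite in_itv /= -ler_distl distrC.
      exact: le_trans rd.
    exact: le_trans rd.
  by rewrite [X in _ <= X]/patch hQ [X in X%:E <= _]/patch mem_set.
rewrite integral_cst; last exact: measurable_rect.
apply: (@le_trans _ _ ((g w)%:E * ((2 * weight w) ^+ 2)%:E)).
  rewrite le_eqVlt; apply/orP; left; apply/eqP; congr (_ * _).
  exact: (@lebesgue2_rect Rr _ _ _ (ltW d0)).
rewrite -!EFinM lee_fin.
suff -> : (g w * (2 * weight w) ^+ 2 = 4 * ((Cmod (u w) : Rr) `^ p * weight w `^ (p - 2)))%R by [].
have -> : (p - 2 = p - 4 + 2)%R by ring.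
by rewrite powRD2 // /g; ring.
Qed.

(** [weighted_mean] with s = p - 4 bounds the integrand at z by an average of [g], and the exchange
    of integrations returns the given integral up to the constant 4 c. *)
Lemma besov_derivative :
  \int[leb2]_(z in disk) ((weight z * (Cmod (cder u z) : Rr)) `^ p * weight z `^ (p - 2))%:E < +oo.
Proof.
have [c c0 Hc] := weighted_mean (p - 4) p1 Hu.
have H : \int[leb2]_(z in disk) ((weight z * (Cmod (cder u z) : Rr)) `^ p * weight z `^ (p - 2))%:E <=
    c%:E * \int[leb2]_w (4%:E * ((fun w => ((Cmod (u w) : Rr) `^ p * weight w `^ (p - 2))%:E) \_ disk) w).
  apply: (@tonelli_bound_plane Rr disk Psi) => //.
  - exact: measurable_disk.
  - by move=> z hz; rewrite lee_fin mulr_ge0 ?powR_ge0.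
  - move=> z hz; have := Hc z hz _ (or_intror erefl).
    have -> : (p - 4 + 2 = p - 2)%R by ring.
    move=> h; apply: (le_trans h); rewrite lee_wpmul2l ?lee_fin //.
    exact: inner_ge.
  - exact: inner_le.
apply: (le_lt_trans H).
rewrite ge0_integralZl_EFin //; last 2 first.
- by move=> w _; apply: erestrict_ge0 => ? _; rewrite lee_fin mulr_ge0 ?powR_ge0.
- apply/(measurable_restrictT _ _).1; first exact: measurable_disk.
  by apply/measurable_EFinP; apply: measurable_weighted.
rewrite -integral_mkcond.
by rewrite !lte_mul_pinfty ?lee_fin // ?mule_ge0 // integral_ge0 // => z _; rewrite lee_fin mulr_ge0 ?powR_ge0.
Qed.

End Derivative.

(** * Besov integrals *)

Lemma gt0_powRD (K : realType) (x r s : K) : (0 < x)%R -> (x `^ (r + s) = x `^ r * x `^ s)%R.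
Proof. by move=> x0; rewrite powRD //; apply/implyP => _; rewrite gt_eqF. Qed.

Lemma powR_add_le (K : realType) (a b p : K) : (0 <= p)%R -> (0 <= a)%R -> (0 <= b)%R ->
  ((a + b) `^ p <= 2 `^ p * (a `^ p + b `^ p))%R.
Proof.
move=> p0; wlog ab : a b / (a <= b)%R => [H|] a0 b0.
  have [ab|/ltW ba] := leP a b; first exact: H.
  by rewrite addrC [(a `^ p + _)%R]addrC; exact: H.
apply: (@le_trans _ _ ((2 * b) `^ p)%R).
  by apply: ge0_ler_powR; rewrite ?nnegrE //; lra.
by rewrite powRM // ler_wpM2l ?powR_ge0 // lerDr powR_ge0.
Qed.

(** Collects what additivity and homogeneity of the integral ask for, so that finite majorants can
    be assembled term by term. *)
Definition summable_disk (f : Rr * Rr -> Rr) :=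
  [/\ measurable_fun disk f, forall z, disk z -> (0 <= f z)%R & \int[leb2]_(z in disk) (f z)%:E < +oo].

Lemma summable_add f g : summable_disk f -> summable_disk g -> summable_disk (fun z => f z + g z)%R.
Proof.
move=> [mf f0 If] [mg g0 Ig]; split; first exact: measurable_funD.
  by move=> z hz; rewrite addr_ge0 ?f0 ?g0.
under eq_integral do rewrite EFinD.
rewrite ge0_integralD //; first exact: lte_add_pinfty.
all: try exact: measurable_disk.
all: try exact/measurable_EFinP.
all: by move=> z hz; rewrite lee_fin ?f0 ?g0.
Qed.

Lemma summable_scale (k : Rr) f : (0 <= k)%R -> summable_disk f -> summable_disk (fun z => k * f z)%R.
Proof.
move=> k0 [mf f0 If]; split; first exact: measurable_funM.
  by move=> z hz; rewrite mulr_ge0 ?f0.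
under eq_integral do rewrite EFinM.
rewrite ge0_integralZl_EFin //; first by rewrite lte_mul_pinfty ?lee_fin.
all: try exact: measurable_disk.
all: try exact/measurable_EFinP.
all: by move=> z hz; rewrite lee_fin f0.
Qed.

Lemma dominated_finite (f g : Rr * Rr -> Rr) : (forall z, disk z -> (0 <= f z <= g z)%R) ->
  \int[leb2]_(z in disk) (g z)%:E < +oo -> \int[leb2]_(z in disk) (f z)%:E < +oo.
Proof.
move=> fg; apply: le_lt_trans; apply: ge0_le_integral_nonmeasurable => z /fg /andP[? ?]; by rewrite lee_fin.
Qed.

Definition weighted (u : C -> C) (p s : Rr) (z : Rr * Rr) : Rr := ((Cmod (u z) : Rr) `^ p * weight z `^ s)%R.

Section Besov.
Variables (u : C -> C) (p : Rr).
Hypotheses (p1 : (1 < p)%R) (Hu : analytic_on_D u).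
Hypothesis HM : \int[leb2]_(z in disk) (weighted u p (p - 2) z)%:E < +oo.

Lemma summable_besov : summable_disk (weighted u p (p - 2)).
Proof. by split => //; [exact: measurable_weighted|move=> z _; rewrite mulr_ge0 ?powR_ge0]. Qed.

Lemma summable_besov_derivative : summable_disk (weighted (cder u) p (2 * p - 2)).
Proof.
split; [|by move=> z _; rewrite mulr_ge0 ?powR_ge0|].
  by apply: measurable_weighted; exact: ComplexAnalysis.analytic_cder.
apply: dominated_finite (besov_derivative p1 Hu HM) => z hz.
rewrite /weighted mulr_ge0 ?powR_ge0 //=.
have d0 := weight_gt0 hz.
rewrite (powRM _ (ltW d0) (Cmod_ge0 _)).
rewrite [X in (_ <= X * _)%R]mulrC -mulrA -gt0_powRD //.
by have -> : (p + (p - 2) = 2 * p - 2)%R by ring.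
Qed.

(** Splitting 2 p - 2 as p + (p - 2) separates the factor |u|^p weight^p, bounded by [besov_bloch],
    from the Besov integrand. *)
Lemma besov_square : exists2 K : Rr, (0 <= K)%R & forall z, disk z ->
  (((Cmod (u z) : Rr) ^+ 2) `^ p * weight z `^ (2 * p - 2) <= K * weighted u p (p - 2) z)%R.
Proof.
have [K K0 HK] := besov_bloch p1 Hu HM.
exists K => // z hz; have d0 := weight_gt0 hz.
have -> : (2 * p - 2 = p + (p - 2))%R by ring.
rewrite expr2 powRM; [|exact: Cmod_ge0|exact: Cmod_ge0].
rewrite gt0_powRD //.
rewrite mulrACA /weighted; apply: ler_wpM2r; first by rewrite mulr_ge0 ?powR_ge0.
exact: HK.
Qed.

End Besov.

(** * The Besov condition for h''/h' and the integral of the Schwarzian *)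

Section Final.
Variables (p : Rr) (h g : C -> C).
Hypothesis p1' : Rlt (IZR 1) p.
Hypotheses (Hh : analytic_on_D h) (Hg : analytic_on_D g).
Hypothesis Hh0 : forall z, inD z -> cder h z <> Coquelicot.Complex.RtoC (IZR Z0).
Hypothesis Hw1 : forall z, inD z -> Rlt (Cmod (dilatation h g z)) (IZR 1).
Hypothesis HB : in_Besov p (dilatation h g).
Hypothesis Hsup : exists c : R, Rlt c (IZR 1) /\ forall z, inD z -> Rle (Cmod (dilatation h g z)) c.
Hypothesis HF : in_Besov_tilde p (logJ h g).

Let p1 : (1 < p)%R. Proof. exact/RltP. Qed.
Let q := ComplexAnalysis.preschwarz h.
Let w := dilatation h g.
Let p0 : (0 <= p)%R. Proof. by apply: ltW; apply: lt_trans p1. Qed.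
Let Aq : analytic_on_D q. Proof. exact: ComplexAnalysis.analytic_preschwarz. Qed.
Let Aw : analytic_on_D w. Proof. by case: HB. Qed.
Let Aw' : analytic_on_D (cder w). Proof. exact: ComplexAnalysis.analytic_cder. Qed.

Lemma besov_dilatation : \int[leb2]_(z in disk) (weighted (cder w) p (p - 2) z)%:E < +oo.
Proof. by case: HB. Qed.

Lemma schwarzian_bounds_plane : exists2 K : Rr, (0 <= K)%R & forall z, inD z ->
  ((Cmod (q z) : Rr) <= Cmod (Dz (logJ h g) z) + K * Cmod (cder w z))%R /\
  ((Cmod (schwarzian h g z) : Rr) <= K * ((Cmod (cder q z) : Rr) + Cmod (cder (cder w) z)
     + ((Cmod (q z) : Rr) ^+ 2 + (Cmod (cder w z) : Rr) ^+ 2)))%R.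
Proof.
have [c [c1 Hc]] := Hsup.
have [K [K0 HK]] := ComplexAnalysis.schwarzian_bounds h g Hh Hg Hh0 Hw1 c c1 Hc.
exists K; first exact/RleP.
move=> z hz; have [/RleP H1 /RleP H2] := HK z hz; split; first exact: H1.
by move: H2; rewrite !RpowE !RealsE !addrA.
Qed.

(** By |q| <= |F_z| + K |w'| the integral for q is controlled by the hypothesis on F, since |F_z| is
    at most |F_z| + |F_zbar|, and by the one on w. *)
Lemma besov_preschwarz : \int[leb2]_(z in disk) (weighted q p (p - 2) z)%:E < +oo.
Proof.
have [K K0 HK] := schwarzian_bounds_plane.
(* The positive part of [|q| - K |w'|] is measurable and bounded by [|F_z|]: this avoids
   proving that [F_z] is measurable. *)
pose v (z : Rr * Rr) : Rr := Num.max ((Cmod (q z) : Rr) - K * Cmod (cder w z))%R 0%R.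
have v0 z : (0 <= v z)%R by rewrite /v le_max lexx orbT.
have Sv : summable_disk (fun z => v z `^ p * weight z `^ (p - 2))%R.
  split; [|by move=> z _; rewrite mulr_ge0 ?powR_ge0|].
    apply: measurable_funM; last first.
      by apply: (measurableT_comp (measurable_powR _)); exact: measurable_funTS measurable_weight.
    apply: (measurableT_comp (measurable_powR _)); apply: measurable_maxr => //.
    apply: measurable_funB; first exact: measurable_analytic.
    by apply: measurable_funM => //; exact: measurable_analytic.
  apply: dominated_finite HF => z hz; rewrite mulr_ge0 ?powR_ge0 //=.
  rewrite -/(weight z); apply: ler_wpM2r; first exact: powR_ge0.
  have D0 : (0 <= (Cmod (Dz (logJ h g) z) : Rr))%R by exact: Cmod_ge0.
  have D1 : (0 <= (Cmod (Dzb (logJ h g) z) : Rr))%R by exact: Cmod_ge0.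
  apply: ge0_ler_powR; [exact: p0|by rewrite nnegrE; exact: v0|by rewrite nnegrE addr_ge0|].
  apply: (@le_trans _ _ (Cmod (Dz (logJ h g) z) : Rr)); last by rewrite lerDl.
  rewrite /v ge_max D0 andbT lerBlDr; exact: (HK z hz).1.
have Sw := summable_besov Aw' besov_dilatation.
have [_ _ S] := summable_scale (powR_ge0 2 p) (summable_add Sv (summable_scale (powR_ge0 K p) Sw)).
apply: dominated_finite S => z hz; rewrite /weighted mulr_ge0 ?powR_ge0 //=.
rewrite [X in (_ <= _ * (_ + X))%R]mulrA -mulrDl mulrA; apply: ler_wpM2r; first exact: powR_ge0.
have w0 : (0 <= (Cmod (cder w z) : Rr))%R by exact: Cmod_ge0.
rewrite -powRM //.
apply: (le_trans _ (powR_add_le p0 (v0 z) (mulr_ge0 K0 w0))).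
apply: ge0_ler_powR; [exact: p0|by rewrite nnegrE Cmod_ge0|by rewrite nnegrE addr_ge0 ?mulr_ge0|].
by rewrite -lerBlDr /v le_max lexx.
Qed.

Lemma schwarzian_finite : \int[leb2]_(z in disk) (weighted (schwarzian h g) p (2 * p - 2) z)%:E < +oo.
Proof.
have [K K0 HK] := schwarzian_bounds_plane.
have [K1 K10 HK1] := besov_square p1 Aq besov_preschwarz.
have [K2 K20 HK2] := besov_square p1 Aw' besov_dilatation.
have S1 := summable_besov_derivative p1 Aq besov_preschwarz.
have S2 := summable_besov_derivative p1 Aw' besov_dilatation.
have S3 := summable_scale K10 (summable_besov Aq besov_preschwarz).
have S4 := summable_scale K20 (summable_besov Aw' besov_dilatation).
(* The four summands are separated by two nested applications of [powR_add_le], first into the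
   derivatives and the squares, each costing a factor 2^p. *)
have C0 : (0 <= K `^ p * (2 `^ p * 2 `^ p))%R by rewrite !mulr_ge0 ?powR_ge0.
have [_ _ S] := summable_scale C0 (summable_add (summable_add S1 S2) (summable_add S3 S4)).
apply: dominated_finite S => z hz; rewrite {1}/weighted mulr_ge0 ?powR_ge0 //=.
have := (HK z hz).2.
have := HK1 z hz; have := HK2 z hz; rewrite /weighted.
have a0 : (0 <= (Cmod (cder q z) : Rr))%R by exact: Cmod_ge0.
have b0 : (0 <= (Cmod (cder (cder w) z) : Rr))%R by exact: Cmod_ge0.
have c0 : (0 <= (Cmod (q z) : Rr) ^+ 2)%R by exact: sqr_ge0.
have e0 : (0 <= (Cmod (cder w z) : Rr) ^+ 2)%R by exact: sqr_ge0.
have s0 : (0 <= (Cmod (schwarzian h g z) : Rr))%R by exact: Cmod_ge0.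
move: a0 b0 c0 e0 s0.
set a : Rr := Cmod (cder q z); set b : Rr := Cmod (cder (cder w) z).
set c : Rr := ((Cmod (q z) : Rr) ^+ 2)%R; set e : Rr := ((Cmod (cder w z) : Rr) ^+ 2)%R.
set s : Rr := Cmod (schwarzian h g z).
set X := (X in (_ <= K2 * X)%R -> _); set Y := (X in (_ <= K1 * X)%R -> _).
move=> a0 b0 c0 e0 s0 hX hY hs.
have D0 : (0 <= weight z `^ (2 * p - 2))%R by exact: powR_ge0.
set D : Rr := (weight z `^ (2 * p - 2))%R in hX hY D0 *.
have ab0 : (0 <= a + b)%R by rewrite addr_ge0.
have ce0 : (0 <= c + e)%R by rewrite addr_ge0.
have h1 : (s `^ p <= K `^ p * (2 `^ p * 2 `^ p) * (a `^ p + b `^ p + (c `^ p + e `^ p)))%R.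
  apply: (@le_trans _ _ ((K * ((a + b) + (c + e))) `^ p)%R).
    by apply: ge0_ler_powR; rewrite ?nnegrE // mulr_ge0 // addr_ge0.
  rewrite powRM //; last by rewrite addr_ge0.
  rewrite -!mulrA ler_wpM2l ?powR_ge0 //.
  apply: (le_trans (powR_add_le p0 ab0 ce0)).
  rewrite ler_wpM2l ?powR_ge0 // mulrDr; apply: lerD; exact: powR_add_le.
apply: (@le_trans _ _ (K `^ p * (2 `^ p * 2 `^ p) * (a `^ p + b `^ p + (c `^ p + e `^ p)) * D)%R).
  by rewrite ler_wpM2r.
rewrite -mulrA ler_wpM2l // !mulrDl; apply: lerD => //; exact: lerD.
Qed.

End Final.

End BesovEstimates.

From Coquelicot Require Import Coquelicot.
Local Open Scope R_scope.

Theorem theorem1 (p : R) (h g : C -> C) :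
  1 < p ->
  (* f = h + conj g sense-preserving, locally univalent harmonic on D *)
  analytic_on_D h -> analytic_on_D g ->
  h (RtoC 0) = RtoC 0 -> g (RtoC 0) = RtoC 0 ->
  (forall z, inD z -> cder h z <> RtoC 0) ->
  (forall z, inD z -> Cmod (dilatation h g z) < 1) ->
  (* uniformly locally univalent *)
  uniformly_locally_univalent (harm h g) ->
  (* w in B_p and ||w|| = sup_D |w| < 1 *)
  in_Besov p (dilatation h g) ->
  (exists c : R, c < 1 /\ forall z, inD z -> Cmod (dilatation h g z) <= c) ->
  (* F = log J_f in B~_p *)
  in_Besov_tilde p (logJ h g) ->
  I_f_finite p h g.
Proof.
intros Hp Hh Hg _ _ Hh0 Hw1 _ HB Hsup HF.
exact (BesovEstimates.schwarzian_finite Hp Hh Hg Hh0 Hw1 HB Hsup HF).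
Qed.
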